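(* Let $\{\xi_k\}_{k\ge1}$ be i.i.d. random vectors in $\mathbb R^d$, centered and with identity covariance matrix, and let $P_n$ be the distribution of $n^{-1/2}\sum_{k=1}^n\xi_k$. The following statements are equivalent: 1. There exists $n_0\in\mathbb N$ such that $[P_{n_0}]^{ac}$ is not the zero measure. 2. There exists a representation of $P_n$, $n\in\mathbb N$, in the form $P_n=Q_n+R_n$ with non-negative measures $Q_n,R_n$ such that (2i) $Q_n(dy)=q_n(y)\,dy$ and $\sup_{y\in\mathbb R^d}\left|q_n(y)-(2\pi)^{-d/2}e^{-\|y\|^2/2}\right|\to0$ as $n\to\infty$; (2ii) there exist constants $D,\rho>0$ such that $R_n(\mathbb R^d)\le De^{-\rho n}$ for all $n\in\mathbb N$.
   Context: For a measure $\mu$ on the Borel sets of $\mathbb R^d$, $\mu^{ac}$ denotes its absolutely continuous component with respect to Lebesgue measure on $\mathbb R^d$. *)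

(* Defs.v *)
From HB Require Import structures.
From mathcomp Require Import all_boot all_order all_algebra.
From mathcomp Require Import all_classical all_reals all_analysis.
From mathcomp Require Import measurable_realfun.

Set Implicit Arguments.
Unset Strict Implicit.
Unset Printing Implicit Defensive.

Import Order.TTheory GRing.Theory Num.Theory.
Import numFieldNormedType.Exports.

Local Open Scope classical_set_scope.
Local Open Scope ring_scope.

(* R^d is 'rV[R]_d with its Borel sigma-algebra. The topology is the library's
   one on matrices; its norm is the sup norm, so the Euclidean norm is [norm2]
   below. *)

Definition borel_rV_display : measure_display.
Proof. exact: default_measure_display. Qed.

Section borel_rV.
Context (R : realType) (d : nat).

Let borel0 : <<s @open 'rV[R]_d >> set0.
Proof. exact: sigma_algebra0. Qed.

Let borelC A : <<s @open 'rV[R]_d >> A -> <<s @open 'rV[R]_d >> (~` A).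
Proof. exact: sigma_algebraC. Qed.

Let borel_bigcup (F : (set 'rV[R]_d)^nat) :
  (forall i, <<s @open 'rV[R]_d >> (F i)) ->
  <<s @open 'rV[R]_d >> (\bigcup_i F i).
Proof. exact: sigma_algebra_bigcup. Qed.

HB.instance Definition _ := @isMeasurable.Build borel_rV_display
  'rV[R]_d <<s @open 'rV[R]_d >> borel0 borelC borel_bigcup.

End borel_rV.

Section borel_rV_lemmas.
Context (R : realType).

Lemma measurable_rV_coord d (i : 'I_d) :
  measurable_fun setT (fun x : 'rV[R]_d => x ord0 i).
Proof.
apply: (measurability _ (RGenOInfty.measurableE R)).
move=> _ [_ [x ->] <-]; rewrite setTI; apply: sub_sigma_algebra.
by apply: open_comp => [y _|]; [exact: coord_continuous|exact: interval_open].
Qed.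

Lemma open_rV_boxes d (A : set 'rV[R]_d) : open A ->
  let box (q : 'rV[rat]_d * nat) :=
    [set x : 'rV[R]_d | forall i, `|x ord0 i - ratr (q.1 ord0 i)| < q.2.+1%:R^-1] in
  A = \bigcup_(q in [set q | box q `<=` A]) box q.
Proof.
move=> oA box; apply/seteqP; split; last by move=> x [q /= qA] /qA.
move=> x Ax.
have /nbhs_ballP[e /= e0 eA] : nbhs x A by exact: open_nbhs_nbhs.
have [n ne] : exists n : nat, n.+1%:R^-1 < e / 2.
  have := near_infty_natSinv_lt (PosNum (divr_gt0 e0 (ltr0n _ 2))).
  by move=> [N _ /(_ N (leqnn _))]; exists N.
have n0 : 0 < n.+1%:R^-1 :> R by rewrite invr_gt0 ltr0n.
have /choice[q Hq] : forall i : 'I_d, exists r : rat,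
    `|x ord0 i - ratr r| < n.+1%:R^-1.
  move=> i; have : x ord0 i - n.+1%:R^-1 < x ord0 i + n.+1%:R^-1.
    by rewrite ltrD2l gtrN.
  move=> /rat_in_itvoo[r]; rewrite in_itv/= => /andP[r1 r2].
  by exists r; rewrite distrC ltr_distl r1.
exists (\row_i q i, n) => /=; last by move=> i; rewrite mxE.
move=> y /= yq; apply: eA; split => // j i.
rewrite (ord1 j) /ball/= [e]splitr.
rewrite -(subrK (ratr (q i)) (x ord0 i)) -addrA.
apply: (le_lt_trans (ler_normD _ _)); apply: ltrD.
  exact: lt_trans ne.
by rewrite distrC; have := yq i; rewrite mxE => /lt_trans; exact.
Qed.

Lemma measurable_rV d dT (T : measurableType dT) (f : T -> 'rV[R]_d) :
  (forall i, measurable_fun setT (fun w => f w ord0 i)) -> measurable_fun setT f.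
Proof.
move=> mf; apply: (measurability (@open 'rV[R]_d)) => //.
move=> _ [B oB <-]; rewrite setTI (open_rV_boxes oB) preimage_bigcup.
rewrite bigcup_mkcond; apply: countable_bigcupT_measurable => // q.
case: ifPn => // _; rewrite (_ : _ @^-1` _ = \bigcap_(i in [set: 'I_d])
    ((fun w => f w ord0 i) @^-1` ball (ratr (q.1 ord0 i) : R) q.2.+1%:R^-1)).
  apply: fin_bigcap_measurable => // i _; rewrite -[X in measurable X]setTI.
  by apply: mf => //; apply: open_measurable; exact: ball_open.
apply/seteqP; split=> [w /= h i _|w /= h i].
  by rewrite /ball/= distrC; exact: h.
by have := h i I; rewrite /ball/= distrC.
Qed.

End borel_rV_lemmas.

Section lebesgue_rV.
Context (R : realType).

Definition cons_rV d (p : measurableTypeR R * 'rV[R]_d) : 'rV[R]_d.+1 :=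
  row_mx ((p.1 : R)%:M : 'rV_1) p.2.

Definition uncons_rV d (x : 'rV[R]_d.+1) : measurableTypeR R * 'rV[R]_d :=
  (x ord0 ord0, rsubmx (x : 'rV_(1 + d))).

Lemma cons_rVK d : cancel (@cons_rV d) (@uncons_rV d).
Proof.
move=> [a v]; rewrite /uncons_rV /cons_rV row_mxKr; congr pair.
transitivity (row_mx (a%:M : 'rV_1) v ord0 (lshift d (@ord0 0))).
  by congr (row_mx _ _ _ _); exact/val_inj.
by rewrite row_mxEl mxE eqxx mulr1n.
Qed.

Lemma measurable_cons_rV d : measurable_fun setT (@cons_rV d).
Proof.
apply: measurable_rV => i; rewrite /cons_rV.
have -> : i = @unsplit 1 d (@fintype.split 1 d i) by rewrite splitK.
case: (@fintype.split 1 d i) => j /=.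
- rewrite (_ : (fun _ => _) = fst); first exact: measurable_fst.
  apply/funext => p; apply: etrans (@row_mxEl _ 1 1 d _ _ _ _) _.
  by rewrite (ord1 j) mxE eqxx mulr1n.
- rewrite (_ : (fun _ => _) = (fun x : 'rV[R]_d => x ord0 j) \o snd).
    by apply: measurableT_comp => //; exact: measurable_rV_coord.
  by apply/funext => p; exact: (@row_mxEr _ 1 1 d).
Qed.

Lemma measurable_uncons_rV d : measurable_fun setT (@uncons_rV d).
Proof.
apply/measurable_fun_pairP; split; first exact: measurable_rV_coord.
apply: measurable_rV => i.
rewrite (_ : (fun _ => _) = fun x : 'rV[R]_d.+1 => x ord0 (@rshift 1 d i)).
  exact: measurable_rV_coord.
by apply/funext => x; rewrite /= mxE.
Qed.

(* Lebesgue measure on R^d, as the iterated product of the one-dimensional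
   Lebesgue measure; Lebesgue measure on R^0 is the Dirac mass. *)
Section step.
Context (d : nat) (mu : {sigma_finite_measure set 'rV[R]_d -> \bar R}).

Definition lebesgue_rVS : set 'rV[R]_d.+1 -> \bar R :=
  pushforward (lebesgue_measure \x mu)%E (@cons_rV d).

Let lebesgue_rVS0 : lebesgue_rVS set0 = 0%E.
Proof. by apply: measure0; exact: measurable_cons_rV. Qed.

Let lebesgue_rVS_ge0 A : (0 <= lebesgue_rVS A)%E.
Proof. by apply: measure_ge0; exact: measurable_cons_rV. Qed.

Let lebesgue_rVS_sigma_additive : semi_sigma_additive lebesgue_rVS.
Proof. by apply: measure_semi_sigma_additive; exact: measurable_cons_rV. Qed.

HB.instance Definition _ := isMeasure.Build _ _ _ lebesgue_rVS
  lebesgue_rVS0 lebesgue_rVS_ge0 lebesgue_rVS_sigma_additive.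

Let lebesgue_rVS_sigma_finite : sigma_finite setT lebesgue_rVS.
Proof.
have /sigma_finiteP[F [TF ndF Foo]] := sigma_finiteT (@lebesgue_measure R).
have /sigma_finiteP[G [TG ndG Goo]] := sigma_finiteT mu.
exists (fun n => @uncons_rV d @^-1` (F n `*` G n)).
  rewrite -preimage_bigcup -(preimage_setT (@uncons_rV d)); congr (_ @^-1` _).
  rewrite -setXTT TF TG predeqE => -[x y]; split => [[[n _ Fnx] [k _ Gky]]|].
    exists (maxn n k) => //; split.
    - by have /subsetPset := ndF _ _ (leq_maxl n k); exact.
    - by have /subsetPset := ndG _ _ (leq_maxr n k); exact.
  by move=> [n _ [? ?]]; split; exists n.
move=> n; have [mF Foon] := Foo n; have [mG Goon] := Goo n; split.
  rewrite -[X in measurable X]setTI; apply: measurable_uncons_rV => //.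
  exact: measurableX.
rewrite /lebesgue_rVS /pushforward -comp_preimage.
rewrite (_ : _ \o _ = id); last by apply/funext; exact: cons_rVK.
by rewrite preimage_id product_measure1E// lte_mul_pinfty// ge0_fin_numE.
Qed.

HB.instance Definition _ := Measure_isSigmaFinite.Build _ _ _
  lebesgue_rVS lebesgue_rVS_sigma_finite.

End step.

Fixpoint lebesgue_rV d : {sigma_finite_measure set 'rV[R]_d -> \bar R} :=
  match d with
  | 0%N => [the {sigma_finite_measure set 'rV[R]_0 -> \bar R} of
               dirac (0 : 'rV[R]_0)]
  | d'.+1 => [the {sigma_finite_measure set 'rV[R]_d'.+1 -> \bar R} of
               lebesgue_rVS (lebesgue_rV d')]
  end.

Lemma lebesgue_rV_box d (A : 'I_d -> set R) : (forall i, measurable (A i)) ->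
  lebesgue_rV d [set x | forall i, A i (x ord0 i)] =
  (\prod_(i < d) lebesgue_measure (A i))%E.
Proof.
elim: d A => [|d IH] A mA.
  by rewrite big_ord0 /= diracE mem_set// => -[].
rewrite big_ord_recl -IH//= /lebesgue_rVS /pushforward.
have mB : measurable [set x : 'rV[R]_d | forall i, A (lift ord0 i) (x ord0 i)].
  rewrite (_ : [set x | _] = \bigcap_(i in [set: 'I_d])
      ((fun x : 'rV[R]_d => x ord0 i) @^-1` A (lift ord0 i))).
    apply: fin_bigcap_measurable => // i _; rewrite -[X in measurable X]setTI.
    by apply: measurable_rV_coord => //; exact: mA.
  by apply/seteqP; split=> [x /= h i _|x /= h i]; [exact: h|exact: (h i I)].
rewrite -product_measure1E//; last exact: mA.
congr (_ _); apply/seteqP; split=> -[a v] /=.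
- move=> h; split=> [|i].
    by have := h ord0; rewrite -[cons_rV _ _ _]/((uncons_rV _).1) cons_rVK.
  have := h (lift ord0 i); congr (A _ _).
  rewrite (_ : lift _ _ = @rshift 1 d i); last exact/val_inj.
  exact: (@row_mxEr _ 1 1 d).
- move=> [ha hv] i; case: (unliftP ord0 i) => [j ->|->].
    have := hv j; congr (A _ _).
    rewrite (_ : lift _ _ = @rshift 1 d j); last exact/val_inj.
    exact/esym/(@row_mxEr _ 1 1 d).
  by rewrite -[cons_rV _ _ _]/((uncons_rV _).1) cons_rVK.
Qed.

End lebesgue_rV.

Section absolutely_continuous_part.
Context dT (T : measurableType dT) (R : realType).

Definition mutually_singular (mu nu : set T -> \bar R) :=
  exists N, [/\ measurable N, mu N = 0%E & nu (~` N) = 0%E].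

(* [ac] is the absolutely continuous component of [mu] in its Lebesgue
   decomposition with respect to [leb]. *)
Definition is_ac_part (leb mu ac : set T -> \bar R) :=
  ac `<< leb /\
  exists s : {measure set T -> \bar R}, mutually_singular s leb /\
    (forall A, measurable A -> mu A = (ac A + s A)%E).

End absolutely_continuous_part.

Section random_vectors.
Context dT (T : measurableType dT) (R : realType) (P : probability T R) (d : nat).
Implicit Types xi : nat -> {RV P >-> 'rV[R]_d}.

Definition mutually_independent xi :=
  forall (J : seq nat) (A : nat -> set 'rV[R]_d), uniq J ->
    (forall k, measurable (A k)) ->
    P (\bigcap_(k in [set` J]) (xi k @^-1` A k)) =
    (\prod_(k <- J) P (xi k @^-1` A k))%E.

Definition identically_distributed xi :=
  forall j k A, measurable A -> distribution P (xi j) A = distribution P (xi k) A.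

Definition rv_coord (X : T -> 'rV[R]_d) (i : 'I_d) : T -> R :=
  fun w => X w ord0 i.

Definition square_integrable (X : T -> 'rV[R]_d) :=
  forall i, rv_coord X i \in Lfun P 2%:E.

Definition centered (X : T -> 'rV[R]_d) :=
  forall i, ('E_P[rv_coord X i] = 0)%E.

Definition identity_covariance (X : T -> 'rV[R]_d) :=
  forall i j, covariance P (rv_coord X i) (rv_coord X j) = ((i == j)%:R)%:E.

Definition normalized_sum xi (n : nat) : T -> 'rV[R]_d :=
  fun w => (Num.sqrt n%:R)^-1 *: \sum_(k < n) xi k w.

Lemma measurable_normalized_sum xi n : measurable_fun setT (normalized_sum xi n).
Proof.
apply: measurable_rV => i; rewrite /normalized_sum.
rewrite (_ : (fun _ => _) = fun w => (Num.sqrt n%:R)^-1 *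
    \sum_(k < n) (xi k w) ord0 i); last first.
  by apply/funext => w; rewrite mxE summxE.
apply: measurable_funM => //; apply: measurable_sum => k.
by apply: (measurableT_comp (measurable_rV_coord i)).
Qed.

HB.instance Definition _ xi n := isMeasurableFun.Build _ _ _ _
  (normalized_sum xi n) (measurable_normalized_sum xi n).

End random_vectors.

Section gaussian.
Context (R : realType) (d : nat).

Definition norm2 (y : 'rV[R]_d) : R := Num.sqrt (\sum_(i < d) y ord0 i ^+ 2).

Definition std_gauss_pdf (y : 'rV[R]_d) : R :=
  (2 * pi) `^ (- (d%:R / 2)) * expR (- (norm2 y ^+ 2 / 2)).

End gaussian.

(* Main.v *)
(* Suppose that some P_n0 has an absolutely continuous part. Then the law of a
   sum of 2 n0 steps dominates a multiple of a tent-like density G_1, because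
   the convolution of a set's indicator with itself is continuous. Expand the
   n-fold convolution: outside an event of exponentially small mass at least
   n / C of the factors are G_1, and their convolution is an interpolated
   binomial law, which at scale sqrt n is Lipschitz uniformly in n. So P_n is
   q_n dy + R_n with q_n uniformly Lipschitz and R_n exponentially small.
   Lindeberg's argument compares P_n convolved with the heat kernel h_t to
   h_(1+t), uniformly on R^d for each fixed t > 0. Since q_n is Lipschitz,
   convolving it with h_t moves it by O(sqrt t) only, so q_n is uniformly close
   to h_1.

   Conversely the Gaussian density is bounded below on a cube, so the density
   q_n is positive there for large n; the absolutely continuous part of P_n
   dominates q_n dy. *)
Require Import Defs.
From HB Require Import structures.
From mathcomp Require Import all_boot all_order all_algebra.
From mathcomp Require Import all_classical all_reals all_analysis.
From mathcomp Require Import measurable_realfun ring lra zify.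

Set Implicit Arguments.
Unset Strict Implicit.
Unset Printing Implicit Defensive.

Import Order.TTheory GRing.Theory Num.Theory.
Import numFieldNormedType.Exports.

Local Open Scope classical_set_scope.
Local Open Scope ring_scope.

(** * Integration on R^d *)

(** The obstacle is a Lipschitz bound that is uniform in n: a single smooth factor, seen at scale
    sqrt n, has a Lipschitz constant that grows with n. The number of smooth factors must therefore
    grow with n, and their convolution must stay computable. Tents allow this: [spline 1] convolved
    with [spline N] equals [spline 0] convolved with [spline N.+1], so the gained smoothness is
    gathered in one explicit binomial factor, while each leftover [spline 0] joins an otherwise
    arbitrary finite measure. That measure keeps mass at most 1 / [m0], and averaging over it
    multiplies the Lipschitz bound by no more than this mass. Measures are handled through their
    integrals of nonnegative functions, so that a density is constructed only at the end. In the
    comparison with the Gaussian, t is fixed first, small enough for the smoothing error and for the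
    passage from h_(1+t) to h_1; only then is n taken large, which makes small both the Lindeberg
    error and the peak of h_t times the mass of R_n. *)

Section image_measure.
Context d1 d2 (X : measurableType d1) (Y : measurableType d2) (R : realType).

(** Bundling the map with its measurability lets the measure structure be inferred without a side
    condition. *)
Definition image_measure (m : set X -> \bar R) (f : {mfun X >-> Y}) :
  set Y -> \bar R := pushforward m f.

Variables (m : {measure set X -> \bar R}) (f : {mfun X >-> Y}).

Let image0 : image_measure m f set0 = 0%E.
Proof. exact: measure0. Qed.

Let image_ge0 A : (0 <= image_measure m f A)%E.
Proof. exact: measure_ge0. Qed.

Let image_sigma_additive : semi_sigma_additive (image_measure m f).
Proof. exact: measure_semi_sigma_additive. Qed.

HB.instance Definition _ := isMeasure.Build _ _ _ (image_measure m f)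
  image0 image_ge0 image_sigma_additive.

Lemma ge0_integral_image_measure (g : Y -> \bar R) :
  measurable_fun setT g -> (forall y, 0 <= g y)%E ->
  (\int[image_measure m f]_y g y = \int[m]_x g (f x))%E.
Proof. by move=> mg g0; rewrite ge0_integral_pushforward//= => x _. Qed.

End image_measure.

Section rV_measurability.
Context (R : realType) (d : nat).

Lemma measurable_rV_affine (c : R) (b : 'rV[R]_d) :
  measurable_fun setT (fun x : 'rV[R]_d => c *: x + b).
Proof.
apply: measurable_rV => i.
rewrite (_ : (fun _ => _) = fun x : 'rV[R]_d => c * x ord0 i + b ord0 i).
  apply: measurable_funD => //; apply: measurable_funM => //.
  exact: measurable_rV_coord.
by apply/funext => x; rewrite !mxE.
Qed.

Lemma measurable_rV_shift (b : 'rV[R]_d) :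
  measurable_fun setT (fun x : 'rV[R]_d => x + b).
Proof.
rewrite (_ : (fun _ => _) = fun x : 'rV[R]_d => 1 *: x + b).
  exact: measurable_rV_affine.
by apply/funext => x; rewrite scale1r.
Qed.

Lemma measurable_rV_scale (c : R) :
  measurable_fun setT (fun x : 'rV[R]_d => c *: x).
Proof.
rewrite (_ : (fun _ => _) = fun x : 'rV[R]_d => c *: x + 0).
  exact: measurable_rV_affine.
by apply/funext => x; rewrite addr0.
Qed.

Lemma measurable_rV_add dT (T : measurableType dT) (f g : T -> 'rV[R]_d) :
  measurable_fun setT f -> measurable_fun setT g ->
  measurable_fun setT (fun w => f w + g w).
Proof.
move=> mf mg; apply: measurable_rV => i.
rewrite (_ : (fun _ => _) = fun w => f w ord0 i + g w ord0 i).
  by apply: measurable_funD; apply: (measurableT_comp (measurable_rV_coord i)).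
by apply/funext => x; rewrite !mxE.
Qed.

Lemma measurable_rV_lin dT (T : measurableType dT) (c : R)
    (f : T -> 'rV[R]_d) :
  measurable_fun setT f -> measurable_fun setT (fun w => c *: f w).
Proof.
by move=> mf; apply: (measurableT_comp (measurable_rV_scale c)).
Qed.

End rV_measurability.

Section lebesgue_affine.
Context (R : realType).
Local Notation leb := (@lebesgue_measure R).
Local Open Scope ereal_scope.

(** Uniqueness of Lebesgue measure: c times the image measure gives each half-open interval its
    length. *)
Lemma lebesgue_measure_affine (c b : R) (A : set (measurableTypeR R)) : (0 < c)%R ->
  measurable A ->
  leb A = c%:E * leb [set x | A (c * x + b)%R].
Proof.
move=> c0 mA.
pose f (x : measurableTypeR R) : measurableTypeR R := (c * x + b)%R.
have mf : measurable_fun setT f.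
  by apply: measurable_funD => //; exact: measurable_funM.
pose C := NngNum (ltW c0).
pose f' : {mfun _ >-> _} := HB.pack f (isMeasurableFun.Build _ _ _ _ _ mf).
pose m : {measure set (measurableTypeR R) -> \bar R} :=
  mscale C (image_measure leb f').
rewrite (_ : _ * _ = m A)//.
apply: lebesgue_measure_unique => // _ [[x y] /= _ <-].
rewrite /m /mscale/= /image_measure /pushforward.
rewrite (_ : f @^-1` _ = `](x - b) / c, (y - b) / c]%classic)%R; last first.
  apply/seteqP; split=> t; rewrite /f/= !in_itv/=;
    by rewrite ltr_pdivrMr// ler_pdivlMr// ltrBlDr lerBrDr [(t * c)%R]mulrC.
rewrite !lebesgue_measure_itv/= !lte_fin ltr_pM2r ?invr_gt0// ltrD2r.
case: ifPn => _; last by rewrite mule0.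
rewrite -!EFinD -EFinM -mulrBl; congr EFin.
have c1 := lt0r_neq0 c0; field.
exact: c1.
Qed.

Lemma ge0_integral_lebesgue_affine (c b : R) (f : measurableTypeR R -> \bar R) : (0 < c)%R ->
  measurable_fun setT f -> (forall x, 0 <= f x) ->
  \int[leb]_x f x = c%:E * \int[leb]_x f (c * x + b)%R.
Proof.
move=> c0 mf f0.
pose g (x : measurableTypeR R) : measurableTypeR R := (c * x + b)%R.
have mg : measurable_fun setT g.
  by apply: measurable_funD => //; exact: measurable_funM.
pose C := NngNum (ltW c0).
pose g' : {mfun _ >-> _} := HB.pack g (isMeasurableFun.Build _ _ _ _ _ mg).
transitivity (\int[mscale C (image_measure leb g')]_x f x).
  by apply: eq_measure_integral => A mA _; exact: lebesgue_measure_affine.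
rewrite ge0_integral_mscale//=; congr (_ * _).
by rewrite ge0_integral_image_measure.
Qed.

End lebesgue_affine.

Section lebesgue_rV_integral.
Context (R : realType).
Local Notation leb := (lebesgue_rV R).
Local Open Scope ereal_scope.

Lemma ge0_integral_lebesgue_rVS d (f : 'rV[R]_d.+1 -> \bar R) :
  measurable_fun setT f -> (forall x, 0 <= f x) ->
  \int[leb d.+1]_x f x =
  \int[lebesgue_measure]_t \int[leb d]_v f (cons_rV (t, v)).
Proof.
move=> mf f0 /=; rewrite /lebesgue_rVS.
rewrite ge0_integral_pushforward//=; last exact: measurable_cons_rV.
rewrite -(@fubini_tonelli1 _ _ _ _ _ lebesgue_measure (leb d)
  (f \o @cons_rV R d))//.
- apply: measurableT_comp => //; exact: measurable_cons_rV.
- by move=> x; exact: f0.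
Qed.

Lemma cons_rV_0 d (t : R) (v : 'rV[R]_d) : cons_rV (t, v) ord0 ord0 = t.
Proof. by rewrite -[LHS]/((uncons_rV _).1) cons_rVK. Qed.

Lemma cons_rV_lift d (t : R) (v : 'rV[R]_d) i :
  cons_rV (t, v) ord0 (lift ord0 i) = v ord0 i.
Proof.
rewrite (_ : lift _ _ = @rshift 1 d i); last exact/val_inj.
exact: (@row_mxEr _ 1 1 d).
Qed.


Lemma cons_rV_affine d (c t b0 : R) (v b : 'rV[R]_d) :
  (c *: cons_rV (t, v) + cons_rV (b0, b) = cons_rV (c * t + b0, c *: v + b))%R.
Proof.
apply/rowP => i; case: (unliftP ord0 i) => [j|] ->.
  by rewrite 2![in LHS]mxE !cons_rV_lift !mxE.
by rewrite 2![in LHS]mxE !cons_rV_0.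
Qed.

Lemma uncons_rVK d : cancel (@uncons_rV R d) (@cons_rV R d).
Proof.
move=> x; apply/rowP => i; case: (unliftP ord0 i) => [j|] ->.
  rewrite cons_rV_lift mxE; congr (x _ _); exact/val_inj.
by rewrite cons_rV_0.
Qed.

Lemma measurable_integral_rV d dT (T : measurableType dT)
    (f : T * 'rV[R]_d -> \bar R) :
  measurable_fun setT f -> (forall x, 0 <= f x) ->
  measurable_fun setT (fun t => \int[leb d]_v f (t, v)).
Proof. by move=> mf f0; exact: measurable_fun_fubini_tonelli_F. Qed.

(** Induction on the dimension: the affine map acts separately on the first coordinate and on the
    others, and each coordinate contributes one factor c. *)
Lemma ge0_integral_rV_affine d (c : R) (b : 'rV[R]_d) (f : 'rV[R]_d -> \bar R) :
  (0 < c)%R -> measurable_fun setT f -> (forall x, 0 <= f x) ->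
  \int[leb d]_x f x = (c ^+ d)%:E * \int[leb d]_x f (c *: x + b)%R.
Proof.
move=> c0; elim: d => [|d IH] in b f *; move=> mf f0.
  rewrite expr0 mul1e !integral_dirac//=; last first.
    by apply: measurableT_comp => //; exact: measurable_rV_affine.
  rewrite !diracT !mul1e; congr f; apply/rowP; case=> //.
rewrite ge0_integral_lebesgue_rVS// [in RHS]ge0_integral_lebesgue_rVS//; last 1 first.
  by apply: measurableT_comp => //; exact: measurable_rV_affine.
have mfc : measurable_fun setT (f \o @cons_rV R d).
  by apply: measurableT_comp => //; exact: measurable_cons_rV.
rewrite -(uncons_rVK b); case: (uncons_rV b) => b0 b'.
rewrite [LHS](@ge0_integral_lebesgue_affine _ c b0)//; last 2 first.
- apply: (measurable_integral_rV mfc) => x; exact: f0.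
- by move=> x; exact: integral_ge0.
rewrite exprS EFinM -muleA; congr (_ * _).
rewrite -ge0_integralZl//; last 3 first.
- have mfa : measurable_fun setT
      (fun p => f (c *: @cons_rV R d p + cons_rV (b0, b'))%R).
    apply: (measurableT_comp mf).
    apply: (measurableT_comp (measurable_rV_affine c _)).
    exact: measurable_cons_rV.
  by apply: (measurable_integral_rV mfa) => x; exact: f0.
- by move=> *; exact: integral_ge0.
- by rewrite lee_fin exprn_ge0// ltW.
apply: eq_integral => t _; rewrite (IH b')//.
  by congr (_ * _); apply: eq_integral => v _; rewrite cons_rV_affine.
exact: (measurableT_comp mfc (measurable_pair1 _)).
Qed.

Lemma ge0_integral_rV_shift d (b : 'rV[R]_d) (f : 'rV[R]_d -> \bar R) :
  measurable_fun setT f -> (forall x, 0 <= f x) ->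
  \int[leb d]_x f x = \int[leb d]_x f (x + b)%R.
Proof.
move=> mf f0; rewrite (@ge0_integral_rV_affine _ 1 b)// expr1n mul1e.
by under eq_integral do rewrite scale1r.
Qed.

Lemma measurable_prod_coord d (f : 'I_d -> R -> R) :
  (forall i, measurable_fun setT (f i)) ->
  measurable_fun setT (fun x : 'rV[R]_d => (\prod_i f i (x ord0 i))%R).
Proof.
move=> mf; apply: measurable_prod => i _.
apply: measurableT_comp; [exact: mf|exact: measurable_rV_coord].
Qed.

Lemma integral_rV_prod d (f : 'I_d -> R -> R) :
  (forall i, measurable_fun setT (f i)) -> (forall i x, 0 <= f i x)%R ->
  \int[leb d]_x (\prod_i f i (x ord0 i))%:E =
  \prod_i \int[lebesgue_measure]_t (f i t)%:E.
Proof.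
elim: d => [|d IH] in f *; move=> mf f0.
  rewrite big_ord0 integral_dirac//= ?diracT ?mul1e ?big_ord0//.
  by apply/measurable_EFinP; apply: (measurable_prod_coord (fun i => mf _)).
rewrite ge0_integral_lebesgue_rVS//; last 2 first.
- by apply/measurable_EFinP; apply: (measurable_prod_coord (fun i => mf _)).
- by move=> x; rewrite lee_fin; apply: prodr_ge0.
rewrite big_ord_recl -IH//.
rewrite -ge0_integralZr//; last 3 first.
- by apply/measurable_EFinP; exact: mf.
- by move=> t _; rewrite lee_fin.
- by apply: integral_ge0 => x _; rewrite lee_fin prodr_ge0.
apply: eq_integral => t _; rewrite -ge0_integralZl//; last 3 first.
- by apply/measurable_EFinP; apply: (measurable_prod_coord (fun i => mf _)).
- by move=> x _; rewrite lee_fin prodr_ge0.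
- by rewrite lee_fin.
apply: eq_integral => v _; rewrite big_ord_recl cons_rV_0 EFinM.
by congr (_ * (_)%:E); apply: eq_bigr => i _; rewrite cons_rV_lift.
Qed.

End lebesgue_rV_integral.

(** * Interpolated binomial laws *)

Section interpolation.
Context (R : realType).
Implicit Types (b : int -> R) (x y D : R).

(** The sum over z of b z times the unit tent at x - z; only the two integers around x
    contribute. *)
Definition interp b x : R :=
  let f := Num.floor x in (1 - (x - f%:~R)) * b f + (x - f%:~R) * b (f + 1).

Let floor_frac x : 0 <= x - (Num.floor x)%:~R <= 1.
Proof.
have /andP[h1] := floor_itv x; rewrite intrD => h2.
by rewrite subr_ge0 h1 /= lerBlDl ltW.
Qed.

Lemma interpD b c x : interp (b \+ c) x = interp b x + interp c x.
Proof. by rewrite /interp/=; ring. Qed.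

Lemma interpZ (k : R) b x : interp (fun z => k * b z) x = k * interp b x.
Proof. by rewrite /interp/=; ring. Qed.

Lemma interp_shift b (k : int) x :
  interp b (x + k%:~R) = interp (fun z => b (z + k)) x.
Proof.
rewrite /interp; have -> : Num.floor (x + k%:~R) = Num.floor x + k.
  by rewrite floorDrz ?rpred_int// intrKfloor.
have -> : x + k%:~R - (Num.floor x + k)%:~R = x - (Num.floor x)%:~R.
  by rewrite intrD; ring.
by rewrite [Num.floor x + k + 1]addrAC.
Qed.

Lemma interp_ge0 b x : (forall z, 0 <= b z) -> 0 <= interp b x.
Proof.
move=> b0; have /andP[h1 h2] := floor_frac x.
by rewrite addr_ge0// mulr_ge0// subr_ge0.
Qed.

Lemma interp_le b x M : (forall z, b z <= M) -> interp b x <= M.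
Proof.
move=> bM; have /andP[h1 h2] := floor_frac x; rewrite /interp.
move: (x - _) h1 h2 => t h1 h2; set u := b _; set v := b _.
have uM : 0 <= (1 - t) * (M - u).
  by apply: mulr_ge0; rewrite subr_ge0 ?bM.
have vM : 0 <= t * (M - v).
  by apply: mulr_ge0; rewrite ?subr_ge0 ?bM.
by rewrite -subr_ge0 (_ : _ - _ = (1 - t) * (M - u) + t * (M - v)) ?addr_ge0//; ring.
Qed.

Lemma interp_lipschitz b D x y : (forall z, `|b (z + 1) - b z| <= D) ->
  `|interp b x - interp b y| <= D * `|x - y|.
Proof.
move=> bD; wlog xy : x y / x <= y.
  move=> h; have [/h//|/ltW/h] := leP x y.
  by rewrite distrC [in leRHS]distrC.
rewrite [in leRHS]distrC (ger0_norm (_ : 0 <= y - x)) ?subr_ge0//.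
have D0 : 0 <= D := le_trans (normr_ge0 _) (bD 0).
have : Num.floor x <= Num.floor y by exact: le_floor.
rewrite le_eqVlt => /predU1P[fxy|].
  rewrite /interp fxy; set f := Num.floor y.
  rewrite (_ : _ - _ = (x - y) * (b (f + 1) - b f)); last by ring.
  rewrite normrM distrC (ger0_norm (_ : 0 <= y - x)) ?subr_ge0//.
  by rewrite mulrC ler_wpM2r// subr_ge0.
move=> fxy.
have chain (f : int) (n : nat) : `|b (f + n%:Z) - b f| <= D * n%:R.
  elim: n => [|n IH]; first by rewrite addr0 subrr normr0 mulr0.
  rewrite -natr1 mulrDr mulr1 [leRHS]addrC.
  rewrite (_ : b _ - b f = (b (f + n%:Z + 1) - b (f + n%:Z)) + (b (f + n%:Z) - b f)).
    by apply: (le_trans (ler_normD _ _)); apply: lerD.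
  by rewrite subrKA -addrA -[n.+1]addn1 PoszD.
have [n gE] : exists n : nat, Num.floor y = Num.floor x + 1 + n%:Z.
  exists (absz (Num.floor y - (Num.floor x + 1))%R).
  by move: fxy; lia.
have /andP[hx1 hx2] := floor_frac x; have /andP[hy1 hy2] := floor_frac y.
have := chain (Num.floor x + 1) n; rewrite -gE.
have := bD (Num.floor x); have := bD (Num.floor y).
have : (Num.floor y)%:~R = (Num.floor x)%:~R + 1 + n%:R :> R.
  by rewrite gE !intrD.
rewrite /interp.
move: (Num.floor x)%:~R (Num.floor y)%:~R hx1 hx2 hy1 hy2 => fx fy hx1 hx2 hy1 hy2 fyE.
move: (b (Num.floor x)) (b (Num.floor x + 1)) (b (Num.floor y)) (b (Num.floor y + 1)).
move=> b1 b2 b3 b4 d1 d2 d3.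
(* Three pieces: from x up to the next integer, between integers (bounded by [chain]), and from the
   last integer to y. *)
rewrite (_ : _ - _ = - ((1 - (x - fx)) * (b2 - b1)) + (- (b3 - b2) - (y - fy) * (b4 - b3))); last first.
  by ring.
apply: (le_trans (ler_normD _ _)); rewrite normrN.
apply: (@le_trans _ _ ((1 - (x - fx)) * D + (D * n%:R + (y - fy) * D))).
  apply: lerD.
    rewrite normrM ger0_norm ?subr_ge0//.
    by rewrite ler_wpM2l// subr_ge0.
  apply: (le_trans (ler_normB _ _)); rewrite normrN; apply: lerD => //.
  by rewrite normrM ger0_norm// ler_wpM2l.
by rewrite fyE le_eqVlt; apply/orP; left; apply/eqP; ring.
Qed.

End interpolation.

Section binomial_walk.
Context (R : realType).

(** From N to N + 1 the left side is multiplied by (2N + 1)(2N + 3) / (2N + 2)^2, which is below 1.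
    This gives the rate N^(-1/2) of the central weight without Stirling's formula. *)
Lemma central_bin_le (N : nat) :
  ('C(N.*2, N)%:R / 4 ^+ N) ^+ 2 * (N.*2.+1)%:R <= 1 :> R.
Proof.
elim: N => [|N IH]; first by rewrite bin0 expr0 divr1 expr1n mul1r.
set c := _ / _ in IH.
have cE : 'C(N.+1.*2, N.+1)%:R / 4 ^+ N.+1 =
    c * ((N.*2.+1)%:R / (N.*2.+2)%:R) :> R.
  have h1 : (N.+1 * 'C(N.*2.+2, N.+1) = N.*2.+2 * 'C(N.*2.+1, N))%N.
    by rewrite mul_bin_diag.
  have h2 : (N.+1 * 'C(N.*2.+1, N) = N.*2.+1 * 'C(N.*2, N))%N.
    have := mul_bin_down N.*2.+1 N; rewrite /=.
    by rewrite (_ : (N.*2.+1 - N = N.+1)%N)//; lia.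
  have h3 : (N.+1 * 'C(N.*2.+2, N.+1) = 2 * (N.*2.+1 * 'C(N.*2, N)))%N.
    by rewrite h1 -h2; lia.
  have {}h3 : N.+1%:R * 'C(N.*2.+2, N.+1)%:R = 2 * ((N.*2.+1)%:R * 'C(N.*2, N)%:R) :> R.
    by rewrite -!natrM h3.
  have N2 : (N.*2.+2)%:R = 2 * N.+1%:R :> R by rewrite -natrM; congr (_%:R); lia.
  have N0 : N.+1%:R != 0 :> R by rewrite pnatr_eq0.
  rewrite /c N2 doubleS exprS.
  have p0 : 4 ^+ N != 0 :> R by rewrite expf_neq0.
  apply: (mulfI N0); rewrite [LHS]mulrA h3.
  move: (N.+1%:R) N0 (4 ^+ N) p0 => m m0 p p0; field.
  by rewrite ?p0 ?m0.
rewrite cE.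
have k0 : 0 <= N%:R :> R by [].
have E1 : (N.*2.+1)%:R = 2 * N%:R + 1 :> R by rewrite -natr1 -muln2 natrM; ring.
have E2 : (N.*2.+2)%:R = 2 * N%:R + 2 :> R by rewrite -natr1 E1; ring.
have E3 : (N.+1.*2.+1)%:R = 2 * N%:R + 3 :> R by rewrite doubleS -natr1 E2; ring.
rewrite E1 E2 E3 in IH *.
have E20 : 2 * N%:R + 2 != 0 :> R by lra.
rewrite (_ : _ * _ = (c ^+ 2 * (2 * N%:R + 1)) *
   (((2 * N%:R + 1) * (2 * N%:R + 3)) / (2 * N%:R + 2) ^+ 2)); last by field.
have q1 : 0 <= c ^+ 2 * (2 * N%:R + 1) by apply: mulr_ge0; [exact: sqr_ge0|lra].
have q2 : 0 <= (2 * N%:R + 1) * (2 * N%:R + 3) / (2 * N%:R + 2) ^+ 2 :> R.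
  by apply: divr_ge0; [apply: mulr_ge0; lra|exact: sqr_ge0].
apply: (mulr_ile1 q1 q2 IH).
rewrite ler_pdivrMr ?mul1r; first by rewrite expr2; nra.
by rewrite exprn_gt0//; lra.
Qed.

(** The law of half the sum of 2N fair signs; the symmetry in z keeps the binomial index a natural
    number. *)
Definition walk (N : nat) (z : int) : R := 'C(N.*2, (N + `|z|)%N)%:R / 4 ^+ N.

Lemma walk_ge0 N z : 0 <= walk N z.
Proof. by rewrite divr_ge0// exprn_ge0. Qed.

Lemma walk0_le1 z : walk 0 z <= 1.
Proof. by rewrite /walk divr1; case: z => [[|n]|n]. Qed.

Lemma walk0_eq0 z : z != 0 -> walk 0 z = 0.
Proof. by rewrite /walk divr1; case: z => [[|n]|n]. Qed.

(** Two more fair steps, that is Pascal's rule applied twice. *)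
Lemma walkS N z :
  walk N.+1 z = (walk N (z + -1) + 2 * walk N z + walk N (z + 1)) / 4.
Proof.
have H n : ('C(N.*2.+2, N.+2 + n) =
   'C(N.*2, N + n) + 2 * 'C(N.*2, N + n.+1) + 'C(N.*2, N + n.+2))%N.
  by rewrite !addnS !addSn !binS; lia.
(* At z = 0 both neighbours have index N + 1, so the lower index that Pascal's rule produces is
   reflected by [bin_sub]. *)
have H0 : ('C(N.*2.+2, N.+1) = 2 * 'C(N.*2, N) + 2 * 'C(N.*2, N.+1))%N.
  case: N {H} => [|N]//.
  have N2 : (N <= N.*2.+2)%N by lia.
  have := bin_sub N2; rewrite (_ : (N.*2.+2 - N = N.+2)%N); last by lia.
  by rewrite doubleS (binS N.*2.+3 N.+1) !(binS N.*2.+2); lia.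
rewrite /walk exprS invfM doubleS.
suff -> : 'C(N.*2.+2, N.+1 + `|z|)%:R = ('C(N.*2, N + `|z + -1|)%:R +
    2 * 'C(N.*2, N + `|z|)%:R + 'C(N.*2, N + `|z + 1|)%:R) :> R by ring.
rewrite -natrM -!natrD; congr (_%:R).
case: z => [[|n]|n].
- rewrite (_ : absz (0%:Z - 1)%R = 1%N)// (_ : absz (0%:Z + 1)%R = 1%N)//=.
  by rewrite !addn0 H0 addn1; lia.
- rewrite (_ : absz (n.+1%:Z - 1)%R = n); last by lia.
  rewrite (_ : absz (n.+1%:Z + 1)%R = n.+2); last by lia.
  by rewrite /= -H !addnS !addSn.
- rewrite (_ : absz (Negz n - 1)%R = n.+2); last by lia.
  rewrite (_ : absz (Negz n + 1)%R = n); last by lia.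
  rewrite (_ : absz (Negz n) = n.+1)//.
  by rewrite (_ : (N.+1 + n.+1 = N.+2 + n)%N) ?H; lia.
Qed.

(** A rational substitute for the Gaussian decay of the binomial weights, obtained from the ratio (N
    - x) / (N + x + 1) of consecutive ones. It is strong enough for the O(1/N) bound on
    differences. *)
Lemma bin_decay (N x : nat) :
  'C(N.*2, N + x)%:R * (N%:R + x%:R ^+ 2) <= N%:R * 'C(N.*2, N)%:R :> R.
Proof.
elim: x => [|x IH]; first by rewrite addn0 expr0n addr0 mulrC.
have [xN|Nx] := leqP N x.
  by rewrite bin_small ?mul0r ?mulr_ge0//; lia.
have := mul_bin_left N.*2 (N + x).
rewrite (_ : (N.*2 - (N + x) = N - x)%N); last by lia.
move/(congr1 (fun n => n%:R : R)); rewrite !natrM natrB ?(ltnW Nx)// -natr1 natrD.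
rewrite addnS -[x.+1%:R]natr1.
set C := 'C(_, N + x)%:R in IH *; set C' := 'C(_, _.+1)%:R; set C0 := 'C(_, N)%:R in IH *.
have C'0 : 0 <= C' by [].
have Cge0 : 0 <= C by [].
have C00 : 0 <= C0 by [].
have x0 : 0 <= x%:R :> R by [].
have {Nx}Nx : x%:R < N%:R :> R by rewrite ltr_nat.
move: N%:R x%:R x0 Nx IH => n y y0 yn IH E.
have n0 : 0 < n by lra.
have q0 : 0 < (n + y + 1) * (n + y ^+ 2) by rewrite mulr_gt0// ?ltr_wpDr ?sqr_ge0//; lra.
rewrite -(ler_pM2l q0).
have -> : (n + y + 1) * (n + y ^+ 2) * (C' * (n + (y + 1) ^+ 2)) =
   (n + y ^+ 2) * (n + (y + 1) ^+ 2) * ((n + y + 1) * C') by ring.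
rewrite E.
have -> : (n + y ^+ 2) * (n + (y + 1) ^+ 2) * ((n - y) * C) =
   (n - y) * (n + (y + 1) ^+ 2) * (C * (n + y ^+ 2)) by ring.
apply: (@le_trans _ _ ((n - y) * (n + (y + 1) ^+ 2) * (n * C0))).
  apply: ler_wpM2l => //; apply: mulr_ge0; first lra.
  by rewrite addr_ge0 ?sqr_ge0// ltW.
rewrite ler_wpM2r// ?mulr_ge0 ?(ltW n0)//.
rewrite -subr_ge0.
have -> : (n + y + 1) * (n + y ^+ 2) - (n - y) * (n + (y + 1) ^+ 2) =
   2 * y ^+ 3 + 3 * y ^+ 2 + y by ring.
by rewrite !addr_ge0// mulr_ge0// exprn_ge0.
Qed.

Lemma walk_le (N : nat) z : (0 < N)%N -> walk N z <= (Num.sqrt N%:R)^-1.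
Proof.
move=> N0; have n0 : 0 < N%:R :> R by rewrite ltr0n.
have := bin_decay N `|z|; have := central_bin_le N.
rewrite /walk; set C := 'C(_, N + _)%:R; set C0 := 'C(_, N)%:R => h1 h2.
have C00 : 0 <= C0 by [].
have Cge0 : 0 <= C by [].
have CC : C <= C0.
  rewrite -(ler_pM2l n0); apply: le_trans h2.
  by rewrite mulrC ler_wpM2l// lerDl sqr_ge0.
apply: (@le_trans _ _ (C0 / 4 ^+ N)).
  by rewrite ler_wpM2r// invr_ge0 exprn_ge0.
rewrite -[leRHS]mul1r ler_pdivlMr ?sqrtr_gt0//.
rewrite -(@ler_pXn2r _ 2)// ?nnegrE ?mulr_ge0 ?sqrtr_ge0 ?invr_ge0 ?exprn_ge0//.
rewrite exprMn sqr_sqrtr// expr1n; apply: le_trans h1.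
by rewrite ler_wpM2l ?sqr_ge0// ler_nat -muln2; lia.
Qed.

(** Consecutive weights differ by (2x + 1) / (N + x + 1) times the larger one. By [bin_decay] the
    larger weight times 2x + 1 is at most the central weight times sqrt N + 1, and the central
    weight is at most 1 / sqrt N, so that 1/N remains. *)
Lemma walk_diff_le (N : nat) z : (0 < N)%N ->
  `|walk N (z + 1) - walk N z| <= 2 / N%:R.
Proof.
move=> N0.
suff H n : `|walk N n.+1%:Z - walk N n%:Z| <= 2 / N%:R.
  case: z => n; first by rewrite -PoszD addn1.
  rewrite NegzE (_ : - n.+1%:Z + 1 = - n%:Z); last by lia.
  by rewrite /walk !abszN distrC; exact: H.
have n0 : 0 < N%:R :> R by rewrite ltr0n.
have C0N : 'C(N.*2, N)%:R / 4 ^+ N * Num.sqrt N%:R <= 1 :> R.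
  have := walk_le 0 N0; rewrite /walk addn0 -[leRHS]mul1r.
  by rewrite ler_pdivlMr ?sqrtr_gt0.
have := mul_bin_left N.*2 (N + n); have := bin_decay N n.
rewrite /walk/= addnS => h1 h2.
have {}h2 : (N%:R + n%:R + 1) * 'C(N.*2, (N + n).+1)%:R =
    (N%:R - n%:R) * 'C(N.*2, N + n)%:R :> R.
  have [nN|Nn] := leqP n N.
    move: h2; rewrite (_ : (N.*2 - (N + n) = N - n)%N); last by lia.
    move/(congr1 (fun n => n%:R : R)); rewrite !natrM natrB// -natr1 natrD.
    by [].
  by rewrite !bin_small ?mulr0//; lia.
have s0 : 0 < Num.sqrt N%:R :> R by rewrite sqrtr_gt0.
have s1 : 1 <= Num.sqrt N%:R :> R by rewrite -[leLHS]sqrtr1 ler_wsqrtr ?ler1n.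
have sE : N%:R = Num.sqrt N%:R ^+ 2 :> R by rewrite sqr_sqrtr.
have y0 : 0 <= n%:R :> R by [].
have p0 : 0 < 4 ^+ N :> R by rewrite exprn_gt0.
have Cge0 : 0 <= 'C(N.*2, N + n)%:R :> R by [].
have C0ge0 : 0 <= 'C(N.*2, N)%:R :> R by [].
rewrite -mulrBl normrM normfV (ger0_norm (ltW p0)).
move: h1 h2 C0N Cge0 C0ge0; move: ('C(_, N + n)%:R) ('C(_, _.+1)%:R) ('C(_, N)%:R).
move: (4 ^+ N) p0 n%:R y0 => p p0 y y0.
move: (N%:R) n0 (Num.sqrt _) s0 s1 sE => m m0 s s0 s1 sE C C' C0 h1 h2 h3 Cge0 C0ge0.
have CE : C - C' = C * (2 * y + 1) / (m + y + 1).
  have z0 : m + y + 1 != 0 by lra.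
  apply: (mulfI z0); rewrite mulrBr h2; field.
  exact: z0.
rewrite distrC CE ger0_norm; last by rewrite divr_ge0// ?mulr_ge0//; lra.
(* [2 y s <= s^2 + y^2], so [C (2 y + 1)] is at most [C0 (s + 1)] *)
have key : C * (2 * y + 1) <= C0 * (s + 1).
  have q0 : 0 < m + y ^+ 2 by rewrite ltr_wpDr ?sqr_ge0.
  rewrite -(ler_pM2l q0).
  apply: (@le_trans _ _ (m * C0 * (2 * y + 1))).
    rewrite [leLHS](_ : _ = C * (m + y ^+ 2) * (2 * y + 1)); last by ring.
    by rewrite ler_wpM2r//; lra.
  rewrite [leLHS](_ : _ = C0 * (m * (2 * y + 1))); last by ring.
  rewrite [leRHS](_ : _ = C0 * ((m + y ^+ 2) * (s + 1))); last by ring.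
  apply: ler_wpM2l => //; rewrite sE.
  have := sqr_ge0 (s - y); have := sqr_ge0 y; rewrite !expr2 => a1 a2.
  nra.
have c1 : C0 <= p / s by rewrite ler_pdivlMr// -(ler_pM2r (_ : 0 < p^-1)) ?invr_gt0// mulrAC divff ?gt_eqF.
rewrite ler_pdivrMr// ler_pdivrMr//; last by lra.
apply: (le_trans key); apply: (@le_trans _ _ (p / s * (s + 1))).
  by rewrite ler_wpM2r//; lra.
apply: (@le_trans _ _ (2 * p)).
  rewrite mulrDr divfK ?gt_eqF// mulr1 (_ : 2 * p = p + p); last by ring.
  rewrite lerD2l ler_pdivrMr// ler_peMr//; exact: ltW.
rewrite [leRHS](_ : _ = 2 * p * ((m + y + 1) / m)); last by ring.
rewrite ler_peMr//; first by lra.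
by rewrite ler_pdivlMr// mul1r; lra.
Qed.

End binomial_walk.

Section spline.
Context (R : realType) (w : R).
Hypothesis w0 : 0 < w.
Local Notation leb := (@lebesgue_measure R).

(* The binomial law of 2N fair steps of size w/2 convolved with a tent of
   half-width w. By [spline_conv] each convolution with [spline 1] raises N by
   one, and the sup and Lipschitz bounds have the orders N^-1/2 and N^-1 that
   the scaling of a local limit theorem requires. *)
Definition spline (N : nat) (t : R) : R := interp (walk R N) (t / w).

Lemma spline_ge0 N t : 0 <= spline N t.
Proof. by apply: interp_ge0 => z; exact: walk_ge0. Qed.

Lemma spline_le N t : (0 < N)%N -> spline N t <= (Num.sqrt N%:R)^-1.
Proof. by move=> N0; apply: interp_le => z; exact: walk_le. Qed.

Lemma spline_lipschitz N s t : (0 < N)%N ->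
  `|spline N s - spline N t| <= 2 / N%:R / w * `|s - t|.
Proof.
move=> N0; apply: (le_trans (interp_lipschitz _ _ (fun z => walk_diff_le _ z N0))).
by rewrite -mulrBl normrM normfV (ger0_norm (ltW w0)) [`|_| / w]mulrC mulrA.
Qed.

Lemma splineS N t :
  spline N.+1 t = (spline N (t - w) + 2 * spline N t + spline N (t + w)) / 4.
Proof.
have wE : w / w = 1 by rewrite divff ?gt_eqF.
rewrite /spline [(t - w) / w]mulrBl [(t + w) / w]mulrDl wE.
have := interp_shift (walk R N) 1 (t / w).
have := interp_shift (walk R N) (-1) (t / w).
rewrite mulrN1z mulr1z => -> ->.
rewrite -interpZ -!interpD [RHS]mulrC -interpZ; congr interp.
by apply/funext => z; rewrite walkS /= mulrC.
Qed.

Lemma spline0_le1 t : spline 0 t <= 1.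
Proof. by apply: interp_le => z; exact: walk0_le1. Qed.

Lemma spline0_eq0 t : w <= `|t| -> spline 0 t = 0.
Proof.
rewrite /spline /interp => wt.
have {wt} : 1 <= `|t / w|.
  by rewrite normrM normfV (gtr0_norm w0) ler_pdivlMr// mul1r.
move: (t / w) => x x1.
have /andP[h1 h2] := floor_itv x.
have [f0|f0] := eqVneq (Num.floor x) 0.
  move: h1 h2; rewrite f0 add0r => h1 h2; have : x < 1 by exact: h2.
  by rewrite ltNge -(ger0_norm h1) x1.
rewrite (walk0_eq0 _ f0) mulr0 add0r.
have [f1|f1] := eqVneq (Num.floor x + 1) 0; last by rewrite (walk0_eq0 _ f1) mulr0.
move: h1 h2; rewrite f1 => h1 h2.
have f1' : Num.floor x = -1 by lia.
rewrite f1' in h1 *; have {}h1 : -1 <= x by exact: h1.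
have {}h2 : x < 0 by exact: h2.
rewrite (_ : x = -1); first by rewrite mulrN1z opprK addNr mul0r.
by apply/eqP; rewrite eq_le h1 andbT lerNr -(ltr0_norm h2).
Qed.

Lemma spline1_le1 t : spline 1 t <= 1.
Proof.
rewrite splineS; have := spline0_le1 (t - w); have := spline0_le1 t.
have := spline0_le1 (t + w); lra.
Qed.

Lemma spline1_eq0 t : 2 * w <= `|t| -> spline 1 t = 0.
Proof.
move=> wt; rewrite splineS !spline0_eq0 ?mulr0 ?addr0 ?mul0r//.
- have := ler_normD (t + w) (- w); rewrite normrN addrK (gtr0_norm w0).
  by move: wt w0; lra.
- by move: wt w0; lra.
- have := ler_normD (t - w) w; rewrite subrK (gtr0_norm w0).
  by move: wt w0; lra.
Qed.

Lemma lipschitz_measurable (f : R -> R) D :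
  (forall s t, `|f s - f t| <= D * `|s - t|) -> measurable_fun setT f.
Proof.
move=> fD; apply: continuous_measurable_fun => x.
apply/cvgrPdist_le => e e0.
have D1 : 0 < `|D| + 1 by rewrite ltr_pwDr.
near=> y; apply: (le_trans (fD _ _)).
apply: (@le_trans _ _ ((`|D| + 1) * `|x - y|)).
  by rewrite ler_wpM2r// (le_trans (ler_norm D))// lerDl.
rewrite mulrC -ler_pdivlMr//.
by near: y; apply: cvgr_dist_le => //; exact: divr_gt0.
Unshelve. all: by end_near.
Qed.

Lemma measurable_spline N : measurable_fun setT (spline N).
Proof.
case: N => [|N]; last first.
  by apply: lipschitz_measurable => s t; exact: spline_lipschitz.
apply: (@lipschitz_measurable _ w^-1) => s t.
suff h z : `|walk R 0 (z + 1) - walk R 0 z| <= 1.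
  apply: (le_trans (interp_lipschitz _ _ h)).
  by rewrite -mulrBl mul1r normrM normfV (ger0_norm (ltW w0)) mulrC.
 have := walk0_le1 R z; have := walk0_le1 R (z + 1).
have := walk_ge0 R 0 z; have := walk_ge0 R 0 (z + 1) => h1 h2 h3 h4.
by rewrite ler_norml; lra.
Qed.

Local Open Scope ereal_scope.

Lemma integral_binomial_mean (f1 f2 f3 : measurableTypeR R -> \bar R) :
  measurable_fun setT f1 -> measurable_fun setT f2 -> measurable_fun setT f3 ->
  (forall t, 0 <= f1 t) -> (forall t, 0 <= f2 t) -> (forall t, 0 <= f3 t) ->
  \int[leb]_t (4^-1%:E * (f1 t + 2%:E * f2 t + f3 t)) =
  4^-1%:E * (\int[leb]_t f1 t + 2%:E * \int[leb]_t f2 t + \int[leb]_t f3 t).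
Proof.
move=> m1 m2 m3 f10 f20 f30.
have m2' : measurable_fun setT (fun t => 2%:E * f2 t) by exact: measurable_funeM.
have m12 : measurable_fun setT (fun t => f1 t + 2%:E * f2 t) by exact: emeasurable_funD.
have q0 t : 0 <= 2%:E * f2 t by rewrite mule_ge0// lee_fin.
have q1 t : 0 <= f1 t + 2%:E * f2 t by exact: adde_ge0.
rewrite ge0_integralZl//; last 2 first.
- exact: emeasurable_funD.
- by move=> t _; rewrite adde_ge0.
by rewrite ge0_integralD// ge0_integralD// ge0_integralZl.
Qed.

Lemma integral_splineS N : \int[leb]_t (spline N.+1 t)%:E = \int[leb]_t (spline N t)%:E.
Proof.
have mS b : measurable_fun setT (fun t : R => (spline N (t + b))%:E).
  apply/measurable_EFinP; apply: (measurableT_comp (measurable_spline N)).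
  exact: measurable_funD.
have shift b : \int[leb]_t (spline N (t + b))%:E = \int[leb]_t (spline N t)%:E.
  rewrite [RHS](@ge0_integral_lebesgue_affine _ 1 b)//; last 2 first.
  - by apply/measurable_EFinP; exact: measurable_spline.
  - by move=> t; rewrite lee_fin spline_ge0.
  by rewrite mul1e; apply: eq_integral => t _; rewrite mul1r.
transitivity (\int[leb]_t (4^-1%:E * ((spline N (t - w))%:E +
    2%:E * (spline N (t + 0))%:E + (spline N (t + w))%:E))).
  by apply: eq_integral => t _; rewrite splineS addr0 mulrC !EFinM !EFinD.
have g0 b t : 0 <= (spline N (t + b))%:E by rewrite lee_fin spline_ge0.
rewrite (integral_binomial_mean (mS _) (mS _) (mS _))//.
rewrite !shift; set I := integral _ _ _.
have I0 : 0 <= I by apply: integral_ge0 => t _; rewrite lee_fin spline_ge0.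
(* The integral is not yet known to be finite, so the value +oo is checked separately. *)
case: I I0 => [r r0| |]//.
  by rewrite /=; congr EFin; lra.
by move=> _; rewrite gt0_muley ?lte_fin// !addey// gt0_muley// lte_fin.
Qed.

(** The recursion [splineS] is an average of translates, and a translation passes from one factor of
    a convolution to the other; so it may be expanded on the left factor and collected on the right
    one. *)
Lemma spline_conv N x :
  \int[leb]_t (spline 1 (x - t) * spline N t)%:E =
  \int[leb]_t (spline 0 (x - t) * spline N.+1 t)%:E.
Proof.
have mS M b : measurable_fun setT (fun t : R => spline M (t + b)).
  apply: (measurableT_comp (measurable_spline M)); exact: measurable_funD.
have mR b : measurable_fun setT (fun t : R => spline 0 (x - t + b)).
  by apply: (measurableT_comp (mS 0%N b)); exact: measurable_funB.
pose A b c (t : R) := (spline 0 (x - t + b) * spline N (t + c))%:E.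
have mA b c : measurable_fun setT (A b c).
  by apply/measurable_EFinP; exact: measurable_funM.
have A0 b c t : 0 <= A b c t by rewrite lee_fin mulr_ge0 ?spline_ge0.
have shift b : \int[leb]_t A b 0%R t = \int[leb]_t A 0%R b t.
  rewrite (@ge0_integral_lebesgue_affine _ 1%R b)//; last exact: mA.
  rewrite mul1e.
  apply: eq_integral => t _; rewrite /A mul1r; congr ((spline 0 _ * spline N _)%:E).
    by rewrite opprD addrA subrK addr0.
  by rewrite addr0.
transitivity (\int[leb]_t (4^-1%:E * (A (- w)%R 0%R t + 2%:E * A 0%R 0%R t + A w 0%R t))).
  apply: eq_integral => t _.
  rewrite splineS /A !addr0; congr EFin; ring.
rewrite (@integral_binomial_mean (A (- w)%R 0%R) (A 0%R 0%R) (A w 0%R) (mA _ _) (mA _ _) (mA _ _))//.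
rewrite (shift (- w)%R) (shift w).
rewrite -(@integral_binomial_mean (A 0%R (- w)%R) (A 0%R 0%R) (A 0%R w) (mA _ _) (mA _ _) (mA _ _))//.
apply: eq_integral => t _.
by rewrite splineS /A !addr0; congr EFin; ring.
Qed.

End spline.

(** Factors are exchanged one at a time, and the others are at most 1. *)
Lemma prod_diff_le (R : realDomainType) (n : nat) (a b : 'I_n -> R) :
  (forall i, 0 <= a i <= 1) -> (forall i, 0 <= b i <= 1) ->
  `|\prod_i a i - \prod_i b i| <= \sum_i `|a i - b i|.
Proof.
elim: n => [|n IH] in a b *; move=> a01 b01.
  by rewrite !big_ord0 subrr normr0.
rewrite !big_ord_recl.
set A := \prod_(i < n) _; set B := \prod_(i < n) _.
have -> : a ord0 * A - b ord0 * B = (a ord0 - b ord0) * A + b ord0 * (A - B) by ring.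
have A1 : 0 <= A <= 1.
  apply/andP; split; last by apply: prodr_ile1 => i _; exact: a01.
  by apply: prodr_ge0 => i _; have /andP[] := a01 (lift ord0 i).
have /andP[b0 b1] := b01 ord0; have /andP[A0 A1'] := A1.
apply: (le_trans (ler_normD _ _)); apply: lerD.
  by rewrite normrM (ger0_norm A0) ler_piMr.
rewrite normrM (ger0_norm b0).
apply: (le_trans (ler_piMl _ b1)) => //.
exact: IH.
Qed.

Section spline_rV.
Context (R : realType) (d : nat) (w : R).
Hypothesis w0 : 0 < w.
Local Notation V := 'rV[R]_d.
Local Notation leb := (lebesgue_rV R d).

Definition spline_rV (N : nat) (x : V) : R := \prod_i spline w N (x ord0 i).

Lemma spline_rV_ge0 N x : 0 <= spline_rV N x.
Proof. by apply: prodr_ge0 => i _; exact: spline_ge0. Qed.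

Lemma measurable_spline_rV N : measurable_fun setT (spline_rV N).
Proof.
by apply: (measurable_prod_coord (f := fun _ => spline w N)) => i;
  exact: measurable_spline.
Qed.

Lemma spline_rV1_le1 x : spline_rV 1 x <= 1.
Proof.
apply: prodr_ile1 => i _.
by rewrite spline_ge0 spline1_le1.
Qed.

Lemma spline_rV1_eq0 (x : V) i : 2 * w <= `|x ord0 i| -> spline_rV 1 x = 0.
Proof. by move=> h; rewrite /spline_rV (bigD1 i)//= spline1_eq0// mul0r. Qed.

(* The bound is uniform in the scale [s] as long as [s^2 / N] stays bounded. *)
Lemma scaled_spline_rV_lipschitz N (s B : R) (x y : V) :
  (0 < N)%N -> 0 < B -> 0 <= s -> s ^+ 2 <= B ^+ 2 * N%:R ->
  `|s ^+ d * spline_rV N (s *: x) - s ^+ d * spline_rV N (s *: y)| <=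
  2 * B ^+ d.+1 / w * \sum_i `|x ord0 i - y ord0 i|.
Proof.
move=> N0 B0 s0 sBN.
have n0 : 0 < N%:R :> R by rewrite ltr0n.
(* The normalization by B puts every factor in [0, 1], as [prod_diff_le] requires; it costs B^d in
   front. *)
have scaleE u : s ^+ d * spline_rV N (s *: u) =
    B ^+ d * \prod_i (s / B * spline w N (s * u ord0 i)).
  rewrite big_split/= prodr_const card_ord mulrA -exprMn mulrCA divff ?gt_eqF// mulr1.
  by congr (_ * _); apply: eq_bigr => i _; rewrite mxE.
have sB : s <= B * Num.sqrt N%:R.
  rewrite -(@ler_pXn2r _ 2)// ?nnegrE ?mulr_ge0 ?sqrtr_ge0 ?(ltW B0)//.
  by rewrite exprMn sqr_sqrtr.
have in01 t : 0 <= s / B * spline w N t <= 1.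
  rewrite mulr_ge0 ?divr_ge0 ?spline_ge0 ?(ltW B0)//=.
  apply: (@le_trans _ _ (s / B * (Num.sqrt N%:R)^-1)).
    by rewrite ler_wpM2l ?divr_ge0 ?(ltW B0)//; exact: spline_le.
  by rewrite ler_pdivrMr ?sqrtr_gt0// mul1r ler_pdivrMr// mulrC.
rewrite !scaleE -mulrBr normrM ger0_norm ?exprn_ge0 ?(ltW B0)//.
rewrite exprS.
rewrite [leRHS](_ : _ = B ^+ d * (2 * B / w * \sum_i `|x ord0 i - y ord0 i|)); last by ring.
rewrite ler_wpM2l ?exprn_ge0 ?(ltW B0)//.
apply: (le_trans (prod_diff_le _ _)) => //.
rewrite mulr_sumr ler_sum// => i _.
rewrite -mulrBr normrM ger0_norm ?divr_ge0 ?(ltW B0)//.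
apply: (@le_trans _ _ (s / B * (2 / N%:R / w * `|s * x ord0 i - s * y ord0 i|))).
  by rewrite ler_wpM2l ?divr_ge0 ?(ltW B0)//; exact: spline_lipschitz.
rewrite -mulrBr normrM (ger0_norm s0).
rewrite [leLHS](_ : _ = s ^+ 2 / (B * N%:R) * (2 / w * `|x ord0 i - y ord0 i|)); last first.
  by field; rewrite !gt_eqF.
rewrite [leRHS](_ : _ = B * (2 / w * `|x ord0 i - y ord0 i|)); last by ring.
rewrite ler_wpM2r ?mulr_ge0 ?invr_ge0 ?(ltW w0)//.
by rewrite ler_pdivrMr ?mulr_gt0// mulrA -expr2.
Qed.

Local Open Scope ereal_scope.

Lemma spline_rV_conv N (x : V) :
  \int[leb]_y (spline_rV 1 (x - y) * spline_rV N y)%:E =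
  \int[leb]_y (spline_rV 0 (x - y) * spline_rV N.+1 y)%:E.
Proof.
have H M M' : \int[leb]_y (spline_rV M (x - y) * spline_rV M' y)%:E =
    \prod_i \int[lebesgue_measure]_t (spline w M (x ord0 i - t) * spline w M' t)%:E.
  rewrite -(integral_rV_prod (f := fun i t => spline w M (x ord0 i - t) * spline w M' t)%R).
  - apply: eq_integral => y _; congr EFin.
    by rewrite -big_split; apply: eq_bigr => i _; rewrite !mxE.
  - move=> i; apply: measurable_funM; last exact: measurable_spline.
    apply: (measurableT_comp (measurable_spline w0 M)); exact: measurable_funB.
  - by move=> i t; rewrite mulr_ge0 ?spline_ge0.
by rewrite !H; apply: eq_bigr => i _; exact: spline_conv.
Qed.

Definition spline_mass := \int[leb]_x (spline_rV 0 x)%:E.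

Lemma integral_spline_rV N : \int[leb]_x (spline_rV N x)%:E = spline_mass.
Proof.
have H M : \int[leb]_x (spline_rV M x)%:E =
    \prod_(i < d) \int[lebesgue_measure]_t (spline w M t)%:E.
  rewrite -(integral_rV_prod (f := fun=> spline w M))//.
  - by move=> _; exact: measurable_spline.
  - by move=> _ t; exact: spline_ge0.
rewrite /spline_mass !H; apply: eq_bigr => i _.
by elim: N => // N <-; exact: integral_splineS.
Qed.

Let mass1 : exists2 m : R, (0 < m)%R &
  \int[lebesgue_measure]_t (spline w 0 t)%:E = m%:E.
Proof.
have m0 : measurable_fun setT (fun t => (spline w 0 t)%:E).
  by apply/measurable_EFinP; exact: measurable_spline.
set I := integral _ _ _.
have Ilt : I < +oo.
  apply: (@le_lt_trans _ _ (\int[lebesgue_measure]_t (\1_(`[- w, w]%classic) t)%:E)).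
    apply: ge0_le_integral => //.
    - by move=> t _; rewrite lee_fin spline_ge0.
    - by apply/measurable_EFinP; exact: measurable_indic.
    - move=> t _; rewrite lee_fin indicE mem_setE in_itv/= -ler_norml.
      have [_|/ltW tw] := leP `|t|%R w; first by rewrite mulr1n spline0_le1.
      by rewrite spline0_eq0.
  rewrite integral_indic//= setIT lebesgue_measure_itv/=.
  by case: ifPn => _; rewrite ?ltry// -EFinD ltry.
have Igt : 0 < I.
  (* On [0, w/2] the tent 1 - t/w is at least 1/2. *)
  apply: (@lt_le_trans _ _ (\int[lebesgue_measure]_t ((2^-1 * \1_(`[0, w / 2]%classic) t)%R%:E))).
    under eq_integral do rewrite EFinM.
    rewrite ge0_integralZl_EFin//; last exact/measurable_EFinP/measurable_indic.
    rewrite integral_indic//= setIT lebesgue_measure_itv/= lte_fin divr_gt0//.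
    by rewrite -EFinD -EFinM lte_fin subr0 mulr_gt0// divr_gt0.
  apply: ge0_le_integral => //.
  - by apply/measurable_EFinP; apply: measurable_funM => //; exact: measurable_indic.
  - move=> t _; rewrite lee_fin indicE mem_setE in_itv/=.
    case: (boolP (0 <= t <= w / 2)%R) => [/andP[t0 tw]|_]; last by rewrite mulr0 spline_ge0.
    have t1 : (t / w <= 1 / 2)%R.
      by rewrite ler_pdivrMr//; move: tw; lra.
    have t2 : (0 <= t / w)%R by rewrite divr_ge0// ltW.
    have f0 : Num.floor (t / w) = 0%R.
      apply/eqP; rewrite floor_eq mulr0z t2/= add0r.
      by apply: (le_lt_trans t1); lra.
    rewrite mulr1 /spline /interp f0 mulr0z subr0.
    have -> : walk R 0 0 = 1%R by rewrite /walk /= bin0 divr1.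
    by rewrite walk0_eq0// mulr0 addr0 mulr1; move: t1; lra.
exists (fine I); first by rewrite fine_gt0// Igt.
by rewrite fineK// ge0_fin_numE// ltW.
Qed.

Lemma spline_massE : exists2 m : R, (0 < m)%R & spline_mass = m%:E.
Proof.
have [m m0 mE] := mass1.
exists (\prod_(i < d) m)%R; first by rewrite prodr_gt0.
rewrite /spline_mass /spline_rV.
rewrite (integral_rV_prod (f := fun=> spline w 0%N)); last 2 first.
- by move=> _; exact: measurable_spline.
- by move=> _ t; exact: spline_ge0.
by rewrite -prodEFin; apply: eq_bigr.
Qed.

End spline_rV.

(** * Densities, convolutions and differences of measures *)

Section packing.
Context d (T : measurableType d) (R : realType).

Definition pack_mfun d' (T' : measurableType d') (f : T -> T')
    (mf : measurable_fun setT f) : {mfun T >-> T'} :=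
  HB.pack f (isMeasurableFun.Build _ _ _ _ f mf).

Lemma pack_finite_subproof (m : {measure set T -> \bar R}) :
  (m setT < +oo)%E -> fin_num_fun m.
Proof.
move=> mT A mA; rewrite ge0_fin_numE//; apply: le_lt_trans mT.
by apply: le_measure; rewrite ?inE.
Qed.

Section pack_finite.
Variable (m : {measure set T -> \bar R}).

(** An alias of [m] whose proof argument carries the finiteness, so that the finite-measure
    structure can be inferred. *)
Definition pack_finite (_ : (m setT < +oo)%E) : set T -> \bar R := m.

Hypothesis mT : (m setT < +oo)%E.

HB.instance Definition _ := Measure.copy (pack_finite mT) m.

HB.instance Definition _ := Measure_isFinite.Build _ _ _ (pack_finite mT)
  (pack_finite_subproof mT).

End pack_finite.

End packing.

Section density_measure.
Context d (T : measurableType d) (R : realType).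
Local Open Scope ereal_scope.

(* The absolute value makes this a measure without a sign hypothesis on [g]. *)
Definition density_measure (mu : set T -> \bar R) (g : {mfun T >-> R}) :
  set T -> \bar R := fun A => \int[mu]_(x in A) `|g x|%:E.

Variables (mu : {measure set T -> \bar R}) (g : {mfun T >-> R}).

Let mg : measurable_fun setT (fun x => `|g x|%:E).
Proof.
apply/measurable_EFinP; apply: measurableT_comp => //; exact: measurable_funPT.
Qed.

Let density0 : density_measure mu g set0 = 0.
Proof. by rewrite /density_measure integral_set0. Qed.

Let density_ge0 A : 0 <= density_measure mu g A.
Proof. by apply: integral_ge0 => x _; rewrite lee_fin. Qed.

Let density_sigma_additive : semi_sigma_additive (density_measure mu g).
Proof.
move=> F mF tF mUF; rewrite /density_measure ge0_integral_bigcup//.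
- by apply: is_cvg_ereal_nneg_natsum_cond => n _ _; exact: density_ge0.
- exact: measurable_funTS.
Qed.

HB.instance Definition _ := isMeasure.Build _ _ _ (density_measure mu g)
  density0 density_ge0 density_sigma_additive.

Import HBNNSimple.

(** True for simple functions by linearity, then for nonnegative ones by monotone convergence on
    both sides. *)
Lemma ge0_integral_density (f : T -> \bar R) :
  measurable_fun setT f -> (forall x, 0 <= f x) ->
  \int[density_measure mu g]_x f x = \int[mu]_x (f x * `|g x|%:E).
Proof.
move=> mf f0; pose f_ := nnsfun_approx measurableT mf.
have f_cvg x : (f_ n x)%:E @[n --> \oo] --> f x.
  by apply: cvg_nnsfun_approx => // y _; exact: f0.
have mf_ n : measurable_fun setT (fun x => (f_ n x)%:E).
  by apply/measurable_EFinP; exact: measurable_funPT.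
have nd_f x : {homo (fun n => (f_ n x)%:E) : n m / (n <= m)%N >-> n <= m}.
  by move=> n m nm; rewrite lee_fin; exact/lefP/nd_nnsfun_approx.
transitivity (limn (fun n => \int[density_measure mu g]_x (f_ n x)%:E)).
  rewrite -monotone_convergence//.
  - by apply: eq_integral => x _; apply/esym/cvg_lim.
  - by move=> n x _; rewrite lee_fin.
transitivity (limn (fun n => \int[mu]_x ((f_ n x)%:E * `|g x|%:E))); last first.
  rewrite -monotone_convergence//.
  - apply: eq_integral => x _; apply/cvg_lim => //.
    by apply: cvgeZr => //; exact: f_cvg.
  - by move=> n; exact: emeasurable_funM.
  - by move=> n x _; rewrite mule_ge0// lee_fin.
  - by move=> x _ n m nm; rewrite lee_wpmul2r ?lee_fin//; exact/lefP/nd_nnsfun_approx.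
apply: congr_lim; apply/funext => n.
rewrite integralT_nnsfun sintegralE.
under [RHS]eq_integral => x _.
  rewrite (fimfunE (f_ n)) -fsumEFin// ge0_mule_fsuml; last first.
    by move=> r; rewrite nnfun_muleindic_ge0.
  over.
rewrite ge0_integral_fsum//; last 2 first.
- move=> r; apply: emeasurable_funM => //.
  by apply/measurable_EFinP; exact: measurable_funM.
- by move=> r x _; rewrite mule_ge0 ?nnfun_muleindic_ge0// lee_fin.
apply: eq_fsbigr => r _.
have [r0|r0] := ltP r 0%R.
  rewrite preimage_nnfun0// measure0 mule0; apply/esym/integral0_eq => x _.
  by rewrite indic0 mulr0 mul0e.
under [RHS]eq_integral => x _ do rewrite EFinM -muleA.
rewrite ge0_integralZl//; last first.
  by apply: emeasurable_funM => //; apply/measurable_EFinP; exact: measurable_indic.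
congr (_ * _); rewrite /density_measure.
rewrite [LHS]integral_mkcond; apply: eq_integral => x _.
rewrite patchE indicE; case: ifPn => _; last by rewrite mul0e.
by rewrite mul1e.
Qed.

End density_measure.

Section convolution.
Context (R : realType) (d : nat).
Local Notation V := 'rV[R]_d.
Local Open Scope ereal_scope.

Lemma measurable_rV_addp : measurable_fun setT (fun p : V * V => (p.1 + p.2)%R).
Proof. by apply: measurable_rV_add; [exact: measurable_fst|exact: measurable_snd]. Qed.

Definition mconv (m1 m2 : {finite_measure set V -> \bar R}) : set V -> \bar R :=
  image_measure (m1 \x m2) (pack_mfun measurable_rV_addp).

Section mconv_measure.
Variables m1 m2 : {finite_measure set V -> \bar R}.

HB.instance Definition _ := Measure.copy (mconv m1 m2)
  (image_measure (m1 \x m2) (pack_mfun measurable_rV_addp)).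

Lemma mconv_setT : mconv m1 m2 setT = m1 setT * m2 setT.
Proof.
by rewrite /mconv /image_measure /pushforward preimage_setT -setXTT product_measure1E.
Qed.

Let mconv_fin : fin_num_fun (mconv m1 m2).
Proof.
apply: pack_finite_subproof; apply: (@le_lt_trans _ _ (m1 setT * m2 setT)).
  by rewrite -mconv_setT.
by rewrite -ge0_fin_numE ?mule_ge0// fin_numM// fin_num_measure.
Qed.

HB.instance Definition _ := Measure_isFinite.Build _ _ _ (mconv m1 m2) mconv_fin.

Lemma measurable_mconv_section (f : V -> \bar R) :
  measurable_fun setT f -> (forall x, 0 <= f x) ->
  measurable_fun setT (fun x : V => \int[m2]_y f (x + y)%R).
Proof.
move=> mf f0.
have mg := measurableT_comp mf measurable_rV_addp.
exact: (measurable_fun_fubini_tonelli_F (m2 := m2) _ mg (fun p => f0 _)).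
Qed.

Lemma ge0_integral_mconv (f : V -> \bar R) :
  measurable_fun setT f -> (forall x, 0 <= f x) ->
  \int[mconv m1 m2]_x f x = \int[m1]_x \int[m2]_y f (x + y)%R.
Proof.
move=> mf f0.
have mg := measurableT_comp mf measurable_rV_addp.
rewrite [LHS]ge0_integral_image_measure//.
exact: (fubini_tonelli1 (m1 := m1) (m2 := m2) _ mg (fun p => f0 _)).
Qed.

End mconv_measure.
End convolution.

Section finite_measure_add.
Context d (T : measurableType d) (R : realType).
Variables m1 m2 : {finite_measure set T -> \bar R}.

Let add_fin : fin_num_fun (measure_add m1 m2).
Proof. by move=> A mA; rewrite measure_addE fin_numD !fin_num_measure. Qed.

HB.instance Definition _ := Measure.on (measure_add m1 m2).

HB.instance Definition _ := Measure_isFinite.Build _ _ _ (measure_add m1 m2) add_fin.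

End finite_measure_add.

Section measure_difference.
Context d (T : measurableType d) (R : realType).
Variables m1 m2 : {finite_measure set T -> \bar R}.
Hypothesis le21 : forall A, measurable A -> (m2 A <= m1 A)%E.
Local Open Scope ereal_scope.

Lemma measure_difference_ex : exists m : {finite_measure set T -> \bar R},
  forall A, measurable A -> m1 A = m2 A + m A.
Proof.
(* A measure must be nonnegative on all sets, while [le21] speaks of measurable ones only; the
   maximum changes nothing on the latter. *)
pose m A := maxe 0 (m1 A - m2 A).
have mE A : measurable A -> m A = m1 A - m2 A.
  move=> mA; apply: max_r; rewrite sube_ge0 ?le21//.
  by rewrite fin_num_measure.
have m0 : m set0 = 0 by rewrite mE// !measure0 sube0.
have mge0 A : 0 <= m A by rewrite /m le_max lexx.
have madd : semi_sigma_additive m.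
  move=> F mF tF mUF; rewrite mE//.
  rewrite (_ : (fun _ => _) = (fun n => \sum_(0 <= i < n) m1 (F i)) \-
      (fun n => \sum_(0 <= i < n) m2 (F i))); last first.
    apply/funext => n /=; elim: n => [|n IH]; first by rewrite !big_geq ?sube0.
    by rewrite !big_nat_recr//= IH mE// fin_num_oppeD ?fin_num_measure// addeACA.
  apply: cvgeB.
  - by rewrite fin_num_adde_defr// fin_num_measure.
  - exact: measure_semi_sigma_additive.
  - exact: measure_semi_sigma_additive.
pose mm : {measure set T -> \bar R} :=
  HB.pack m (isMeasure.Build _ _ _ m m0 mge0 madd).
have mT : mm setT < +oo.
  by rewrite /= mE// -ge0_fin_numE ?fin_numB ?fin_num_measure// -mE.
exists [the {finite_measure set T -> \bar R} of pack_finite mT] => A mA.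
by rewrite /= /pack_finite /= mE// addeC subeK// fin_num_measure.
Qed.

End measure_difference.

(** * Splitting the powers of a law with a spline component *)

Section product_swap.
Context (R : realType) (d : nat).
Local Notation V := 'rV[R]_d.
Local Notation leb := (lebesgue_rV R d).
Local Open Scope ereal_scope.

Lemma measurable_rV_subp : measurable_fun setT (fun p : V * V => (p.2 - p.1)%R).
Proof.
rewrite (_ : (fun _ => _) = fun p : V * V => (p.2 + (-1) *: p.1)%R).
  apply: measurable_rV_add; first exact: measurable_snd.
  by apply: measurable_rV_lin; exact: measurable_fst.
by apply/funext => p; rewrite scaleN1r.
Qed.

Lemma integral_translate_mul (g : V -> R) (F : V -> \bar R) (x : V) :
  measurable_fun setT g -> (forall x, 0 <= g x)%R ->
  measurable_fun setT F -> (forall x, 0 <= F x) ->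
  \int[leb]_v ((g v)%:E * F (v + x)%R) = \int[leb]_z ((g (z - x)%R)%:E * F z).
Proof.
move=> mg g0 mF F0.
rewrite [LHS](ge0_integral_rV_shift (- x)%R).
- by apply: eq_integral => z _; rewrite subrK.
- apply: emeasurable_funM; first exact/measurable_EFinP.
  exact: (measurableT_comp mF (measurable_rV_shift x)).
- by move=> z; rewrite mule_ge0// lee_fin.
Qed.

(** Substitute z = v + x and apply Tonelli; the inner integral on the right is the density of the
    convolution of g and h. *)
Lemma integral_conv2 (g h : V -> R) (F : V -> \bar R) :
  measurable_fun setT g -> (forall x, 0 <= g x)%R ->
  measurable_fun setT h -> (forall x, 0 <= h x)%R ->
  measurable_fun setT F -> (forall x, 0 <= F x) ->
  \int[leb]_x ((h x)%:E * \int[leb]_v ((g v)%:E * F (v + x)%R)) =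
  \int[leb]_z (F z * \int[leb]_x (g (z - x) * h x)%:E).
Proof.
move=> mg g0 mh h0 mF F0.
pose K (p : V * V) := (h p.1)%:E * ((g (p.2 - p.1)%R)%:E * F p.2).
have mK : measurable_fun setT K.
  apply: emeasurable_funM.
    by apply/measurable_EFinP; exact: (measurableT_comp mh measurable_fst).
  apply: emeasurable_funM.
    by apply/measurable_EFinP; exact: (measurableT_comp mg measurable_rV_subp).
  exact: (measurableT_comp mF measurable_snd).
have K0 p : 0 <= K p by rewrite !mule_ge0// lee_fin.
have mgF x : measurable_fun setT (fun z : V => (g (z - x)%R)%:E * F z).
  apply: emeasurable_funM => //; apply/measurable_EFinP.
  exact: (measurableT_comp mg (measurable_rV_shift (- x)%R)).
transitivity (\int[leb]_x \int[leb]_z K (x, z)).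
  apply: eq_integral => x _; rewrite integral_translate_mul//.
  by rewrite -ge0_integralZl ?lee_fin// => z _; rewrite mule_ge0// lee_fin.
rewrite (fubini_tonelli (m1 := leb) (m2 := leb) _ mK K0).
apply: eq_integral => z _; rewrite -ge0_integralZl//; last 2 first.
- apply/measurable_EFinP; apply: measurable_funM => //.
  by apply: (measurableT_comp (measurableT_comp mg measurable_rV_subp)
    (measurable_pair2 z)).
- by move=> x _; rewrite lee_fin mulr_ge0.
apply: eq_integral => x _; rewrite /K/= muleA [LHS]muleC; congr (_ * _).
by rewrite -EFinM mulrC.
Qed.

Lemma integral_conv2C (g h : V -> R) (F : V -> \bar R) :
  measurable_fun setT g -> (forall x, 0 <= g x)%R ->
  measurable_fun setT h -> (forall x, 0 <= h x)%R ->
  measurable_fun setT F -> (forall x, 0 <= F x) ->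
  \int[leb]_x ((h x)%:E * \int[leb]_v ((g v)%:E * F (v + x)%R)) =
  \int[leb]_v ((g v)%:E * \int[leb]_x ((h x)%:E * F (v + x)%R)).
Proof.
move=> mg g0 mh h0 mF F0.
pose K (p : V * V) := (h p.1)%:E * ((g p.2)%:E * F (p.2 + p.1)%R).
have mK : measurable_fun setT K.
  apply: emeasurable_funM.
    by apply/measurable_EFinP; exact: (measurableT_comp mh measurable_fst).
  apply: emeasurable_funM.
    by apply/measurable_EFinP; exact: (measurableT_comp mg measurable_snd).
  apply: (measurableT_comp mF).
  by apply: measurable_rV_add; [exact: measurable_snd|exact: measurable_fst].
have K0 p : 0 <= K p by rewrite !mule_ge0// lee_fin.
have mgF x : measurable_fun setT (fun v : V => (g v)%:E * F (v + x)%R).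
  apply: emeasurable_funM; first exact/measurable_EFinP.
  exact: (measurableT_comp mF (measurable_rV_shift x)).
have mhF v : measurable_fun setT (fun x : V => (h x)%:E * F (v + x)%R).
  apply: emeasurable_funM; first exact/measurable_EFinP.
  under eq_fun do rewrite addrC.
  exact: (measurableT_comp mF (measurable_rV_shift v)).
transitivity (\int[leb]_x \int[leb]_z K (x, z)).
  apply: eq_integral => x _.
  by rewrite -ge0_integralZl ?lee_fin// => z _; rewrite mule_ge0// lee_fin.
rewrite (fubini_tonelli (m1 := leb) (m2 := leb) _ mK K0).
apply: eq_integral => z _; rewrite -ge0_integralZl ?lee_fin//; last first.
  by move=> x _; rewrite mule_ge0// lee_fin.
by apply: eq_integral => x _; rewrite /K/= muleCA.
Qed.

End product_swap.

Section smoothing.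
Context (R : realType) (d : nat) (w : R).
Hypothesis w0 : (0 < w)%R.
Local Notation V := 'rV[R]_d.
Local Notation leb := (lebesgue_rV R d).
Local Notation G := (@spline_rV R d w).
Local Open Scope ereal_scope.

(** Convolution seen from the test function: integrating [smooth N f] against a measure integrates f
    against its convolution with [G N]. *)
Definition smooth N (f : V -> \bar R) (y : V) : \bar R :=
  \int[leb]_x ((G N x)%:E * f (x + y)%R).

Lemma measurable_smooth N f : measurable_fun setT f -> (forall x, 0 <= f x) ->
  measurable_fun setT (smooth N f).
Proof.
move=> mf f0.
have mK : measurable_fun setT (fun p : V * V => (G N p.2)%:E * f (p.2 + p.1)%R).
  apply: emeasurable_funM.
    apply/measurable_EFinP.
    exact: (measurableT_comp (@measurable_spline_rV R d w w0 N) measurable_snd).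
  apply: (measurableT_comp mf).
  by apply: measurable_rV_add; [exact: measurable_snd|exact: measurable_fst].
apply: (measurable_integral_rV mK) => p.
by rewrite mule_ge0// lee_fin spline_rV_ge0.
Qed.

Lemma smooth_ge0 N f y : (forall x, 0 <= f x) -> 0 <= smooth N f y.
Proof.
by move=> f0; apply: integral_ge0 => x _; rewrite mule_ge0// lee_fin spline_rV_ge0.
Qed.

Let mshift (f : V -> \bar R) y : measurable_fun setT f ->
  measurable_fun setT (fun x : V => f (x + y)%R).
Proof. by move=> mf; exact: (measurableT_comp mf (measurable_rV_shift y)). Qed.

(* One factor [G 1] is traded for one more smoothing step and a factor [G 0]. *)
Lemma smooth_smooth1 N (f : V -> \bar R) y :
  measurable_fun setT f -> (forall x, 0 <= f x) ->
  smooth N (smooth 1 f) y = smooth 0 (smooth N.+1 f) y.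
Proof.
move=> mf f0.
have mG M := @measurable_spline_rV R d w w0 M.
have G0 M := @spline_rV_ge0 R d w M.
have E M M' : smooth M' (smooth M f) y =
    \int[leb]_z (f (z + y)%R * \int[leb]_x (G M (z - x) * G M' x)%:E).
  transitivity (\int[leb]_x ((G M' x)%:E * \int[leb]_v ((G M v)%:E * f (v + x + y)%R))).
    by apply: eq_integral => x _; congr (_ * _); apply: eq_integral => v _; rewrite addrA.
  exact: (integral_conv2 (mG M) (G0 M) (mG M') (G0 M') (mshift y mf) (fun=> f0 _)).
rewrite E -[RHS]/(\int[leb]_x ((G 0 x)%:E * \int[leb]_v ((G N.+1 v)%:E * f (v + (x + y))%R))).
transitivity (\int[leb]_x ((G N.+1 x)%:E * \int[leb]_v ((G 0 v)%:E * f (v + (x + y))%R))).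
  rewrite -[RHS]/(smooth _ (smooth _ _) _) E.
  by apply: eq_integral => z _; rewrite spline_rV_conv.
transitivity (\int[leb]_x ((G N.+1 x)%:E * \int[leb]_v ((G 0 v)%:E * f (v + x + y)%R))).
  by apply: eq_integral => x _; congr (_ * _); apply: eq_integral => v _; rewrite addrA.
transitivity (\int[leb]_v ((G 0 v)%:E * \int[leb]_x ((G N.+1 x)%:E * f (v + x + y)%R))).
  exact: (integral_conv2C (mG _) (G0 _) (mG _) (G0 _) (mshift y mf) (fun=> f0 _)).
apply: eq_integral => v _; congr (_ * _); apply: eq_integral => x _.
by rewrite addrA [(v + x)%R]addrC.
Qed.

Lemma smoothZ N (f : V -> \bar R) (r : R) y :
  measurable_fun setT f -> (forall x, 0 <= f x) -> (0 <= r)%R ->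
  smooth N (fun s => r%:E * f s) y = r%:E * smooth N f y.
Proof.
move=> mf f0 r0; rewrite /smooth -ge0_integralZl//.
- by apply: eq_integral => x _; rewrite muleCA.
- apply: emeasurable_funM; last exact: mshift.
  by apply/measurable_EFinP; exact: measurable_spline_rV.
- by move=> x _; rewrite mule_ge0// lee_fin spline_rV_ge0.
Qed.

Lemma smooth_shift N (f : V -> \bar R) x y :
  smooth N (fun s => f (x + s)%R) y = smooth N f (x + y)%R.
Proof. by apply: eq_integral => z _; rewrite addrCA. Qed.

Lemma smooth_measure N (f : V -> \bar R) y (b : {finite_measure set V -> \bar R}) :
  measurable_fun setT f -> (forall x, 0 <= f x) ->
  smooth N (fun s => \int[b]_v f (s + v)%R) y = \int[b]_v smooth N f (y + v)%R.
Proof.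
move=> mf f0.
pose K (p : V * V) := (G N p.1)%:E * f (p.1 + (y + p.2))%R.
have mG : measurable_fun setT (fun x : V => (G N x)%:E).
  by apply/measurable_EFinP; exact: measurable_spline_rV.
have mK : measurable_fun setT K.
  apply: emeasurable_funM; first exact: (measurableT_comp mG measurable_fst).
  apply: (measurableT_comp mf); apply: measurable_rV_add => //.
  apply: measurable_rV_add => //; exact: measurable_snd.
have K0 p : 0 <= K p by rewrite mule_ge0// lee_fin spline_rV_ge0.
rewrite -[RHS](fubini_tonelli (m1 := leb) (m2 := b) _ mK K0).
apply: eq_integral => x _; rewrite /fubini_F -ge0_integralZl//.
- by apply: eq_integral => v _; rewrite /K/= addrA.
- under eq_fun do rewrite addrC; exact: mshift.
- by rewrite lee_fin spline_rV_ge0.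
Qed.

Section splitting.
Variables (c p m0 : R) (x0 : V) (k b : {finite_measure set V -> \bar R}).
Hypotheses (c0 : (0 < c)%R) (m00 : (0 < m0)%R) (mass : spline_mass d w = m0%:E).
Hypothesis pE : (p = c * m0)%R.
Hypothesis bT : b setT = (1 - p)%:E.
Hypothesis kE : forall f : V -> \bar R, measurable_fun setT f ->
  (forall x, 0 <= f x) ->
  \int[k]_x f x = c%:E * smooth 1 f x0 + \int[b]_x f x.
(** In the application [k] is the law of a block of 2 n0 steps and [M i] that of i blocks and some
    leftover steps, so that [ME] adds one block. *)
Variable M : nat -> {finite_measure set V -> \bar R}.
Hypothesis MT : forall i, M i setT <= 1.
Hypothesis ME : forall i (f : V -> \bar R), measurable_fun setT f ->
  (forall x, 0 <= f x) ->
  \int[M i.+1]_x f x = \int[M i]_s \int[k]_v f (s + v)%R.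

Let p0 : (0 < p)%R. Proof. by rewrite pE mulr_gt0. Qed.
Let p1 : (p <= 1)%R.
Proof. by have : 0 <= b setT by []; rewrite bT lee_fin subr_ge0. Qed.

Lemma zero_finite_measure_ex : exists z : {finite_measure set V -> \bar R},
  (z setT = 0) /\ forall f : V -> \bar R, \int[z]_x f x = 0.
Proof.
have h : @mzero _ V R setT < +oo by rewrite /mzero ltry.
exists [the {finite_measure set V -> \bar R} of pack_finite h]; split => // f.
exact: integral_measure_zero.
Qed.

Lemma smooth_measure_ex N : exists z : {finite_measure set V -> \bar R},
  z setT = p%:E /\ forall f : V -> \bar R, measurable_fun setT f ->
  (forall x, 0 <= f x) -> \int[z]_x f x = c%:E * smooth N f x0.
Proof.
pose g x := (c * G N (x - x0))%R.
have mg : measurable_fun setT g.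
  apply: measurable_funM => //.
  exact: (measurableT_comp (@measurable_spline_rV R d w w0 N) (measurable_rV_shift _)).
have g0 x : (0 <= g x)%R by rewrite mulr_ge0 ?spline_rV_ge0 ?ltW.
pose z := density_measure leb (pack_mfun mg).
have zE (f : V -> \bar R) : measurable_fun setT f ->
    (forall x, 0 <= f x) -> \int[z]_x f x = c%:E * smooth N f x0.
  move=> mf f0; rewrite ge0_integral_density// /smooth -ge0_integralZl//; last 3 first.
  - apply: emeasurable_funM; last exact: mshift.
    by apply/measurable_EFinP; exact: measurable_spline_rV.
  - by move=> x _; rewrite mule_ge0// lee_fin spline_rV_ge0.
  - by rewrite lee_fin ltW.
  rewrite [LHS](ge0_integral_rV_shift x0)//.
  - by apply: eq_integral => x _; rewrite /= ger0_norm// /g addrK muleC EFinM muleA.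
  - apply: emeasurable_funM => //; apply/measurable_EFinP.
    by apply: measurableT_comp.
  - by move=> x; rewrite mule_ge0// lee_fin.
have zT : z setT = p%:E.
  rewrite -[LHS]mul1e -(integral_cst z measurableT 1) zE//.
  rewrite /smooth; under eq_integral do rewrite mule1.
  by rewrite (integral_spline_rV d w0) mass -EFinM -pE.
have zlt : z setT < +oo by rewrite zT ltry.
by exists [the {finite_measure set V -> \bar R} of pack_finite zlt]; split.
Qed.

Lemma dirac_measure_ex : exists z : {finite_measure set V -> \bar R},
  z setT = c%:E /\ forall f : V -> \bar R, measurable_fun setT f ->
  (forall x, 0 <= f x) -> \int[z]_x f x = c%:E * f x0.
Proof.
exists [the {finite_measure set V -> \bar R} of
  mscale (NngNum (ltW c0)) [the {finite_measure set V -> \bar R} of dirac x0]].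
split; first by rewrite /= /mscale /= diracT mule1.
move=> f mf f0; rewrite ge0_integral_mscale//=; congr (_ * _).
by rewrite integral_dirac//= diracT mul1e.
Qed.

(** If the new factor is the spline part, one spline factor fewer is needed among the previous ones;
    if it is the part b, all are needed. Hence two different splittings of the same [M i]. The
    operator [op] is the identity when the first spline factor is gained and a smoothing afterwards;
    [W] is what is left over from the new factor. *)
Lemma split_step i N (op : (V -> \bar R) -> V -> \bar R)
    (W T1 R1 T2 R2 : {finite_measure set V -> \bar R}) :
  (forall f y, measurable_fun setT f -> (forall x, 0 <= f x) ->
    op (fun s => c%:E * smooth 1 f (x0 + s)%R) y = \int[W]_v smooth N f (y + v)%R) ->
  (forall f, measurable_fun setT f -> (forall x, 0 <= f x) ->
    \int[M i]_x f x = \int[T1]_y op f y + \int[R1]_x f x) ->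
  (forall f, measurable_fun setT f -> (forall x, 0 <= f x) ->
    \int[M i]_x f x = \int[T2]_y smooth N f y + \int[R2]_x f x) ->
  exists T' R' : {finite_measure set V -> \bar R},
    [/\ T' setT = T1 setT * W setT + T2 setT * (1 - p)%:E,
        R' setT = R1 setT * p%:E + R2 setT * (1 - p)%:E &
        forall f, measurable_fun setT f -> (forall x, 0 <= f x) ->
          \int[M i.+1]_x f x = \int[T']_y smooth N f y + \int[R']_x f x].
Proof.
move=> opE H1 H2; have [z [zT zE]] := smooth_measure_ex 1.
exists [the {finite_measure set V -> \bar R} of measure_add
  [the {finite_measure set V -> \bar R} of mconv T1 W]
  [the {finite_measure set V -> \bar R} of mconv T2 b]].
exists [the {finite_measure set V -> \bar R} of measure_add
  [the {finite_measure set V -> \bar R} of mconv R1 z]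
  [the {finite_measure set V -> \bar R} of mconv R2 b]].
split.
- by rewrite /= measure_addE /= !mconv_setT bT.
- by rewrite /= measure_addE /= !mconv_setT bT zT.
move=> f mf f0.
pose A s := c%:E * smooth 1 f (x0 + s)%R.
pose B s := \int[b]_v f (s + v)%R.
have msm n : measurable_fun setT (smooth n f) by exact: measurable_smooth.
have sm0 n x : 0 <= smooth n f x by exact: smooth_ge0.
have mA : measurable_fun setT A.
  apply: measurable_funeM; under eq_fun do rewrite addrC; exact: mshift.
have A0 s : 0 <= A s by rewrite mule_ge0// lee_fin ltW.
have mB : measurable_fun setT B by exact: measurable_mconv_section.
have B0 s : 0 <= B s by exact: integral_ge0.
have shE (n : nat) s : smooth n (fun v => f (s + v)%R) x0 = smooth n f (x0 + s)%R.
  by apply: eq_integral => x _; rewrite [(s + _)%R]addrC addrA.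
have mf' s : measurable_fun setT (fun v : V => f (s + v)%R).
  by under eq_fun do rewrite addrC; exact: mshift.
(* The new factor k is cut into its spline part, giving A, and b, giving B; each is then integrated
   with the splitting meant for it. *)
transitivity (\int[M i]_s A s + \int[M i]_s B s).
  rewrite -ge0_integralD// ME//; apply: eq_integral => s _.
  by rewrite kE//= shE.
rewrite (H1 A)// (H2 B)//.
rewrite !ge0_integral_measure_add// !ge0_integral_mconv//.
rewrite addeACA; congr (_ + _ + (_ + _)).
- by apply: eq_integral => y _; rewrite opE.
- by apply: eq_integral => y _; rewrite smooth_measure.
- by apply: eq_integral => s _; rewrite zE//= shE.
Qed.

(* Each convolution factor k is the spline component with probability p. The
   remainder collects the cases with at most N spline factors; its bound is
   Markov's inequality for 2^-B, B binomial, since E 2^-B = (1 - p / 2)^i. *)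
Lemma smooth_split i N : exists T' R' : {finite_measure set V -> \bar R},
  [/\ T' setT <= (m0^-1)%:E,
      R' setT <= (2 ^+ N.+1 * (1 - p / 2) ^+ i)%:E &
      forall f, measurable_fun setT f -> (forall x, 0 <= f x) ->
        \int[M i]_x f x = \int[T']_y smooth N.+1 f y + \int[R']_x f x].
Proof.
have [z [zT zE]] := zero_finite_measure_ex.
elim: i N => [|i IH] N.
  exists z, (M 0%N); split.
  - by rewrite zT lee_fin invr_ge0 ltW.
  - apply: (le_trans (MT 0)); rewrite expr0 mulr1 lee_fin.
    by rewrite exprn_ege1// ler1n.
  - by move=> f mf f0; rewrite zE add0e.
have q0 : (0 <= 1 - p / 2)%R by move: p1 p0; lra.
have p1' : (0 <= 1 - p)%R by rewrite subr_ge0.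
case: N => [|N].
  have [T2 [R2 [T2m R2m H2]]] := IH 0%N.
  (* The first spline factor is kept whole, so only its weight c and its center remain in [W]. The
     masses add up because c + (1 - p) / m0 = 1 / m0, by p = c m0. *)
  have [W [WT WE]] := dirac_measure_ex.
  have [||//|T' [R' [T'E R'E H]]] := @split_step i 1%N id W (M i) z T2 R2.
  - move=> f y mf f0; rewrite WE 1?addrC//.
    + by under eq_fun do rewrite addrC; apply: mshift; exact: measurable_smooth.
    + by move=> x; exact: smooth_ge0.
  - by move=> f mf f0; rewrite zE adde0.
  exists T', R'; split => //.
  - rewrite T'E WT; apply: (@le_trans _ _ (1 * c%:E + (m0^-1)%:E * (1 - p)%:E)).
      by apply: leeD; apply: lee_wpmul2r; rewrite ?lee_fin ?(ltW c0).
    rewrite mul1e -EFinM -EFinD lee_fin le_eqVlt; apply/orP; left; apply/eqP.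
    by rewrite pE; field; rewrite gt_eqF.
  - rewrite R'E zT mul0e add0e; apply: (@le_trans _ _ ((2 ^+ 1 * (1 - p / 2) ^+ i)%:E * (1 - p)%:E)).
      by apply: lee_wpmul2r; rewrite ?lee_fin.
    rewrite -EFinM lee_fin expr1 [((1 - p / 2) ^+ i.+1)%R]exprS.
    have : (0 <= (1 - p / 2) ^+ i)%R by exact: exprn_ge0.
    move: ((1 - p / 2) ^+ i)%R => v v0; rewrite -subr_ge0.
    rewrite (_ : _ - _ = v * p)%R ?mulr_ge0 ?(ltW p0)//.
    by field.
have [T1 [R1 [T1m R1m H1]]] := IH N.
have [T2 [R2 [T2m R2m H2]]] := IH N.+1.
(* By [smooth_smooth1] the new factor [G 1] raises the smoothing level by one and leaves [G 0],
   which [W] carries with mass p. *)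
have [W [WT WE]] := smooth_measure_ex 0.
have [|//|//|T' [R' [T'E R'E H]]] := @split_step i N.+2 (smooth N.+1) W T1 R1 T2 R2.
- move=> f y mf f0.
  have msm n : measurable_fun setT (smooth n f) by exact: measurable_smooth.
  have sm0 n x : 0 <= smooth n f x by exact: smooth_ge0.
  have msh n x : measurable_fun setT (fun s : V => smooth n f (x + s)%R).
    by under eq_fun do rewrite addrC; exact: mshift.
  have cM (u v : \bar R) : u = v -> c%:E * u = c%:E * v by move->.
  apply: (etrans (smoothZ N.+1 y (msh 1%N x0) (fun s => sm0 1%N _) (ltW c0))).
  apply: (etrans (cM _ _ (smooth_shift N.+1 (smooth 1 f) x0 y))).
  apply: (etrans (cM _ _ (smooth_smooth1 N.+1 (x0 + y)%R mf f0))).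
  apply: esym; apply: (etrans (WE _ (msh N.+2 y) (fun s => sm0 N.+2 _))).
  apply: (etrans (cM _ _ (smooth_shift 0 (smooth N.+2 f) y x0))).
  by rewrite (addrC y x0).
exists T', R'; split => //.
- rewrite T'E WT; apply: (@le_trans _ _ ((m0^-1)%:E * p%:E + (m0^-1)%:E * (1 - p)%:E)).
    by apply: leeD; apply: lee_wpmul2r; rewrite ?lee_fin ?(ltW p0).
  rewrite -!EFinM -EFinD lee_fin le_eqVlt; apply/orP; left; apply/eqP.
  by ring.
- rewrite R'E; apply: (@le_trans _ _ ((2 ^+ N.+1 * (1 - p / 2) ^+ i)%:E * p%:E +
    (2 ^+ N.+2 * (1 - p / 2) ^+ i)%:E * (1 - p)%:E)).
    by apply: leeD; apply: lee_wpmul2r; rewrite ?lee_fin ?(ltW p0).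
  rewrite -!EFinM -EFinD lee_fin le_eqVlt; apply/orP; left; apply/eqP.
  (* The recursion for the bound is exact: p + 2 (1 - p) = 2 (1 - p / 2). *)
  rewrite [(2 ^+ N.+2)%R]exprS [((1 - p / 2) ^+ i.+1)%R]exprS.
  move: (2 ^+ N.+1)%R ((1 - p / 2) ^+ i)%R => u v.
  by field.
Qed.

End splitting.
End smoothing.

(** * Laws of partial sums *)

Section partial_sums.
Context dT (T : measurableType dT) (R : realType) (P : probability T R) (d : nat).
Local Notation V := 'rV[R]_d.
Variable xi : nat -> {RV P >-> V}.
Local Open Scope ereal_scope.

Definition psum (n : nat) (t : T) : V := (\sum_(k < n) xi k t)%R.

Lemma psumS n t : psum n.+1 t = (psum n t + xi n t)%R.
Proof. by rewrite /psum big_ord_recr. Qed.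

Lemma measurable_psum n : measurable_fun setT (psum n).
Proof.
elim: n => [|n IH].
  rewrite (_ : psum 0 = cst 0%R); first exact: measurable_cst.
  by apply/funext => t; rewrite /psum big_ord0.
rewrite (_ : psum n.+1 = fun t => (psum n t + xi n t)%R); last first.
  by apply/funext => t; rewrite psumS.
exact: measurable_rV_add.
Qed.

HB.instance Definition _ n := isMeasurableFun.Build _ _ _ _ (psum n) (measurable_psum n).

Definition sum_law n : probability V R := distribution P (psum n).

Hypothesis indep : mutually_independent xi.

Let mcap (J : seq nat) (A : nat -> set V) : (forall k, measurable (A k)) ->
  measurable (\bigcap_(k in [set` J]) (xi k @^-1` A k)).
Proof.
move=> mA; apply: fin_bigcap_measurable => // k _.
by rewrite -[X in measurable X]setTI; exact: measurable_funPT.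
Qed.

(** The list J of later indices is arbitrary because the induction step takes index n out of the sum
    and puts it into J. *)
Lemma psum_indep n (J : seq nat) (A : nat -> set V) (B : set V) :
  uniq J -> all (leq n) J -> (forall k, measurable (A k)) -> measurable B ->
  P (psum n @^-1` B `&` \bigcap_(k in [set` J]) (xi k @^-1` A k)) =
  P (psum n @^-1` B) * \prod_(k <- J) P (xi k @^-1` A k).
Proof.
elim: n J A B => [|n IH] J A B uJ nJ mA mB.
  have [B0|B0] := pselect (B 0%R).
    rewrite (_ : psum 0 @^-1` B = setT); last first.
      by apply/seteqP; split => // t _; rewrite /= /psum big_ord0.
    by rewrite setTI probability_setT mul1e indep.
  rewrite (_ : psum 0 @^-1` B = set0); last first.
    by apply/seteqP; split => // t; rewrite /= /psum big_ord0.
  by rewrite set0I measure0 mul0e.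
pose X : set (V * V) := (fun p : V * V => (p.1 + p.2)%R) @^-1` B.
have mX : measurable X.
  by rewrite -[X in measurable X]setTI; apply: (@measurable_rV_addp R d).
have mpair : measurable_fun setT (fun t => (psum n t, xi n t)).
  by apply/measurable_fun_pairP; split; [exact: measurable_psum|exact: measurable_funPT].
(* Restricted to the event of the later variables, the joint law of [psum n] and [xi n] is the
   probability of that event times a product measure, since the two agree on rectangles by
   induction. *)
have key (J' : seq nat) (A' : nat -> set V) : uniq J' -> all (leq n.+1) J' ->
    (forall k, measurable (A' k)) ->
    P (psum n.+1 @^-1` B `&` \bigcap_(k in [set` J']) (xi k @^-1` A' k)) =
    \prod_(k <- J') P (xi k @^-1` A' k) *
      (sum_law n \x distribution P (xi n)) X.
  move=> uJ' nJ' mA'.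
  pose E := \bigcap_(k in [set` J']) (xi k @^-1` A' k).
  have mE : measurable E by exact: mcap.
  have PE : P E = \prod_(k <- J') P (xi k @^-1` A' k) by exact: indep.
  have [r rE] : exists r : {nonneg R}, P E = r%:num%:E.
    have r0 : (0 <= fine (P E))%R by exact: fine_ge0.
    by exists (NngNum r0); rewrite /= fineK// fin_num_measure.
  rewrite -PE rE.
  pose m' := image_measure (mrestr P mE) (pack_mfun mpair).
  have -> : P (psum n.+1 @^-1` B `&` E) = m' X.
    rewrite /m' /image_measure /pushforward /mrestr; congr (P (_ `&` _)).
    by apply/seteqP; split => t; rewrite /X/= psumS.
  transitivity ((mscale r (sum_law n) \x distribution P (xi n)) X); last first.
    rewrite /product_measure1 ge0_integral_mscale//.
    exact: measurable_fun_xsection.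
  apply/esym; apply: product_measure_unique => // B1 B2 mB1 mB2.
  rewrite /m' /image_measure /pushforward /mrestr /mscale/= /distribution /pushforward.
  (* The condition on [xi n] becomes the condition at the new index n of the list. *)
  pose A2 k := if k == n then B2 else A' k.
  have mA2 k : measurable (A2 k) by rewrite /A2; case: ifP.
  have nNJ : n \notin J'.
    by apply/negP => /(allP nJ'); rewrite ltnn.
  have eqA2 k : k \in J' -> A2 k = A' k.
    by rewrite /A2; case: eqP => // ->; rewrite (negbTE nNJ).
  transitivity (P (psum n @^-1` B1 `&` \bigcap_(k in [set` n :: J']) (xi k @^-1` A2 k))).
    congr (P _); apply/seteqP; split => t /=.
      move=> [[t1 t2] tE]; split => // k /=; rewrite inE => /predU1P[->|kJ].
        by rewrite /A2 eqxx.
      by rewrite eqA2//; exact: tE.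
    move=> [t1 tE]; split; first split => //.
      by have := tE n (mem_head _ _); rewrite /= /A2 eqxx.
    move=> k kJ; have := tE k; rewrite /= eqA2//; apply.
    by rewrite /= inE kJ orbT.
  rewrite (IH (n :: J') A2 B1)//=; last 2 first.
  - by rewrite nNJ.
  - rewrite leqnn/=; apply/allP => k kJ.
    by have := allP nJ' _ kJ; exact: ltnW.
  rewrite big_cons/= {1}/A2 eqxx.
  rewrite (_ : \prod_(k <- J') P (xi k @^-1` A2 k) = \prod_(k <- J') P (xi k @^-1` A' k)); last first.
    by apply: eq_big_seq => k kJ; rewrite eqA2.
  by rewrite -PE rE [in LHS]muleA [LHS]muleC muleA.
rewrite key// muleC; congr (_ * _).
(* With no later variable, [key] identifies the product-measure factor as the probability that
   [psum n.+1] lies in B. *)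
have := key [::] (fun=> setT); rewrite !big_nil mul1e => <-//.
by rewrite (_ : \bigcap_(k in _) _ = setT) ?setIT//; apply/seteqP; split => // t _ k.
Qed.

Lemma sum_lawS_prod n (B : set V) : measurable B ->
  sum_law n.+1 B = mconv (sum_law n) (distribution P (xi n)) B.
Proof.
move=> mB.
have mpair : measurable_fun setT (fun t => (psum n t, xi n t)).
  by apply/measurable_fun_pairP; split; [exact: measurable_psum|exact: measurable_funPT].
rewrite /mconv /image_measure /pushforward /=.
rewrite (@product_measure_unique _ _ _ _ _ (sum_law n) (distribution P (xi n))
  (image_measure P (pack_mfun mpair)))//.
- rewrite /image_measure /sum_law /distribution /pushforward; congr (P _).
  by apply/seteqP; split => t /=; rewrite psumS.
- move=> B1 B2 mB1 mB2; rewrite /image_measure /sum_law /distribution /pushforward.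
  have := @psum_indep n [:: n] (fun=> B2) B1; rewrite big_seq1 => <-//; last by rewrite /= leqnn.
  by congr (P _); apply/seteqP; split => t /= [t1 t2]; split => //;
    [move=> k /=; rewrite inE => /eqP -> | apply: t2; exact: mem_head].
- by rewrite -[X in measurable X]setTI; apply: (@measurable_rV_addp R d).
Qed.

Hypothesis idist : identically_distributed xi.

Lemma ge0_integral_sum_lawS n (f : V -> \bar R) : measurable_fun setT f ->
  (forall x, 0 <= f x) ->
  \int[sum_law n.+1]_x f x = \int[sum_law n]_s \int[distribution P (xi 0%N)]_v f (s + v)%R.
Proof.
move=> mf f0.
rewrite (@eq_measure_integral _ _ _ _ (mconv (sum_law n) (distribution P (xi n))))//; last first.
  by move=> A mA _; exact: sum_lawS_prod.
rewrite [LHS](ge0_integral_mconv _ _ mf f0); apply: eq_integral => s _.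
by apply: eq_measure_integral => A mA _; exact: idist.
Qed.

Lemma ge0_integral_sum_law0 (f : V -> \bar R) : measurable_fun setT f ->
  (forall x, 0 <= f x) -> \int[sum_law 0]_x f x = f 0%R.
Proof.
move=> mf f0; rewrite ge0_integral_distribution//.
transitivity (\int[P]_t cst (f 0%R) t).
  by apply: eq_integral => t _; rewrite /= /psum big_ord0.
by rewrite integral_cst//= probability_setT mule1.
Qed.

Lemma ge0_integral_sum_lawD a b (f : V -> \bar R) : measurable_fun setT f ->
  (forall x, 0 <= f x) ->
  \int[sum_law (a + b)%N]_x f x = \int[sum_law a]_s \int[sum_law b]_v f (s + v)%R.
Proof.
have mfs (g : V -> \bar R) s : measurable_fun setT g ->
    measurable_fun setT (fun v : V => g (s + v)%R).
  by move=> mg; under eq_fun do rewrite addrC; exact: (measurableT_comp mg (measurable_rV_shift s)).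
elim: b f => [|b IH] f mf f0.
  rewrite addn0; apply: eq_integral => s _.
  by rewrite ge0_integral_sum_law0 ?addr0//; exact: mfs.
rewrite addnS ge0_integral_sum_lawS// IH//; last 2 first.
- exact: measurable_mconv_section.
- by move=> x; exact: integral_ge0.
apply: eq_integral => s _.
rewrite [RHS](ge0_integral_sum_lawS b (mfs _ s mf) (fun _ => f0 _)).
by apply: eq_integral => v _; apply: eq_integral => u _; rewrite addrA.
Qed.

Lemma distribution_normalized_sum n (A : set V) :
  distribution P (normalized_sum xi n) A =
  sum_law n [set x | A ((Num.sqrt n%:R)^-1 *: x)%R].
Proof. by []. Qed.

End partial_sums.

(** * The heat kernel and Lindeberg's argument *)

Section mean_value_bounds.
Context (R : realType).
Implicit Types (f : R -> R) (a b M : R).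

Lemma mvt_bound f f1 a b M : a <= b ->
  (forall x, a <= x <= b -> is_derive x 1 f (f1 x)) ->
  (forall x, a <= x <= b -> `|f1 x| <= M) ->
  `|f b - f a| <= M * (b - a).
Proof.
move=> ab df fM.
have cf : {within `[a, b], continuous f}.
  apply: derivable_within_continuous => x; rewrite in_itv/= => xab.
  exact: (@ex_derive _ _ _ _ _ _ _ (df x xab)).
have [|c] := @MVT_segment _ f f1 a b ab _ cf.
  by move=> x; rewrite in_itv/= => /andP[ax xb]; apply: df; rewrite !ltW.
rewrite in_itv/= => cab ->; rewrite normrM (ger0_norm (_ : 0 <= b - a)) ?subr_ge0//.
by rewrite ler_wpM2r ?subr_ge0// fM.
Qed.

Lemma taylor1_bound f f1 f2 a b M : a <= b ->
  (forall x, a <= x <= b -> is_derive x 1 f (f1 x)) ->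
  (forall x, a <= x <= b -> is_derive x 1 f1 (f2 x)) ->
  (forall x, a <= x <= b -> `|f2 x| <= M) ->
  `|f b - f a - f1 a * (b - a)| <= M * (b - a) ^+ 2.
Proof.
move=> ab df df1 fM.
have aab : a <= a <= b by rewrite lexx.
have M0 : 0 <= M := le_trans (normr_ge0 _) (fM a aab).
have f1M x : a <= x <= b -> `|f1 x - f1 a| <= M * (b - a).
  move=> /andP[ax xb]; apply: (@le_trans _ _ (M * (x - a))).
    apply: (@mvt_bound f1 f2) => // y /andP[ay yx].
    - by apply: df1; rewrite ay (le_trans yx).
    - by apply: fM; rewrite ay (le_trans yx).
  by rewrite ler_wpM2l// lerB.
have := @mvt_bound (fun x => f x - f1 a * x) (fun x => f1 x - f1 a) a b (M * (b - a)) ab.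
rewrite [X in `|X|](_ : _ = f b - f a - f1 a * (b - a)); last by ring.
rewrite -mulrA -expr2; apply => // x xab.
have dx := df x xab.
by apply: is_derive_eq; rewrite /GRing.scale/= mulr1.
Qed.

(** Bounding the oscillation of the second derivative, rather than a third derivative, lets the
    lemma be used both with a bound on f2 and with one on its derivative. Subtracting a quadratic
    reduces it to [taylor1_bound]. *)
Lemma taylor2_bound f f1 f2 a b M : a <= b ->
  (forall x, a <= x <= b -> is_derive x 1 f (f1 x)) ->
  (forall x, a <= x <= b -> is_derive x 1 f1 (f2 x)) ->
  (forall x, a <= x <= b -> `|f2 x - f2 a| <= M) ->
  `|f b - f a - f1 a * (b - a) - f2 a * (b - a) ^+ 2 / 2| <= M * (b - a) ^+ 2.
Proof.
move=> ab df df1 fM.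
have := @taylor1_bound (fun x => f x - (f2 a / 2) * (x - a) ^+ 2)
  (fun x => f1 x - f2 a * (x - a)) (fun x => f2 x - f2 a) a b M ab.
rewrite [X in `|X|](_ : _ = f b - f a - f1 a * (b - a) - f2 a * (b - a) ^+ 2 / 2); last first.
  by field.
apply => // x xab.
- have dx := df x xab; apply: is_derive_eq.
  by rewrite /GRing.scale/= subr0 !mulr1; field.
- have dx := df1 x xab; apply: is_derive_eq.
  by rewrite /GRing.scale/= subr0 mulr1.
Qed.

Lemma expR_le_pow (x : R) (n : nat) : 0 <= x -> x ^+ n * expR (- x) <= n`!%:R.
Proof.
move=> x0; rewrite expRN ler_pdivrMr ?expR_gt0//.
rewrite mulrC -ler_pdivrMr ?ltr0n ?fact_gt0//.
case: n => [|n]; first by rewrite expr0 fact0 divr1 -expR0 ler_expR.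
by apply: le_trans (expR_ge1Dxn n x0); rewrite lerDr.
Qed.

End mean_value_bounds.

Section gaussian_profile.
Context (R : realType) (al be ga : R).
Hypotheses (al0 : 0 <= al) (ga0 : 0 <= ga) (disc : be ^+ 2 <= 4 * al * ga).

(** The exponent of the heat kernel along the segment from z to z - v: al = |z|^2 / 2t, be = z.v /
    t, ga = |v|^2 / 2t, and [disc] is then the Cauchy-Schwarz inequality. [r] is minus the
    derivative of [q]. *)
Let q (s : R) := al - be * s + ga * s ^+ 2.
Let r (s : R) := be - 2 * ga * s.
Let E (s : R) := expR (- q s).

Let dE (s : R) : is_derive s 1 E (r s * E s).
Proof.
have dq : is_derive s 1 (fun s => - q s) (r s).
  by apply: is_derive_eq; rewrite /GRing.scale/= /r; ring.
have := @is_derive1_comp R expR (fun s => - q s) s _ _ (is_derive_expR (- q s)) dq.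
by rewrite mulrC.
Qed.

Let dE1 (s : R) : is_derive s 1 (fun s => r s * E s) ((r s ^+ 2 - 2 * ga) * E s).
Proof.
have dr : is_derive s 1 r (- (2 * ga)).
  by apply: is_derive_eq; rewrite /GRing.scale/=; ring.
have := dE s => dEs.
by apply: is_derive_eq; rewrite /GRing.scale/=; ring.
Qed.

Let dE2 (s : R) : is_derive s 1 (fun s => (r s ^+ 2 - 2 * ga) * E s)
  ((r s ^+ 3 - 6 * ga * r s) * E s).
Proof.
have dr : is_derive s 1 r (- (2 * ga)).
  by apply: is_derive_eq; rewrite /GRing.scale/=; ring.
have := dE s => dEs.
by apply: is_derive_eq; rewrite /GRing.scale/=; ring.
Qed.

(** The discriminant condition. It bounds each derivative of E by a polynomial in q times exp(-q),
    hence uniformly in al and be. *)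
Let r2 s : r s ^+ 2 <= 4 * ga * q s.
Proof.
rewrite -subr_ge0 (_ : _ - _ = 4 * al * ga - be ^+ 2) ?subr_ge0//.
by rewrite /q /r; ring.
Qed.

Let q0 s : 0 <= q s.
Proof.
have [g0|g0] := eqVneq ga 0.
  move: disc; rewrite /q g0 mulr0 mul0r addr0 => h.
  have /eqP : be ^+ 2 == 0 by rewrite eq_le h sqr_ge0.
  by move/eqP; rewrite sqrf_eq0 => /eqP ->; rewrite mul0r subr0.
have {}g0 : 0 < ga by rewrite lt_def g0.
rewrite -(@pmulr_rge0 _ (4 * ga)); first exact: le_trans (sqr_ge0 _) (r2 s).
by rewrite mulr_gt0.
Qed.

Let qE n s : q s ^+ n * E s <= n`!%:R.
Proof. exact: expR_le_pow. Qed.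

Let E2_le s : `|(r s ^+ 2 - 2 * ga) * E s| <= 6 * ga.
Proof.
rewrite normrM (gtr0_norm (expR_gt0 _)).
apply: (@le_trans _ _ ((4 * ga * q s + 2 * ga) * E s)).
  rewrite ler_wpM2r ?expR_ge0//; apply: (le_trans (ler_normB _ _)).
  by rewrite !ger0_norm ?sqr_ge0 ?mulr_ge0// lerD2r r2.
rewrite (_ : _ * _ = ga * (4 * (q s ^+ 1 * E s) + 2 * (q s ^+ 0 * E s))); last by ring.
rewrite [leRHS]mulrC ler_wpM2l//; have := qE 1 s; have := qE 0 s.
by rewrite !factE/=; lra.
Qed.

Let E3_le s : `|(r s ^+ 3 - 6 * ga * r s) * E s| <= 48 * (ga * Num.sqrt ga).
Proof.
rewrite normrM (gtr0_norm (expR_gt0 _)).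
have q1 : 0 <= 1 + q s by have := q0 s; lra.
have rs : `|r s| <= 2 * Num.sqrt ga * (1 + q s).
  rewrite -(@ler_pXn2r _ 2)// ?nnegrE ?(mulr_ge0 (mulr_ge0 _ _) q1) ?sqrtr_ge0//.
  rewrite real_normK ?num_real//; apply: (le_trans (r2 s)).
  rewrite !exprMn sqr_sqrtr// (_ : 2 ^+ 2 = 4); last by rewrite -natrX.
  apply: ler_wpM2l; first by rewrite mulr_ge0.
  by have := q0 s; nra.
apply: (@le_trans _ _ (2 * Num.sqrt ga * (1 + q s) * (4 * ga * q s + 6 * ga) * E s)).
  apply: ler_wpM2r; first exact: expR_ge0.
  rewrite (_ : r s ^+ 3 - _ = r s * (r s ^+ 2 - 6 * ga)); last by ring.
  rewrite normrM ler_pM//; apply: (le_trans (ler_normB _ _)).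
  by rewrite !ger0_norm ?sqr_ge0 ?mulr_ge0// lerD2r r2.
rewrite (_ : _ * E s = ga * Num.sqrt ga * (8 * (q s ^+ 2 * E s) + 20 * (q s ^+ 1 * E s) +
   12 * (q s ^+ 0 * E s))); last by ring.
rewrite [leRHS]mulrC ler_wpM2l ?mulr_ge0 ?sqrtr_ge0//.
have := qE 2 s; have := qE 1 s; have := qE 0 s.
by rewrite !factE/=; lra.
Qed.

(** The second derivative oscillates by at most a multiple of ga, and by at most a multiple of
    ga^(3/2). The minimum of both is of second order for long steps and of third order for short
    ones; this is what makes Lindeberg's argument work with second moments only. *)
Lemma gaussian_profile_taylor :
  `|expR (- (al - be + ga)) - expR (- al) - be * expR (- al) -
    (be ^+ 2 - 2 * ga) * expR (- al) / 2| <= 48 * (ga * Num.min 1 (Num.sqrt ga)).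
Proof.
have E0 : E 0 = expR (- al) by rewrite /E /q mulr0 subr0 expr0n mulr0 addr0.
have E1 : E 1 = expR (- (al - be + ga)) by rewrite /E /q !mulr1 expr1n mulr1.
have r0 : r 0 = be by rewrite /r mulr0 subr0.
suff H M : (forall x, 0 <= x <= 1 -> `|(r x ^+ 2 - 2 * ga) * E x -
    (r 0 ^+ 2 - 2 * ga) * E 0| <= M) ->
   `|expR (- (al - be + ga)) - expR (- al) - be * expR (- al) -
    (be ^+ 2 - 2 * ga) * expR (- al) / 2| <= M.
  rewrite minr_pMr// mulr1 minr_pMr// le_min; apply/andP; split; apply: H => x /andP[x0 x1].
    apply: (le_trans (ler_normB _ _)).
    by have := E2_le x; have := E2_le 0; move: ga0; lra.
  apply: (@le_trans _ _ (48 * (ga * Num.sqrt ga) * (x - 0))).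
    by apply: (mvt_bound x0 (fun y _ => dE2 y) (fun y _ => E3_le y)).
  by rewrite subr0 ler_piMr// !mulr_ge0// sqrtr_ge0.
move=> h; have := taylor2_bound ler01 (fun x _ => dE x) (fun x _ => dE1 x) h.
by rewrite subr0 expr1n !mulr1 E0 E1 r0.
Qed.

End gaussian_profile.

Section heat_kernel.
Context (R : realType) (d : nat).
Local Notation V := 'rV[R]_d.
Local Notation D := (d%:R / 2 : R).
Implicit Types (x y z v : V) (t e h : R).

Definition dotp x y : R := \sum_i x ord0 i * y ord0 i.
Definition sqn x : R := \sum_i x ord0 i ^+ 2.

Lemma sqn_ge0 x : 0 <= sqn x.
Proof. by apply: sumr_ge0 => i _; exact: sqr_ge0. Qed.

(** Cauchy-Schwarz, by Lagrange's identity. *)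
Lemma dotp_sq_le x y : dotp x y ^+ 2 <= sqn x * sqn y.
Proof.
have : 0 <= \sum_i \sum_j (x ord0 i * y ord0 j - x ord0 j * y ord0 i) ^+ 2.
  by apply: sumr_ge0 => i _; apply: sumr_ge0 => j _; exact: sqr_ge0.
suff -> : \sum_i \sum_j (x ord0 i * y ord0 j - x ord0 j * y ord0 i) ^+ 2 =
    2 * (sqn x * sqn y - dotp x y ^+ 2) by rewrite pmulr_rge0// subr_ge0.
have E1 : sqn x * sqn y = \sum_i \sum_j (x ord0 i * y ord0 j) ^+ 2.
  rewrite /sqn mulr_suml; apply: eq_bigr => i _; rewrite mulr_sumr.
  by apply: eq_bigr => j _; rewrite exprMn.
have E2 : dotp x y ^+ 2 = \sum_i \sum_j (x ord0 i * y ord0 i * (x ord0 j * y ord0 j)).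
  by rewrite expr2 {1}/dotp mulr_suml; apply: eq_bigr => i _; rewrite mulr_sumr.
have E3 : sqn x * sqn y = \sum_i \sum_j (x ord0 j * y ord0 i) ^+ 2.
  by rewrite E1 exchange_big.
rewrite (_ : 2 * _ = sqn x * sqn y + sqn x * sqn y - 2 * dotp x y ^+ 2); last by ring.
rewrite {1}E1 E3 E2 mulr_sumr -big_split -sumrB; apply: eq_bigr => i _ /=.
rewrite mulr_sumr -big_split -sumrB; apply: eq_bigr => j _ /=.
by ring.
Qed.

Lemma sqnB x y : sqn (x - y) = sqn x - 2 * dotp x y + sqn y.
Proof.
rewrite /sqn /dotp mulr_sumr -sumrB -big_split; apply: eq_bigr => i _.
by rewrite !mxE /=; ring.
Qed.

Lemma dotpZr (a : R) x y : dotp x (a *: y) = a * dotp x y.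
Proof. by rewrite /dotp mulr_sumr; apply: eq_bigr => i _; rewrite mxE mulrCA. Qed.

Lemma sqnZ (a : R) x : sqn (a *: x) = a ^+ 2 * sqn x.
Proof. by rewrite /sqn mulr_sumr; apply: eq_bigr => i _; rewrite mxE exprMn. Qed.

Lemma norm2_sq x : norm2 x ^+ 2 = sqn x.
Proof. by rewrite /norm2 sqr_sqrtr// sqn_ge0. Qed.

(** The constant (2 pi t)^(-d/2), written as an exponential so that the kernel can be differentiated
    in t by one chain rule. *)
Definition heat_peak t : R := expR (- (D * ln (2 * pi * t))).
Definition heat t x : R := heat_peak t * expR (- (sqn x / (2 * t))).

Lemma heat_peak_gt0 t : 0 < heat_peak t. Proof. exact: expR_gt0. Qed.

Lemma heat_ge0 t x : 0 <= heat t x.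
Proof. by rewrite mulr_ge0 ?expR_ge0. Qed.

Lemma heat_le_peak t x : 0 < t -> heat t x <= heat_peak t.
Proof.
move=> t0; rewrite /heat ler_piMr ?expR_ge0// -expR0 ler_expR oppr_le0.
by rewrite divr_ge0 ?sqn_ge0// mulr_ge0// ltW.
Qed.

Lemma heat_peak_nincr e t : 0 < e -> e <= t -> heat_peak t <= heat_peak e.
Proof.
move=> e0 et; have t0 := lt_le_trans e0 et.
rewrite ler_expR lerN2 ler_wpM2l ?divr_ge0//.
by rewrite ler_ln ?posrE ?mulr_gt0 ?pi_gt0// ler_wpM2l ?mulr_ge0 ?pi_ge0.
Qed.

Lemma heat_le e t x : 0 < e -> e <= t -> heat t x <= heat_peak e.
Proof.
move=> e0 et; apply: le_trans (heat_peak_nincr e0 et).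
by rewrite heat_le_peak// (lt_le_trans e0).
Qed.

Lemma heat1E x : heat 1 x = std_gauss_pdf x.
Proof.
rewrite /heat /std_gauss_pdf /heat_peak !mulr1 norm2_sq; congr (_ * _).
by rewrite /powR gt_eqF ?mulr_gt0 ?pi_gt0// mulNr.
Qed.

Lemma measurable_sqn : measurable_fun setT sqn.
Proof.
apply: measurable_sum => i; apply: measurable_funX; exact: measurable_rV_coord.
Qed.

Lemma measurable_heat t : measurable_fun setT (heat t).
Proof.
apply: measurable_funM => //; apply: measurableT_comp => //.
by apply: measurableT_comp => //; apply: measurable_funM => //; exact: measurable_sqn.
Qed.

Lemma heat_taylor t z v : 0 < t ->
  `|heat t (z - v) - heat t z - dotp z v / t * heat t z -
    ((dotp z v / t) ^+ 2 - sqn v / t) * heat t z / 2| <=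
  heat_peak t * (48 * (sqn v / (2 * t) * Num.min 1 (Num.sqrt (sqn v / (2 * t))))).
Proof.
move=> t0; have t20 : 0 < 2 * t by rewrite mulr_gt0.
have al0 : 0 <= sqn z / (2 * t) by rewrite divr_ge0 ?sqn_ge0 ?ltW.
have ga0 : 0 <= sqn v / (2 * t) by rewrite divr_ge0 ?sqn_ge0 ?ltW.
have disc : (dotp z v / t) ^+ 2 <= 4 * (sqn z / (2 * t)) * (sqn v / (2 * t)).
  rewrite [leRHS](_ : _ = sqn z * sqn v / t ^+ 2); last by field; rewrite gt_eqF.
  by rewrite expr_div_n ler_wpM2r ?dotp_sq_le// invr_ge0 exprn_ge0// ltW.
have := gaussian_profile_taylor al0 ga0 disc.
rewrite -(ler_pM2l (heat_peak_gt0 t)); apply: le_trans.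
rewrite -[X in X * `|_|](gtr0_norm (heat_peak_gt0 t)) -normrM.
rewrite le_eqVlt; apply/orP; left; apply/eqP; congr `|_|.
rewrite /heat (_ : sqn (z - v) / (2 * t) =
  sqn z / (2 * t) - dotp z v / t + sqn v / (2 * t)); last first.
  by rewrite sqnB; field; rewrite gt_eqF.
move: (dotp z v / t) (expR _) (expR _) (heat_peak t) => b E1 E2 P.
rewrite (_ : 2 * (sqn v / (2 * t)) = sqn v / t); last by field; rewrite gt_eqF.
by ring.
Qed.

Definition heat_dt t z : R := (sqn z / 2 / t ^+ 2 - D / t) * heat t z.

Let heat_dtt t z : R :=
  ((sqn z / 2 / t ^+ 2 - D / t) ^+ 2 + D / t ^+ 2 - 2 * (sqn z / 2) / t ^+ 3) * heat t z.

Let pi2 : 0 < 2 * pi :> R. Proof. by rewrite mulr_gt0 ?pi_gt0. Qed.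

Lemma is_derive_heat t z : 0 < t -> is_derive t 1 (fun t => heat t z) (heat_dt t z).
Proof.
move=> t0; have tn0 : t != 0 by rewrite gt_eqF.
have dV : is_derive t 1 (fun t => t^-1) (- t ^- 2).
  have := @is_deriveV R id t 1 1 tn0 (is_derive_id _ _).
  by rewrite /GRing.scale/= mulr1.
have dln : is_derive t 1 (fun t => ln (2 * pi * t)) t^-1.
  have h1 : is_derive t 1 (fun t : R => 2 * pi * t) (2 * pi).
    by apply: is_derive_eq; rewrite /GRing.scale/= mulr1.
  have h2 : 0 < 2 * pi * t by rewrite mulr_gt0.
  have := @is_derive1_comp R (@ln R) (fun t => 2 * pi * t) t _ _ (is_derive1_ln h2) h1.
  by rewrite invfM mulrAC mulVf ?mul1r// gt_eqF.
pose q (t : R) := - (D * ln (2 * pi * t)) - sqn z / 2 * t^-1.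
have dq : is_derive t 1 q (sqn z / 2 / t ^+ 2 - D / t).
  by apply: is_derive_eq; rewrite /GRing.scale/=; ring.
have qE s : heat s z = expR (q s).
  rewrite /heat /heat_peak /q /= expRD; congr (_ * expR (- _)).
  by rewrite invfM mulrA.
have -> : (fun t => heat t z) = expR \o q by apply/funext => s; exact: qE.
rewrite /heat_dt qE mulrC.
exact: (@is_derive1_comp R expR q t _ _ (is_derive_expR (q t)) dq).
Qed.

Let is_derive_heat_dt t z : 0 < t ->
  is_derive t 1 (fun t => heat_dt t z) (heat_dtt t z).
Proof.
move=> t0; have tn0 : t != 0 by rewrite gt_eqF.
have dV : is_derive t 1 (fun t => t^-1) (- t ^- 2).
  have := @is_deriveV R id t 1 1 tn0 (is_derive_id _ _).
  by rewrite /GRing.scale/= mulr1.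
have dh := is_derive_heat z t0.
have -> : (fun t => heat_dt t z) = (fun t => (sqn z / 2 * t^-1 ^+ 2 - D * t^-1) * heat t z).
  by apply/funext => s; rewrite /heat_dt exprVn.
apply: is_derive_eq; rewrite /heat_dtt /heat_dt /GRing.scale/=.
by field.
Qed.

Let heat_moment (n : nat) t z : 0 < t ->
  (sqn z / 2 / t) ^+ n * heat t z <= n`!%:R * heat_peak t.
Proof.
move=> t0; rewrite /heat mulrCA [leRHS]mulrC ler_wpM2l ?expR_ge0//.
rewrite invfM mulrA; apply: expR_le_pow.
by rewrite !divr_ge0 ?sqn_ge0// ltW.
Qed.

Lemma heat_dt_le e t z : 0 < e -> e <= t ->
  `|heat_dt t z| <= (D + 1) * heat_peak e / e.
Proof.
move=> e0 et; have t0 := lt_le_trans e0 et; have tn0 : t != 0 by rewrite gt_eqF.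
have D0 : 0 <= D by rewrite divr_ge0.
have h0 := heat_moment 0 z t0; have h1 := heat_moment 1 z t0.
rewrite fact0 expr0 !mul1r in h0; rewrite (_ : 1`! = 1%N)// expr1 mul1r in h1.
have u0 : 0 <= sqn z / 2 / t by rewrite !divr_ge0 ?sqn_ge0// ltW.
have P0 := ltW (heat_peak_gt0 t); have H0 := heat_ge0 t z.
have tV : 0 <= t^-1 by rewrite invr_ge0 ltW.
have uH0 := mulr_ge0 u0 H0; have DH0 := mulr_ge0 D0 H0.
have D1 : 0 <= D + 1 by rewrite addr_ge0.
have D1P := mulr_ge0 D1 P0.
apply: (@le_trans _ _ ((D + 1) * heat_peak t / t)); last first.
  apply: ler_pM => //.
  - by rewrite ler_wpM2l ?addr_ge0// heat_peak_nincr.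
  - by rewrite lef_pV2 ?posrE.
rewrite /heat_dt (_ : _ * heat t z = (sqn z / 2 / t * heat t z - D * heat t z) / t); last by field.
rewrite normrM normfV (gtr0_norm t0) ler_wpM2r ?invr_ge0 ?(ltW t0)//.
apply: (le_trans (ler_normB _ _)); rewrite (ger0_norm uH0) (ger0_norm DH0).
rewrite mulrDl mul1r addrC; apply: lerD => //.
by rewrite ler_wpM2l.
Qed.

Lemma heat_time_taylor e t h z : 0 < e -> e <= t -> 0 <= h ->
  `|heat (t + h) z - heat t z - heat_dt t z * h| <=
  ((D ^+ 2 + 3 * D + 4) * heat_peak e / e ^+ 2) * h ^+ 2.
Proof.
move=> e0 et h0.
have th : t <= t + h by rewrite lerDl.
have pos s : t <= s <= t + h -> 0 < s by move=> /andP[ts _]; exact: lt_le_trans (lt_le_trans e0 et) ts.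
have := @taylor1_bound R (fun t => heat t z) (fun t => heat_dt t z) (fun t => heat_dtt t z)
  t (t + h) ((D ^+ 2 + 3 * D + 4) * heat_peak e / e ^+ 2) th.
rewrite [t + h - t]addrAC subrr add0r; apply => s sth; have s0 := pos _ sth.
- exact: is_derive_heat.
- exact: is_derive_heat_dt.
have es : e <= s by case/andP: sth => ts _; exact: le_trans ts.
have sn0 : s != 0 by rewrite gt_eqF.
have D0 : 0 <= D by rewrite divr_ge0.
have m0 := heat_moment 0 z s0; have m1 := heat_moment 1 z s0; have m2 := heat_moment 2 z s0.
have u0 : 0 <= sqn z / 2 / s by rewrite !divr_ge0 ?sqn_ge0// ltW.
rewrite fact0 expr0 !mul1r in m0; rewrite (_ : 1`! = 1%N)// expr1 mul1r in m1.
rewrite (_ : 2`! = 2%N)// in m2.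
have H0 := heat_ge0 s z; have P0 := ltW (heat_peak_gt0 s).
have D1 : 0 <= D ^+ 2 + 3 * D + 4.
  by have := sqr_ge0 D; move: D0; lra.
have D1P := mulr_ge0 D1 P0.
have sV : 0 <= (s ^+ 2)^-1 by rewrite invr_ge0 sqr_ge0.
apply: (@le_trans _ _ ((D ^+ 2 + 3 * D + 4) * heat_peak s / s ^+ 2)); last first.
  apply: ler_pM => //.
  - by rewrite ler_wpM2l ?heat_peak_nincr.
  - rewrite lef_pV2 ?posrE ?exprn_gt0//.
    by apply: lerXn2r; rewrite ?nnegrE ?(ltW e0) ?(ltW s0).
rewrite /heat_dtt.
have -> : ((sqn z / 2 / s ^+ 2 - D / s) ^+ 2 + D / s ^+ 2 - 2 * (sqn z / 2) / s ^+ 3) * heat s z =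
  ((sqn z / 2 / s - D) ^+ 2 + D - 2 * (sqn z / 2 / s)) * heat s z / s ^+ 2 by field.
rewrite normrM (ger0_norm sV); apply: ler_wpM2r => //.
rewrite normrM (ger0_norm (heat_ge0 _ _)).
move: u0 H0 m0 m1 m2 P0.
move: (sqn z / 2 / s) (heat s z) (heat_peak s) => u H P u0 H0 m0 m1 m2 P0.
move: (d%:R / 2) D0 => c c0.
(* The moment bounds of order 2, 1 and 0 then give 2 + 2 (c + 1) + c^2 + c = c^2 + 3 c + 4. *)
apply: (@le_trans _ _ ((u ^+ 2 + 2 * (c + 1) * u + (c ^+ 2 + c)) * H)).
  apply: ler_wpM2r => //; rewrite ler_norml.
  have cu := mulr_ge0 c0 u0; have cc := mulr_ge0 c0 c0; have uu := mulr_ge0 u0 u0.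
  by rewrite !expr2; apply/andP; split; nra.
rewrite (_ : _ * H = u ^+ 2 * H + 2 * (c + 1) * (u * H) + (c ^+ 2 + c) * H); last by ring.
have k1 : 2 * (c + 1) * (u * H) <= 2 * (c + 1) * P.
  by rewrite ler_wpM2l// mulr_ge0// addr_ge0.
have k2 : (c ^+ 2 + c) * H <= (c ^+ 2 + c) * P.
  by rewrite ler_wpM2l// addr_ge0// sqr_ge0.
by move: k1 k2 m2; lra.
Qed.

End heat_kernel.

Section heat_integrals.
Context (R : realType) (d : nat).
Local Notation V := 'rV[R]_d.
Local Notation D := (d%:R / 2 : R).
Local Notation leb := (lebesgue_rV R d).

Lemma heat_prod (t : R) (x : V) : 0 < t ->
  heat t x = \prod_i normal_pdf 0 (Num.sqrt t) (x ord0 i).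
Proof.
move=> t0; rewrite normal_pdfE ?gt_eqF ?sqrtr_gt0// big_split/= prodr_const card_ord.
have y0 : 0 < 2 * pi * t by rewrite !mulr_gt0 ?pi_gt0.
congr (_ * _).
  rewrite /heat_peak /normal_peak sqr_sqrtr ?(ltW t0)//.
  rewrite (_ : t * pi *+ 2 = 2 * pi * t); last by rewrite -mulr_natr; ring.
  rewrite -powR12_sqrt ?(ltW y0)// /powR gt_eqF// -expRN -expRM_natl.
  by congr expR; field.
rewrite /normal_fun -expR_sum; congr expR.
rewrite /sqn mulr_suml -sumrN; apply: eq_bigr => i _.
by rewrite subr0 mulNr sqr_sqrtr ?(ltW t0)// -[t *+ 2]mulr_natl.
Qed.

Lemma integral_heat (t : R) : 0 < t -> (\int[leb]_x (heat t x)%:E = 1)%E.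
Proof.
move=> t0; under eq_integral do rewrite heat_prod//.
rewrite (integral_rV_prod (f := fun=> normal_pdf 0 (Num.sqrt t))).
- by rewrite big1// => i _; exact: integral_normal_pdf.
- by move=> _; exact: measurable_normal_pdf.
- by move=> _ x; exact: normal_pdf_ge0.
Qed.

(** Half of the Gaussian exponent absorbs the linear factor, and the other half is the kernel at
    time 2t. The first absolute moment is thus O(sqrt t), because the kernel at time 2t has integral
    1. *)
Lemma heat_abs_le (t : R) (x : V) : 0 < t ->
  (\sum_i `|x ord0 i|) * heat t x <=
  d%:R * (2 * Num.sqrt t) * expR (D * ln 2) * heat (2 * t) x.
Proof.
move=> t0.
have t20 : 0 < 2 * t by rewrite mulr_gt0.
have s0 : 0 < Num.sqrt t by rewrite sqrtr_gt0.
have hE : heat t x = expR (- (sqn x / (4 * t))) * (expR (D * ln 2) * heat (2 * t) x).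
  rewrite /heat /heat_peak -!expRD; congr expR.
  rewrite (_ : 2 * pi * (2 * t) = 2 * (2 * pi * t)); last by ring.
  rewrite (@lnM _ 2 (2 * pi * t)) ?posrE ?mulr_gt0 ?pi_gt0//.
  by field; rewrite gt_eqF.
rewrite hE [leLHS]mulrA -[leRHS]mulrA; apply: ler_wpM2r.
  by rewrite mulr_ge0 ?expR_ge0 ?heat_ge0.
rewrite mulr_suml.
apply: (@le_trans _ _ (\sum_(i < d) 2 * Num.sqrt t)); last first.
  by rewrite sumr_const card_ord -[leLHS]mulr_natl.
apply: ler_sum => i _.
apply: (@le_trans _ _ (`|x ord0 i| * expR (- (x ord0 i ^+ 2 / (4 * t))))).
  rewrite ler_wpM2l// ler_expR lerN2 ler_wpM2r ?invr_ge0 ?mulr_ge0 ?(ltW t0)//.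
  by rewrite /sqn (bigD1 i)//= lerDl sumr_ge0// => j _; exact: sqr_ge0.
rewrite expRN ler_pdivrMr ?expR_gt0//.
set u := _ / (4 * t).
apply: (@le_trans _ _ (2 * Num.sqrt t * (1 + u))); last first.
  by rewrite ler_wpM2l ?mulr_ge0 ?(ltW s0)// expR_ge1Dx.
have tE : t = Num.sqrt t ^+ 2 by rewrite sqr_sqrtr// ltW.
have -> : 2 * Num.sqrt t * (1 + u) = 2 * Num.sqrt t + x ord0 i ^+ 2 / (2 * Num.sqrt t).
  by rewrite /u [in _ / (4 * t)]tE; field; rewrite gt_eqF.
rewrite -(ler_pM2r (_ : 0 < 2 * Num.sqrt t)) ?mulr_gt0//.
rewrite [leRHS]mulrDl divfK ?gt_eqF ?mulr_gt0//.
rewrite -[x ord0 i ^+ 2]real_normK ?num_real//.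
move: `|x ord0 i| (Num.sqrt t) s0 => a b b0; rewrite -subr_ge0.
have -> : 2 * b * (2 * b) + a ^+ 2 - a * (2 * b) = (a - b) ^+ 2 + 3 * b ^+ 2 by ring.
by apply: addr_ge0; [exact: sqr_ge0|apply: mulr_ge0; rewrite ?sqr_ge0].
Qed.

Lemma integral_heat_abs (t : R) : 0 < t ->
  (\int[leb]_x ((\sum_i `|x ord0 i|) * heat t x)%:E <=
   (d%:R * (2 * Num.sqrt t) * expR (D * ln 2))%:E)%E.
Proof.
move=> t0; have t20 : 0 < 2 * t by rewrite mulr_gt0.
set c := _ * expR _.
have c0 : 0 <= c by rewrite !mulr_ge0 ?sqrtr_ge0 ?expR_ge0.
rewrite -[leRHS]mule1 -(integral_heat t20) -ge0_integralZl//; last 2 first.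
- by apply/measurable_EFinP; exact: measurable_heat.
- by move=> x _; rewrite lee_fin heat_ge0.
apply: ge0_le_integral => //.
- by move=> x _; rewrite lee_fin mulr_ge0 ?heat_ge0// sumr_ge0.
- apply/measurable_EFinP; apply: measurable_funM; last exact: measurable_heat.
  apply: measurable_sum => i; apply: measurableT_comp => //.
  exact: measurable_rV_coord.
- by apply: measurable_funeM; apply/measurable_EFinP; exact: measurable_heat.
- by move=> x _; rewrite -EFinM lee_fin heat_abs_le.
Qed.

Lemma heat_near1 (t : R) (z : V) : 0 <= t ->
  `|heat (t + 1) z - heat 1 z| <= (D + 1) * heat_peak d 1 * t.
Proof.
move=> t0; have t1 : 1 <= t + 1 by rewrite lerDr.
have := @mvt_bound R (fun t => heat t z) (fun t => heat_dt t z) 1 (t + 1)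
  ((D + 1) * heat_peak d 1) t1.
rewrite addrK; apply => s /andP[s1 _].
- by apply: is_derive_heat; exact: lt_le_trans s1.
- by apply: (le_trans (heat_dt_le z ltr01 s1)); rewrite divr1.
Qed.

End heat_integrals.

Lemma measurable_sqrtr (R : realType) : measurable_fun setT (@Num.sqrt R).
Proof. by apply: continuous_measurable_fun; exact: sqrt_continuous. Qed.

Section lindeberg.
Context (R : realType) (d : nat).
Local Notation V := 'rV[R]_d.
Local Notation D := (d%:R / 2 : R).
Variable mu : probability V R.
Hypothesis int1 : forall i, mu.-integrable setT (fun v : V => (v ord0 i)%:E).
Hypothesis int2 : forall i j, mu.-integrable setT (fun v : V => (v ord0 i * v ord0 j)%:E).
Hypothesis mean0 : forall i, (\int[mu]_v (v ord0 i)%:E = 0)%E.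
Hypothesis cov1 : forall i j, (\int[mu]_v (v ord0 i * v ord0 j)%:E = (i == j)%:R%:E)%E.

Let int_dotp z : mu.-integrable setT (fun v : V => (dotp z v)%:E).
Proof.
rewrite /dotp; under eq_fun do rewrite -sumEFin.
by apply: integrable_sum => // i _; under eq_fun do rewrite EFinM; exact: integrableZl.
Qed.

Let dotp_sqE (z v : V) : dotp z v ^+ 2 =
  \sum_i \sum_j z ord0 i * z ord0 j * (v ord0 i * v ord0 j).
Proof.
rewrite expr2 {1}/dotp mulr_suml; apply: eq_bigr => i _.
by rewrite /dotp mulr_sumr; apply: eq_bigr => j _; ring.
Qed.

Let int_dotp2 z : mu.-integrable setT (fun v : V => (dotp z v ^+ 2)%:E).
Proof.
under eq_fun do rewrite dotp_sqE -sumEFin.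
apply: integrable_sum => // i _; under eq_fun do rewrite -sumEFin.
apply: integrable_sum => // j _; under eq_fun do rewrite EFinM.
exact: integrableZl.
Qed.

Lemma integrable_sqn : mu.-integrable setT (fun v : V => (sqn v)%:E).
Proof.
rewrite /sqn; under eq_fun do rewrite -sumEFin.
by apply: integrable_sum => // i _; exact: int2.
Qed.

Let integral_dotp z : (\int[mu]_v (dotp z v)%:E = 0)%E.
Proof.
rewrite /dotp; under eq_integral do rewrite -sumEFin.
rewrite integral_sum//; last first.
  by move=> i; under eq_fun do rewrite EFinM; exact: integrableZl.
rewrite big1// => i _; under eq_integral do rewrite EFinM.
by rewrite integralZl// mean0 mule0.
Qed.

Let integral_dotp2 z : (\int[mu]_v (dotp z v ^+ 2)%:E = (sqn z)%:E)%E.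
Proof.
have ij i j : mu.-integrable setT (fun v : V => (z ord0 i * z ord0 j * (v ord0 i * v ord0 j))%:E).
  by under eq_fun do rewrite EFinM; exact: integrableZl.
under eq_integral do rewrite dotp_sqE -sumEFin.
rewrite integral_sum//; last first.
  by move=> i; under eq_fun do rewrite -sumEFin; exact: integrable_sum.
rewrite /sqn -sumEFin; apply: eq_bigr => i _.
under eq_integral do rewrite -sumEFin.
rewrite integral_sum// (bigD1 i)//= big1 ?adde0.
  under eq_integral do rewrite EFinM.
  by rewrite integralZl// cov1 eqxx mule1.
move=> j ji; under eq_integral do rewrite EFinM.
by rewrite integralZl// cov1 eq_sym (negbTE ji) mule0.
Qed.

Let integral_sqn : (\int[mu]_v (sqn v)%:E = d%:R%:E)%E.
Proof.
rewrite /sqn; under eq_integral do rewrite -sumEFin.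
rewrite integral_sum//; last by move=> i; exact: int2.
rewrite (eq_bigr (fun=> 1%:E)%R); last by move=> i _; rewrite cov1 eqxx.
by rewrite sumEFin sumr_const card_ord.
Qed.

(** Up to a constant, n times the Taylor error of a step v / sqrt n, with Y proportional to |v|^2.
    It tends to 0 pointwise and is dominated by Y, so its mean tends to 0 as soon as Y is
    integrable. *)
Let trunc (Y : V -> R) n v := Y v * Num.min 1 (Num.sqrt (Y v / n%:R)).

Let trunc_cvg0 (Y : V -> R) : (forall v, 0 <= Y v) ->
  mu.-integrable setT (EFin \o Y) ->
  (\int[mu]_v (trunc Y n v)%:E @[n --> \oo] --> 0)%E.
Proof.
move=> Y0 iY.
have mY : measurable_fun setT Y by apply/measurable_EFinP; exact: measurable_int iY.
have mT n : measurable_fun setT (trunc Y n).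
  apply: measurable_funM => //; apply: measurable_minr => //.
  apply: (measurableT_comp (@measurable_sqrtr R)); exact: measurable_funM.
have := @dominated_convergence _ _ _ mu setT measurableT
  (fun n v => (trunc Y n v)%:E) (cst 0%E) (EFin \o Y).
case=> //.
- by move=> n; exact/measurable_EFinP.
- apply: aeW => v _; rewrite /=; apply/fine_cvgP; split; first by near=> n.
  rewrite /=.
  have [Yv|Yv] := eqVneq (Y v) 0.
    rewrite (_ : _ \o _ = cst 0); first exact: cvg_cst.
    by apply/funext => n; rewrite /= /trunc Yv mul0r.
  apply/cvgrPdist_le => e e0; near=> n.
  have n0 : 0 < n%:R :> R by rewrite ltr0n; near: n; exact: nbhs_infty_gt.
  rewrite /= sub0r normrN ger0_norm; last first.
    by rewrite mulr_ge0// le_min ler01 sqrtr_ge0.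
  have Ypos : 0 < Y v by rewrite lt_def Yv Y0.
  apply: (@le_trans _ _ (Y v * Num.sqrt (Y v / n%:R))).
    by rewrite ler_wpM2l// ge_min lexx orbT.
  rewrite mulrC -ler_pdivlMr//.
  have eY : 0 <= e / Y v by rewrite divr_ge0// ltW.
  rewrite -[leRHS]ger0_norm// -sqrtr_sqr ler_wsqrtr// ler_pdivrMr// mulrC -ler_pdivrMr; last first.
    by rewrite exprn_gt0// divr_gt0.
  by near: n; exact: nbhs_infty_ger.
- apply: aeW => v n _ /=; rewrite lee_fin ger0_norm.
    by rewrite /trunc ler_piMr// ge_min lexx.
  by rewrite mulr_ge0// le_min ler01 sqrtr_ge0.
- by move=> _ _; rewrite integral_cst// mul0e.
Unshelve. all: by end_near.
Qed.

Let heat_step_bound (e : R) (n : nat) (t : R) (z : V) : 0 < e -> (0 < n)%N -> e <= t ->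
  (`|\int[mu]_v (heat t (z - (Num.sqrt n%:R)^-1 *: v))%:E - (heat t z + heat_dt t z / n%:R)%:E| <=
  (48 * heat_peak d e / n%:R)%:E * \int[mu]_v (trunc (fun v => (sqn v / (2 * e))%R) n v)%:E)%E.
Proof.
move=> e0 n0 et; have t0 := lt_le_trans e0 et.
set s := (Num.sqrt n%:R)^-1.
have n0' : 0 < n%:R :> R by rewrite ltr0n.
have s0 : 0 < s by rewrite invr_gt0 sqrtr_gt0.
have s2 : s ^+ 2 = n%:R^-1 by rewrite /s exprVn sqr_sqrtr// ltW.
have t2e : 0 < 2 * e by rewrite mulr_gt0.
(* The second order Taylor polynomial of the kernel at z, ordered so that its mean involves only the
   known first and second moments. *)
pose L (v : V) := heat t z + (s / t * heat t z) * dotp z v +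
  (s ^+ 2 / t ^+ 2 * heat t z / 2) * dotp z v ^+ 2 - (s ^+ 2 / t * heat t z / 2) * sqn v.
have intZ (c : R) (f : V -> R) : mu.-integrable setT (fun v => (f v)%:E) ->
    mu.-integrable setT (fun v => (c * f v)%:E).
  by move=> fi; under eq_fun do rewrite EFinM; exact: integrableZl.
have integralZ (c : R) (f : V -> R) : mu.-integrable setT (fun v => (f v)%:E) ->
    (\int[mu]_v (c * f v)%:E = c%:E * \int[mu]_v (f v)%:E)%E.
  by move=> fi; under eq_integral do rewrite EFinM; rewrite integralZl.
have ic : mu.-integrable setT (fun=> (heat t z)%:E) by exact: finite_measure_integrable_cst.
have ec : (\int[mu]_v (heat t z)%:E = (heat t z)%:E)%E.
  by rewrite (integral_cst mu measurableT) /= probability_setT mule1.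
have i1 := intZ (s / t * heat t z) _ (int_dotp z).
have i2 := intZ (s ^+ 2 / t ^+ 2 * heat t z / 2) _ (int_dotp2 z).
have i3 := intZ (s ^+ 2 / t * heat t z / 2) _ integrable_sqn.
have i01 := integrableD measurableT ic i1.
have i012 := integrableD measurableT i01 i2.
have iL : mu.-integrable setT (fun v => (L v)%:E) by exact: (integrableB measurableT i012 i3).
have LE : (\int[mu]_v (L v)%:E = (heat t z + heat_dt t z / n%:R)%:E)%E.
  rewrite [LHS](integralB_EFin measurableT i012 i3).
  rewrite (integralD_EFin measurableT i01 i2) (integralD_EFin measurableT ic i1).
  rewrite (integralZ _ _ (int_dotp z)) (integralZ _ _ (int_dotp2 z)) (integralZ _ _ integrable_sqn).
  rewrite integral_dotp integral_dotp2 integral_sqn.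
  rewrite ec mule0 adde0.
  rewrite /=; congr EFin.
  by rewrite s2 /heat_dt; field; rewrite !gt_eqF.
have mh : measurable_fun setT (fun v : V => heat t (z - s *: v)).
  apply: (measurableT_comp (measurable_heat t)).
  rewrite (_ : (fun _ => _) = fun v : V => - s *: v + z); first exact: measurable_rV_affine.
  by apply/funext => v; rewrite scaleNr addrC.
have ih : mu.-integrable setT (fun v : V => (heat t (z - s *: v))%:E).
  apply: (le_integrable measurableT _ _ (finite_measure_integrable_cst mu (heat_peak d e) measurableT)).
    exact/measurable_EFinP.
  move=> v _; rewrite /= lee_fin (ger0_norm (heat_ge0 _ _)) (ger0_norm (ltW (heat_peak_gt0 _ _))).
  exact: heat_le.
have iB := integrableB measurableT ih iL.
have mB := measurable_int _ iB.
rewrite -LE -integralB//.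
apply: (le_trans (le_abse_integral mu measurableT mB)).
have iY : mu.-integrable setT (EFin \o (fun v : V => sqn v / (2 * e))).
  rewrite (_ : _ \o _ = fun v => ((2 * e)^-1%:E * (sqn v)%:E)%E).
    exact/integrableZl/integrable_sqn.
  by apply/funext => v; rewrite /= mulrC.
have mY : measurable_fun setT (fun v : V => sqn v / (2 * e)).
  by apply/measurable_EFinP; exact: measurable_int iY.
have mT : measurable_fun setT (trunc (fun v : V => sqn v / (2 * e)) n).
  apply: measurable_funM => //; apply: measurable_minr => //.
  apply: (measurableT_comp (@measurable_sqrtr R)); exact: measurable_funM.
have Y0 (v : V) : 0 <= sqn v / (2 * e) by rewrite divr_ge0 ?sqn_ge0 ?ltW.
have T0 (v : V) : 0 <= trunc (fun v : V => sqn v / (2 * e)) n v.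
  by rewrite mulr_ge0// le_min ler01 sqrtr_ge0.
have c0 : 0 <= 48 * heat_peak d e / n%:R.
  by rewrite divr_ge0 ?mulr_ge0// ltW// heat_peak_gt0.
have mTE : measurable_fun setT (fun v => (trunc (fun v : V => sqn v / (2 * e)) n v)%:E).
  exact/measurable_EFinP.
rewrite -ge0_integralZl//; last by move=> v _; rewrite lee_fin.
apply: ge0_le_integral => //.
- exact: measurableT_comp.
- exact: measurable_funeM.
move=> v _; rewrite -EFinB abse_EFin -EFinM lee_fin.
have := heat_taylor z (s *: v) t0.
rewrite dotpZr sqnZ.
rewrite (_ : _ - _ - _ - _ = heat t (z - s *: v) - L v); last first.
  by rewrite /L; field; rewrite gt_eqF.
move=> /le_trans; apply.
have -> : s ^+ 2 * sqn v / (2 * t) = sqn v / (2 * t) / n%:R by rewrite s2; ring.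
(* The error decreases with t, so its value at e bounds it uniformly in t. *)
have Yt : sqn v / (2 * t) <= sqn v / (2 * e).
  by rewrite ler_wpM2l ?sqn_ge0// lef_pV2 ?posrE ?mulr_gt0// ler_wpM2l.
have Yt0 : 0 <= sqn v / (2 * t) by rewrite divr_ge0 ?sqn_ge0// mulr_ge0// ltW.
rewrite /trunc.
rewrite [leRHS](_ : _ = heat_peak d e * (48 * (sqn v / (2 * e) / n%:R *
  Num.min 1 (Num.sqrt (sqn v / (2 * e) / n%:R))))); last by ring.
have m0 : 0 <= Num.min 1 (Num.sqrt (sqn v / (2 * t) / n%:R)) by rewrite le_min ler01 sqrtr_ge0.
apply: ler_pM; rewrite ?(ltW (heat_peak_gt0 _ _)) ?heat_peak_nincr//.
  by rewrite mulr_ge0// mulr_ge0// divr_ge0// ltW.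
rewrite ler_wpM2l//; apply: ler_pM => //.
- by rewrite divr_ge0// ltW.
- by rewrite ler_wpM2r// invr_ge0 ltW.
- by apply: le_min2 => //; rewrite ler_wsqrtr// ler_wpM2r// invr_ge0 ltW.
Qed.

(* The second order Taylor term integrates to [heat_dt t z / n] because the
   kernel solves the heat equation and the covariance is the identity. *)
Lemma heat_step (e del : R) : 0 < e -> 0 < del ->
  exists N : nat, forall n t z, (N < n)%N -> e <= t ->
  (`|\int[mu]_v (heat t (z - (Num.sqrt n%:R)^-1 *: v))%:E - (heat (t + n%:R^-1) z)%:E| <=
  (del / n%:R)%:E)%E.
Proof.
move=> e0 del0.
set P := heat_peak d e; have P0 : 0 < P := heat_peak_gt0 d e.
pose C := (D ^+ 2 + 3 * D + 4) * P / e ^+ 2.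
have D0 : 0 <= D by rewrite divr_ge0.
have D1 : 0 < D ^+ 2 + 3 * D + 4 by have := sqr_ge0 D; move: D0; lra.
have C0 : 0 < C by rewrite divr_gt0 ?exprn_gt0// (mulr_gt0 D1 P0).
have Y0 (v : V) : 0 <= sqn v / (2 * e) by rewrite divr_ge0 ?sqn_ge0// mulr_ge0// ltW.
have iY : mu.-integrable setT (EFin \o (fun v : V => sqn v / (2 * e))).
  rewrite (_ : _ \o _ = fun v => ((2 * e)^-1%:E * (sqn v)%:E)%E).
    exact/integrableZl/integrable_sqn.
  by apply/funext => v; rewrite /= mulrC.
have d2 : 0 < del / 2 / (48 * P) by rewrite !divr_gt0// mulr_gt0.
have /fine_cvgP[Tfin /cvgrPdist_le /(_ _ d2) Tsmall] := trunc_cvg0 Y0 iY.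
have nC := nbhs_infty_ger (C / (del / 2)).
have [N _ HN] := filterI Tfin (filterI Tsmall nC).
exists N => n t z Nn et.
have [fT [sT Cn]] := HN n (ltnW Nn).
have n0 : (0 < n)%N by exact: leq_ltn_trans Nn.
have n0' : 0 < n%:R :> R by rewrite ltr0n.
have := heat_step_bound z e0 n0 et.
have := heat_time_taylor z e0 et (_ : 0 <= n%:R^-1).
rewrite invr_ge0 => /(_ (ltW n0')).
rewrite -[X in (_ <= _ * X)%E -> _]fineK//.
move: sT; rewrite sub0r normrN /=; set J := fine _ => sT.
set I := integral _ _ _.
(* An infinite integral would contradict the finite bound of [heat_step_bound]. *)
case: I => [r| |]; last 2 first.
- by move=> _; rewrite /= -EFinM leye_eq.
- by move=> _; rewrite /= -EFinM leye_eq.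
rewrite -!EFinB !abse_EFin -EFinM !lee_fin => h1 h2.
rewrite -/C in h1.
have J1 : 48 * P / n%:R * J <= del / 2 / n%:R.
  have : J <= del / 2 / (48 * P) by exact: le_trans (ler_norm _) sT.
  rewrite -(ler_pM2l (_ : 0 < 48 * P / n%:R)) ?divr_gt0 ?mulr_gt0//.
  move=> /le_trans; apply; rewrite le_eqVlt; apply/orP; left; apply/eqP.
  by field; rewrite !gt_eqF.
have C1 : C * n%:R^-1 ^+ 2 <= del / 2 / n%:R.
  rewrite expr2 mulrA ler_wpM2r ?invr_ge0 ?(ltW n0')//.
  by rewrite ler_pdivrMr// mulrC -ler_pdivrMr ?divr_gt0.
rewrite (_ : _ - _ = (r - (heat t z + heat_dt t z / n%:R)) -
  (heat (t + n%:R^-1) z - heat t z - heat_dt t z * n%:R^-1)); last by ring.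
apply: (le_trans (ler_normB _ _)).
move: (le_trans h1 C1) (le_trans h2 J1); set u := `|_|; set v := `|_|.
have -> : del / n%:R = del / 2 / n%:R + del / 2 / n%:R by field; rewrite gt_eqF.
by move=> h3 h4; rewrite addrC lerD.
Qed.

End lindeberg.

Section moments.
Context dT (T : measurableType dT) (R : realType) (P : probability T R) (d : nat).
Local Notation V := 'rV[R]_d.
Variable X : {RV P >-> V}.
Hypothesis X2 : square_integrable P X.
Hypothesis Xc : centered P X.
Hypothesis Xcov : identity_covariance P X.

Let X1 i : rv_coord X i \in Lfun P 1.
Proof. by apply: Lfun_subset12; [exact: fin_num_measure|exact: X2]. Qed.

Let XX i j : (rv_coord X i * rv_coord X j)%R \in Lfun P 1.
Proof. exact: Lfun2_mul_Lfun1. Qed.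

Lemma integrable_coord i :
  (distribution P X).-integrable setT (fun v : V => (v ord0 i)%:E).
Proof.
apply: integrable_pushforward => //.
- by apply/measurable_EFinP; exact: measurable_rV_coord.
- by rewrite preimage_setT; exact/Lfun1_integrable/X1.
Qed.

Lemma measurable_coord_mul i j :
  measurable_fun setT (fun v : V => (v ord0 i * v ord0 j)%:E).
Proof.
by apply/measurable_EFinP; apply: measurable_funM; exact: measurable_rV_coord.
Qed.

Lemma integrable_coord_mul i j :
  (distribution P X).-integrable setT (fun v : V => (v ord0 i * v ord0 j)%:E).
Proof.
apply: integrable_pushforward => //; first exact: measurable_coord_mul.
by rewrite preimage_setT; exact/Lfun1_integrable/XX.
Qed.

Lemma integral_coord i : (\int[distribution P X]_v (v ord0 i)%:E = 0)%E.
Proof.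
rewrite integral_distribution//.
- by rewrite -[RHS](Xc i) unlock.
- by apply/measurable_EFinP; exact: measurable_rV_coord.
- exact/Lfun1_integrable/X1.
Qed.

Lemma integral_coord_mul i j :
  (\int[distribution P X]_v (v ord0 i * v ord0 j)%:E = (i == j)%:R%:E)%E.
Proof.
rewrite integral_distribution//.
- by rewrite -Xcov covarianceE// !Xc mule0 sube0 unlock.
- exact: measurable_coord_mul.
- exact/Lfun1_integrable/XX.
Qed.

End moments.

Section lindeberg_sums.
Context dT (T : measurableType dT) (R : realType) (P : probability T R) (d : nat).
Local Notation V := 'rV[R]_d.
Variable xi : nat -> {RV P >-> V}.
Hypothesis indep : mutually_independent xi.
Hypothesis idist : identically_distributed xi.
Hypothesis xiL2 : forall k, square_integrable P (xi k).
Hypothesis xic : forall k, centered P (xi k).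
Hypothesis xicov : forall k, identity_covariance P (xi k).

Lemma measurable_heat_sub (t s : R) (z : V) :
  measurable_fun setT (fun x : V => (heat t (z - s *: x))%:E).
Proof.
apply/measurable_EFinP; apply: (measurableT_comp (measurable_heat t)).
rewrite (_ : (fun _ => _) = fun v : V => - s *: v + z); first exact: measurable_rV_affine.
by apply/funext => v; rewrite scaleNr addrC.
Qed.

Local Open Scope ereal_scope.

(** Lindeberg's replacement, one summand at a time: each costs del / n and advances the time of the
    kernel by 1 / n. The induction needs [heat_step] uniformly in t and z, since the hypothesis is
    used at time t + 1 / n. *)
Lemma heat_sum_law (e del : R) : (0 < e)%R -> (0 < del)%R ->
  exists N : nat, forall n, (N < n)%N -> forall j t z, (e <= t)%R ->
  \int[sum_law xi j]_x (heat t (z - (Num.sqrt n%:R)^-1 *: x)%R)%:E <=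
    (heat (t + j%:R / n%:R) z + j%:R * (del / n%:R))%:E /\
  (heat (t + j%:R / n%:R)%R z)%:E <=
  \int[sum_law xi j]_x (heat t (z - (Num.sqrt n%:R)^-1 *: x)%R)%:E +
    (j%:R * (del / n%:R))%:E.
Proof.
move=> e0 del0.
have [N HN] := heat_step (integrable_coord (xiL2 0%N)) (integrable_coord_mul (xiL2 0%N))
  (integral_coord (xiL2 0%N) (xic 0%N)) (integral_coord_mul (xiL2 0%N) (xic 0%N) (xicov 0%N)) e0 del0.
exists N => n Nn; elim=> [|j IH] t z et.
  rewrite ge0_integral_sum_law0//; last 2 first.
  - exact: measurable_heat_sub.
  - by move=> x; rewrite lee_fin heat_ge0.
  by rewrite scaler0 subr0 !mul0r !addr0 ?adde0.
set s := ((Num.sqrt n%:R)^-1)%R.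
have n0' : (0 < n%:R :> R)%R by rewrite ltr0n; exact: leq_ltn_trans Nn.
have mh t' z' := measurable_heat_sub t' s z'.
have h0 t' (x : V) : 0 <= (heat t' x)%:E by rewrite lee_fin heat_ge0.
rewrite ge0_integral_sum_lawS//.
pose F x := \int[distribution P (xi 0%N)]_v (heat t (z - s *: (x + v))%R)%:E.
have mF : measurable_fun setT F.
  by apply: (measurable_mconv_section (distribution P (xi 0%N)) (mh t z)) => x.
have F0 x : 0 <= F x by exact: integral_ge0.
have FxE x : F x = \int[distribution P (xi 0%N)]_v (heat t (z - s *: x - s *: v)%R)%:E.
  by apply: eq_integral => v _; rewrite scalerDr opprD addrA.
have FE x : `|F x - (heat (t + n%:R^-1)%R (z - s *: x)%R)%:E| <= (del / n%:R)%:E.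
  rewrite FxE; exact: (HN n t (z - s *: x)%R Nn et).
have dn0 : (0 <= del / n%:R)%R by rewrite divr_ge0 ?ltW.
have Flt x : F x <= (heat (t + n%:R^-1)%R (z - s *: x)%R)%:E + (del / n%:R)%:E /\
    (heat (t + n%:R^-1)%R (z - s *: x)%R)%:E <= F x + (del / n%:R)%:E.
  have := FE x; case: (F x) => [r| |]//=.
  rewrite -!EFinD !lee_fin ler_norml => /andP[h1 h2]; split.
    by move: h2; lra.
  by move: h1; lra.
have et' : (e <= t + n%:R^-1)%R by rewrite (le_trans et)// lerDl invr_ge0 ltW.
have [IH1 IH2] := IH _ z et'.
have tE : (t + n%:R^-1 + j%:R / n%:R = t + j.+1%:R / n%:R)%R.
  by rewrite -natr1; field; rewrite gt_eqF.
rewrite tE in IH1 IH2.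
have jE : (j.+1%:R * (del / n%:R) = j%:R * (del / n%:R) + del / n%:R)%R.
  by rewrite -natr1; ring.
have addcst (f : V -> \bar R) : measurable_fun setT f -> (forall x, 0 <= f x) ->
    \int[sum_law xi j]_x (f x + (del / n%:R)%:E) = \int[sum_law xi j]_x f x + (del / n%:R)%:E.
  move=> mf f0; rewrite ge0_integralD//.
  by rewrite (integral_cst (sum_law xi j) measurableT) /= probability_setT mule1.
have dE0 : 0 <= (del / n%:R)%:E by rewrite lee_fin.
have mhd : measurable_fun setT
    (fun x : V => (heat (t + n%:R^-1)%R (z - s *: x)%R)%:E + (del / n%:R)%:E).
  by apply: emeasurable_funD => //; exact: mh.
have mFd : measurable_fun setT (fun x : V => F x + (del / n%:R)%:E).
  exact: emeasurable_funD.
split.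
- apply: (@le_trans _ _ (\int[sum_law xi j]_x
      ((heat (t + n%:R^-1)%R (z - s *: x)%R)%:E + (del / n%:R)%:E))).
    apply: ge0_le_integral => //.
    + by move=> x _; exact: F0.
    + by move=> x _; have [] := Flt x.
  rewrite addcst//; apply: (le_trans (leeD2r _ IH1)).
  by rewrite -EFinD jE addrA.
- apply: (le_trans IH2).
  have -> : (j.+1%:R * (del / n%:R))%:E = (del / n%:R)%:E + (j%:R * (del / n%:R))%:E.
    by rewrite jE addrC EFinD.
  rewrite addeA; apply: leeD2r; rewrite -addcst//.
  apply: ge0_le_integral => //.
  by move=> x _; have [] := Flt x.
Qed.

End lindeberg_sums.

(** * Lower bounds for densities and their convolutions *)

Section translation_continuity.
Context (R : realType) (d : nat).
Local Notation V := 'rV[R]_d.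
Local Notation leb := (lebesgue_rV R d).
Local Open Scope ereal_scope.

Definition cube (M : R) : set V := [set x : V | forall i, `[- M, M]%classic (x ord0 i)]%R.

Lemma measurable_rV_box (A : 'I_d -> set R) : (forall i, measurable (A i)) ->
  measurable [set x : V | forall i, A i (x ord0 i)].
Proof.
move=> mA; rewrite (_ : [set x | _] = \bigcap_(i in [set: 'I_d])
    ((fun x : V => x ord0 i) @^-1` A i)).
  apply: fin_bigcap_measurable => // i _; rewrite -[X in measurable X]setTI.
  by apply: measurable_rV_coord => //; exact: mA.
by apply/seteqP; split=> [x /= h i _|x /= h i]; [exact: h|exact: (h i I)].
Qed.

Lemma measurable_cube M : measurable (cube M).
Proof. by apply: (@measurable_rV_box (fun=> `[- M, M]%classic%R)). Qed.

Lemma lebesgue_cube_lty M : leb (cube M) < +oo.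
Proof.
rewrite (@lebesgue_rV_box R d (fun=> `[- M, M]%classic%R))// -ge0_fin_numE; last by apply: prode_ge0.
apply: prode_fin_num => i _; rewrite lebesgue_measure_itv/=.
by case: ifP => _ //; rewrite -EFinD.
Qed.

Lemma measurable_preimage_shift (x : V) (A : set V) : measurable A ->
  measurable [set y : V | A (y - x)%R].
Proof.
by move=> mA; rewrite -[X in measurable X]setTI; exact: (measurable_rV_shift (- x)%R measurableT mA).
Qed.

Lemma lebesgue_rV_shift (x : V) (A : set V) : measurable A ->
  leb [set y : V | A (y - x)%R] = leb A.
Proof.
move=> mA; have mA' := measurable_preimage_shift x mA.
have := integral_indic leb measurableT mA; rewrite setIT => <-.
have := integral_indic leb measurableT mA'; rewrite setIT => <-.
rewrite [RHS](@ge0_integral_rV_shift _ _ (- x)%R)//.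
by apply/measurable_EFinP; exact: measurable_indic.
Qed.

(** The symmetric difference of A and its translate A + x. *)
Definition translation_diff (A : set V) (x : V) := [set y : V | ~ (A y <-> A (y - x)%R)].

Lemma measurable_translation_diff A x : measurable A -> measurable (translation_diff A x).
Proof.
move=> mA; have mB := measurable_preimage_shift x mA.
rewrite (_ : translation_diff A x = (A `\` [set y | A (y - x)%R]) `|` ([set y | A (y - x)%R] `\` A)).
  by apply: measurableU; exact: measurableD.
apply/seteqP; split => y /=.
  move=> h; have [Ay|Ay] := pselect (A y).
    by left; split => // Ayx; apply: h; split.
  right; split => //; apply: contrapT => Ayx; apply: h; split => //.
by move=> [[h1 h2]|[h1 h2]] [h3 h4]; [apply: h2; exact: h3|apply: h2; exact: h4].
Qed.

(** Continuity of translations in the local L1 norm, for an indicator. The restriction to a cube is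
    needed for sets such as half-spaces, whose difference sets have infinite measure when d > 1. *)
Definition translation_continuous (A : set V) : Prop := measurable A /\
  forall M e : R, (0 < M)%R -> (0 < e)%R -> exists2 del : R, (0 < del)%R &
    forall x : V, (forall i, `|x ord0 i| < del)%R -> leb (cube M `&` translation_diff A x) <= e%:E.

Let tc0 : translation_continuous set0.
Proof.
split => // M e M0 e0; exists 1%R => // x _.
rewrite (_ : _ `&` _ = set0) ?measure0 ?lee_fin ?ltW//.
by apply/seteqP; split => // y [_]; apply; split.
Qed.

Let tcC A : translation_continuous A -> translation_continuous (~` A).
Proof.
move=> [mA h]; split; first exact: measurableC.
move=> M e M0 e0; have [del del0 H] := h M e M0 e0; exists del => // x xd.
rewrite (_ : translation_diff (~` A) x = translation_diff A x); first exact: H.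
apply/seteqP; split => y /= h1 [h2 h3]; apply: h1; split => //=.
- by move=> nA Ayx; apply: nA; exact: h3.
- by move=> nA Ay; apply: nA; exact: h2.
- by move=> Ay; apply: contrapT => nA; exact: (h3 nA).
- by move=> Ay; apply: contrapT => nA; exact: (h2 nA).
Qed.

Let tcU (F : (set V)^nat) : (forall i, translation_continuous (F i)) ->
  translation_continuous (\bigcup_i F i).
Proof.
move=> tF; have mF i : measurable (F i) by have [] := tF i.
split; first exact: bigcupT_measurable.
move=> M e M0 e0.
pose U := \bigcup_i F i; have mU : measurable U by exact: bigcupT_measurable.
(* The tail of the union inside a slightly larger cube; it has small measure by continuity from
   above. The finite part costs e / 2, the tail and its translate e / 4 each. *)
pose H n := cube (M + 1) `&` (U `\` \bigcup_(i < n) F i).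
have mHn n : measurable (U `\` \bigcup_(i < n) F i).
  by apply: measurableD => //; apply: bigcup_measurable => i _.
have mH n : measurable (H n) by apply: measurableI; [exact: measurable_cube|exact: mHn].
have capH : \bigcap_n H n = set0.
  apply/seteqP; split => // y h; have [_ [[i _ Fi] _]] := h 0%N I.
  have [_ [_ hn]] := h i.+1 I; apply: hn; exists i => //=.
have Hcvg : leb (H n) @[n --> \oo] --> 0.
  rewrite -(@measure0 _ _ _ leb) -capH; apply: nonincreasing_cvg_mu => //.
  - apply: le_lt_trans (lebesgue_cube_lty (M + 1)); apply: le_measure; rewrite ?inE//.
    + exact: measurable_cube.
    + by move=> y [].
  - by rewrite capH.
  - apply/nonincreasing_seqP => n; apply/subsetPset => y [cy [Uy nF]]; split => //.
    by split => // -[i /= ni Fi]; apply: nF; exists i => //=; exact: ltnW.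
have e4 : (0 < e / 4)%R by rewrite divr_gt0.
have [n Hn] : exists n, leb (H n) <= (e / 4)%:E.
  have /fine_cvgP[fin /cvgrPdist_le /(_ _ e4) sm] := Hcvg.
  have [n _ /(_ n (leqnn _))[fn sn]] := filterI fin sm.
  exists n; rewrite -[leLHS]fineK// lee_fin; apply: le_trans sn.
  by rewrite /= sub0r normrN ler_norm.
have en : (0 < e / 2 / n.+1%:R)%R by rewrite !divr_gt0.
have /choice[del Hdel] : forall i, exists del : R, (0 < del)%R /\
    forall x : V, (forall i, `|x ord0 i| < del)%R ->
    leb (cube M `&` translation_diff (F i) x) <= (e / 2 / n.+1%:R)%:E.
  by move=> i; have [_ /(_ M _ M0 en)[del d0 dH]] := tF i; exists del.
(* The initial value 1 ensures that a point of [cube M] stays in [cube (M + 1)] when translated. *)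
pose D : R := \big[Num.min/1%R]_(i < n) del i.
exists D.
  by rewrite /D; elim/big_ind : _ => // [x y x0 y0|i _]; [rewrite lt_min x0|have [] := Hdel i].
move=> x xD.
have x1 i : (`|x ord0 i| < 1)%R by apply: (lt_le_trans (xD i)); exact: bigmin_le_id.
have xdel (k : 'I_n) i : (`|x ord0 i| < del k)%R.
  by apply: (lt_le_trans (xD i)); exact: bigmin_le_cond.
pose G k := cube M `&` translation_diff (F k) x.
pose A1 := \big[setU/set0]_(k < n) G k.
pose A3 := [set y : V | H n (y - x)%R].
have mA1 : measurable A1.
  apply: bigsetU_measurable => k _; apply: measurableI; first exact: measurable_cube.
  exact: measurable_translation_diff.
have mA3 : measurable A3 by exact: measurable_preimage_shift.
have sub : cube M `&` translation_diff U x `<=` (A1 `|` H n) `|` A3.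
  move=> y [cy nU].
  have cM z : cube M z -> cube (M + 1) z.
    move=> cz i; have := cz i; rewrite /= !in_itv/= => /andP[h1 h2].
    by apply/andP; split; [move: h1; lra|move: h2; lra].
  have cMx : cube (M + 1) (y - x)%R.
    move=> i; have := cy i; have := x1 i.
    rewrite /= !in_itv/= !mxE ltr_norml => /andP[h1 h2] /andP[h3 h4].
    by apply/andP; split; [move: h2 h3; lra|move: h1 h4; lra].
  have [A1y|nA1] := pselect (A1 y); first by left; left.
  have eqF k : (k < n)%N -> F k y <-> F k (y - x)%R.
    move=> kn; apply: contrapT => h; apply: nA1.
    by rewrite /A1 -(bigcup_mkord n G); exists k.
  have [Uy|nUy] := pselect (U y).
    left; right; split; first exact: cM.
    split => // -[k /= kn Fk]; apply: nU; split => // _.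
    by exists k => //; apply/(eqF k kn).
  right; split => //; split.
    by apply: contrapT => nUx; apply: nU; split.
  by move=> [k /= kn /(eqF k kn) Fk]; apply: nUy; exists k.
apply: (@le_trans _ _ (leb ((A1 `|` H n) `|` A3))).
  apply: le_measure; rewrite ?inE//.
  - apply: measurableI; [exact: measurable_cube|exact: measurable_translation_diff].
  - by apply: measurableU => //; exact: measurableU.
have subadd A B : measurable A -> measurable B -> leb (A `|` B) <= leb A + leb B.
  by move=> mA mB; exact: measureU2.
apply: (le_trans (subadd _ _ _ mA3)); first exact: measurableU.
have -> : e%:E = (e / 2)%:E + (e / 4)%:E + (e / 4)%:E.
  by rewrite -!EFinD; congr EFin; field.
apply: leeD; last by rewrite lebesgue_rV_shift.
apply: (le_trans (subadd _ _ mA1 (mH n))); apply: leeD => //.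
apply: (@le_trans _ _ (\sum_(k < n) leb (cube M `&` translation_diff (F k) x))).
  apply: (Boole_inequality leb (A := fun k => cube M `&` translation_diff (F k) x)) => k kn.
  by apply: measurableI; [exact: measurable_cube|exact: measurable_translation_diff].
apply: (@le_trans _ _ (\sum_(k < n) (e / 2 / n.+1%:R)%:E)).
  by apply: lee_sum => k _; have [_] := Hdel k; apply.
rewrite sumEFin sumr_const card_ord lee_fin -[leLHS]mulr_natr.
rewrite -[leLHS]mulrA ler_piMr ?divr_ge0 ?(ltW e0)//.
by rewrite mulrC ler_pdivrMr// mul1r ler_nat.
Qed.

Let tc_half (i : 'I_d) (a : R) :
  translation_continuous ((fun x : V => x ord0 i) @^-1` `]a, +oo[).
Proof.
split.
  by rewrite -[X in measurable X]setTI; apply: measurable_rV_coord.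
move=> M e M0 e0.
pose Cst := \prod_(j < d | j != i) lebesgue_measure (`[(- M)%R, M]%classic : set R).
have Cfin : Cst \is a fin_num.
  apply: prode_fin_num => j _; rewrite lebesgue_measure_itv/=.
  by case: ifP => _ //; rewrite -EFinD.
have C0 : 0 <= Cst by apply: prode_ge0.
pose c := fine Cst; have c0 : (0 <= c)%R by exact: fine_ge0.
have c1 : (0 < 2 * (c + 1))%R by rewrite mulr_gt0// ltr_wpDl.
(* Inside the cube the difference set lies in a slab of thickness 2 del and cross-section c; c + 1
   avoids a division by 0. *)
exists (e / (2 * (c + 1)))%R; first exact: divr_gt0.
set del := (e / _)%R => x xd.
pose B j : set R := if j == i then `[a - del, a + del]%classic%R else `[- M, M]%classic%R.
have mB j : measurable (B j) by rewrite /B; case: ifP.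
have del0 : (0 < del)%R by exact: divr_gt0.
apply: (@le_trans _ _ (leb [set x : V | forall j, B j (x ord0 j)])).
  apply: le_measure; rewrite ?inE.
  - apply: measurableI; first exact: measurable_cube.
    apply: measurable_translation_diff; rewrite -[X in measurable X]setTI.
    exact: measurable_rV_coord.
  - exact: measurable_rV_box.
  - move=> y [cy ny] j; rewrite /B; case: eqP => [->|_]; last exact: cy.
    have := xd i; rewrite ltr_norml => /andP[x1 x2].
    move: ny; rewrite /translation_diff /= !in_itv/= !andbT !mxE => ny.
    have [ya|ya] := ltP a (y ord0 i); have [yx|yx] := ltP a (y ord0 i - x ord0 i)%R.
    + by exfalso; apply: ny.
    + by apply/andP; split; [move: ya del0; lra|move: yx x2; lra].
    + by apply/andP; split; [move: yx x1; lra|move: ya del0; lra].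
    + by exfalso; apply: ny; split; rewrite ltNge ?ya ?yx.
rewrite lebesgue_rV_box// (bigD1 i)//= {1}/B eqxx lebesgue_measure_itv/= lte_fin.
rewrite ifT; last by move: del0; lra.
rewrite (eq_bigr (fun=> lebesgue_measure (`[(- M)%R, M]%classic : set R))); last first.
  by move=> j /negbTE ji; rewrite /B ji.
rewrite -/Cst -(fineK Cfin) -/c -EFinB -EFinM lee_fin.
rewrite (_ : (_ - _ = 2 * del)%R); last by ring.
have c2 : (0 < c + 1)%R by rewrite ltr_wpDl.
rewrite (_ : (2 * del * c = e * (c / (c + 1)))%R); last by rewrite /del; field; rewrite gt_eqF.
by rewrite ler_piMr ?(ltW e0)// ler_pdivrMr// mul1r lerDl.
Qed.

(* The sets with this property form a sigma-algebra that contains the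
   half-spaces. *)
Lemma measurable_translation_continuous (A : set V) :
  measurable A -> translation_continuous A.
Proof.
have sC : sigma_algebra setT translation_continuous.
  split => //; first by move=> B tB; rewrite setTD; exact: tcC.
(* Measurability of the identity, tested on coordinates, is the inclusion of the Borel sets in the
   new sigma-algebra. *)
have id_meas : measurable_fun setT (fun x : g_sigma_algebraType translation_continuous => x : V).
  apply: measurable_rV => i.
  apply: (measurability _ (RGenOInfty.measurableE R)).
  move=> _ [_ [a ->] <-]; rewrite setTI; apply: sub_sigma_algebra.
  exact: tc_half.
move=> mA; have := id_meas measurableT _ mA.
by rewrite setTI /measurable/= sigma_algebra_id.
Qed.

End translation_continuity.

Section convolution_minorant.
Context (R : realType) (d : nat).
Local Notation V := 'rV[R]_d.
Local Notation leb := (lebesgue_rV R d).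
Local Open Scope ereal_scope.

(** The inequality passes from sets to functions because L minus the measure with density c on E is
    again a measure. *)
Lemma ge0_integral_minorant (c : R) (E : set V) (L : {finite_measure set V -> \bar R}) :
  (0 < c)%R -> measurable E -> leb E < +oo ->
  (forall A, measurable A -> c%:E * leb (A `&` E) <= L A) ->
  forall f : V -> \bar R, measurable_fun setT f -> (forall x, 0 <= f x) ->
  c%:E * \int[leb]_x ((\1_E x)%:E * f x) <= \int[L]_x f x.
Proof.
move=> c0 mE Elt cL f mf f0.
have mg : measurable_fun setT (fun x => c * \1_E x)%R.
  by apply: measurable_funM => //; exact: measurable_indic.
have g0 x : (0 <= c * \1_E x)%R by rewrite mulr_ge0 ?(ltW c0).
pose D := density_measure leb (pack_mfun mg).
have DE A : measurable A -> D A = c%:E * leb (A `&` E).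
  move=> mA; rewrite /D /density_measure.
  under eq_integral do rewrite /= ger0_norm// EFinM.
  rewrite ge0_integralZl//; last 2 first.
  - by apply/measurable_EFinP; apply: measurable_funTS; exact: measurable_indic.
  - by rewrite lee_fin ltW.
  by rewrite integral_indic// setIC.
have Dlt : D setT < +oo.
  by rewrite DE// setTI lte_mul_pinfty ?lee_fin ?(ltW c0).
pose D' := [the {finite_measure set V -> \bar R} of pack_finite Dlt].
have [m mE'] : exists m : {finite_measure set V -> \bar R},
    forall A, measurable A -> L A = D' A + m A.
  apply: measure_difference_ex => A mA.
  by apply: le_trans (cL _ mA); rewrite -DE.
have -> : \int[L]_x f x = \int[measure_add D' m]_x f x.
  apply: eq_measure_integral => A mA _.
  by apply: (etrans (mE' A mA)); exact: (esym (measure_addE _ _ _)).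
rewrite ge0_integral_measure_add//.
apply: (@le_trans _ _ (\int[D]_x f x)); last by apply: leeDl; exact: integral_ge0.
rewrite ge0_integral_density// -ge0_integralZl//; last 3 first.
- by apply: emeasurable_funM => //; apply/measurable_EFinP; exact: measurable_indic.
- by move=> x _; rewrite mule_ge0// lee_fin.
- by rewrite lee_fin ltW.
rewrite le_eqVlt; apply/orP; left; apply/eqP; apply: eq_integral => x _.
by rewrite /= ger0_norm// EFinM [RHS]muleC -muleA.
Qed.

(* The convolution of two indicators is continuous, and it is positive at some
   [x0] since its integral is. *)
Lemma indic_conv_ball (E : set V) (M : R) : (0 < M)%R -> measurable E -> E `<=` cube M ->
  0 < leb E ->
  exists x0 (eta w : R), [/\ (0 < eta)%R, (0 < w)%R &
    forall z, (eta * spline_rV w 1 (z - x0))%:E <=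
      \int[leb]_x (\1_E (z - x)%R * \1_E x)%:E].
Proof.
move=> M0 mE EM Egt.
have Elt : leb E < +oo.
  apply: le_lt_trans (lebesgue_cube_lty d M); apply: le_measure; rewrite ?inE//.
  exact: measurable_cube.
pose phi z := \int[leb]_x (\1_E (z - x)%R * \1_E x)%:E.
have mI : measurable_fun setT (fun x : V => \1_E x : R) by exact: measurable_indic.
have I0 (x : V) : (0 <= \1_E x :> R)%R by [].
pose S z := [set y : V | E (z - y)%R].
have mS z : measurable (S z).
  rewrite -[X in measurable X]setTI.
  apply: (_ : measurable_fun setT (fun y : V => z - y)%R) => //.
  rewrite (_ : (fun _ => _) = fun v : V => ((- 1) *: v + z)%R); first exact: measurable_rV_affine.
  by apply/funext => v; rewrite scaleN1r addrC.
have phiE z : phi z = leb (S z `&` E).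
  have := integral_indic leb measurableT (measurableI _ _ (mS z) mE); rewrite setIT => <-.
  by apply: eq_integral => y _; rewrite indicI.
have [x0 phi0] : exists x0, phi x0 != 0.
  apply: contrapT => /forallNP h.
  have := integral_conv2 mI I0 mI I0 (measurable_cst 1) (fun=> lee01).
  rewrite [RHS]integral0_eq; last first.
    by move=> z _; rewrite -/(phi z); have /negP/negbNE/eqP -> := h z; rewrite mule0.
  under eq_integral.
    move=> x _; under eq_integral do rewrite mule1.
    rewrite integral_indic// setIT; over.
  have mIE : measurable_fun setT (fun x : V => (\1_E x)%:E : \bar R) by exact/measurable_EFinP.
  have IE0 x : setT x -> 0 <= (\1_E x)%:E :> \bar R by rewrite lee_fin.
  rewrite (ge0_integralZr leb measurableT mIE IE0)//.
  rewrite integral_indic// setIT => /eqP; rewrite mule_eq0 orbb.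
  by rewrite gt_eqF.
have phigt : 0 < phi x0 by rewrite lt0e phi0 phiE measure_ge0.
have phifin : phi x0 \is a fin_num.
  rewrite ge0_fin_numE ?ltW// phiE; apply: le_lt_trans Elt.
  exact: measureIr.
pose r := fine (phi x0); have r0 : (0 < r)%R by rewrite fine_gt0// phigt ltey_eq phifin.
have r2 : (0 < r / 2)%R by rewrite divr_gt0.
have [_ /(_ M _ M0 r2)[del del0 H]] := measurable_translation_continuous (mS x0).
(* [spline_rV w 1] vanishes once a coordinate reaches 2w, so w = del / 2 confines it to where the
   convolution has lost at most half of its value r at x0. *)
exists x0, (r / 2)%R, (del / 2)%R; split => //; first by rewrite divr_gt0.
move=> z; rewrite -/(phi z).
have w0 : (0 < del / 2)%R by rewrite divr_gt0.
have [zd|] := pselect (forall i, `|(z - x0)%R ord0 i| < del)%R; last first.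
  move=> /existsNP[i /negP]; rewrite -leNgt => di.
  rewrite (@spline_rV1_eq0 _ _ _ w0 _ i) ?mulr0.
    by rewrite phiE measure_ge0.
  by rewrite mulrC divfK.
apply: (@le_trans _ _ (r / 2)%:E).
  by rewrite lee_fin ler_piMr ?(ltW r2)// spline_rV1_le1.
have key : phi x0 <= phi z + (r / 2)%:E.
  rewrite !phiE; apply: (le_trans _ (leeD (lexx _) (H _ zd))).
  have mD : measurable (cube M `&` translation_diff (S x0) (z - x0)%R).
    by apply: measurableI; [exact: measurable_cube|exact: measurable_translation_diff].
  apply: le_trans (measureU2 _ (measurableI _ _ (mS z) mE) mD).
  apply: le_measure; rewrite ?inE//.
  - exact: measurableI.
  - by apply: measurableU => //; exact: measurableI.
  move=> y [Sy Ey].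
  have [Sz|nSz] := pselect (S z y); [by left|right; split; first exact: EM].
  move=> [h _]; apply: nSz; have := h Sy; rewrite /S/=.
  by rewrite opprB addrA [(x0 + (z - x0))%R]addrC subrK.
have phizfin : phi z \is a fin_num.
  rewrite phiE ge0_fin_numE//; apply: le_lt_trans Elt.
  exact: measureIr.
move: key; rewrite -(fineK phifin) -(fineK phizfin) -/r -EFinD !lee_fin.
by lra.
Qed.

(** Applying [ge0_integral_minorant] in both variables bounds the convolution below by c^2 times
    that of the indicator of E with itself, which [indic_conv_ball] compares with a spline. *)
Lemma mconv_minorant (c M : R) (E : set V) (L : {finite_measure set V -> \bar R}) :
  (0 < c)%R -> (0 < M)%R -> measurable E -> E `<=` cube M -> 0 < leb E ->
  (forall A, measurable A -> c%:E * leb (A `&` E) <= L A) ->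
  exists x0 (c' w : R), [/\ (0 < c')%R, (0 < w)%R &
    forall A, measurable A ->
      c'%:E * \int[leb]_(x in A) (spline_rV w 1 (x - x0))%:E <= mconv L L A].
Proof.
move=> c0 M0 mE EM Egt cL.
have Elt : leb E < +oo.
  apply: le_lt_trans (lebesgue_cube_lty d M); apply: le_measure; rewrite ?inE//.
  exact: measurable_cube.
have [x0 [eta [w [eta0 w0 H]]]] := indic_conv_ball M0 mE EM Egt.
exists x0, (c * c * eta)%R, w; split => //; first by rewrite !mulr_gt0.
move=> A mA.
have mI : measurable_fun setT (fun x : V => \1_E x : R) by exact: measurable_indic.
have I0 (x : V) : (0 <= \1_E x :> R)%R by [].
have mIA : measurable_fun setT (fun x : V => (\1_A x)%:E : \bar R).
  by apply/measurable_EFinP; exact: measurable_indic.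
have IA0 (x : V) : 0 <= (\1_A x)%:E :> \bar R by rewrite lee_fin.
have min := ge0_integral_minorant c0 mE Elt cL.
have mf s : measurable_fun setT (fun v : V => (\1_A (s + v)%R)%:E : \bar R).
  under eq_fun do rewrite addrC.
  exact: (measurableT_comp mIA (measurable_rV_shift s)).
have mG : measurable_fun setT (fun x : V => \int[L]_y (\1_A (x + y)%R)%:E : \bar R).
  by apply: (measurable_mconv_section L mIA).
have -> : mconv L L A = \int[L]_x \int[L]_y (\1_A (x + y)%R)%:E.
  rewrite -(ge0_integral_mconv L L mIA IA0).
  by rewrite integral_indic// setIT.
apply: le_trans (min _ mG (fun=> integral_ge0 _ _)) => //.
have mGE : measurable_fun setT (fun x : V => \int[leb]_v ((\1_E v)%:E * (\1_A (v + x)%R)%:E) : \bar R).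
  have mK : measurable_fun setT (fun p : V * V => (\1_E p.2)%:E * (\1_A (p.2 + p.1)%R)%:E : \bar R).
    apply: emeasurable_funM.
      by apply/measurable_EFinP; exact: (measurableT_comp mI measurable_snd).
    apply: (measurableT_comp mIA).
    by apply: measurable_rV_add; [exact: measurable_snd|exact: measurable_fst].
  by apply: (measurable_integral_rV mK) => p; rewrite mule_ge0// lee_fin.
have GE0 x : 0 <= \int[leb]_v ((\1_E v)%:E * (\1_A (v + x)%R)%:E) :> \bar R.
  by apply: integral_ge0 => v _; rewrite mule_ge0// lee_fin.
apply: (@le_trans _ _ (c%:E * \int[leb]_x ((\1_E x)%:E * (c%:E *
    \int[leb]_v ((\1_E v)%:E * (\1_A (v + x)%R)%:E))))); last first.
  apply: lee_wpmul2l; first by rewrite lee_fin ltW.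
  apply: ge0_le_integral => //.
  - by move=> x _; rewrite !mule_ge0// lee_fin// ltW.
  - by apply: emeasurable_funM; [exact/measurable_EFinP|exact: measurable_funeM].
  - by apply: emeasurable_funM; [exact/measurable_EFinP|].
  - move=> x _; apply: lee_wpmul2l; first by rewrite lee_fin.
    apply: le_trans (min _ (mf x) (fun=> IA0 _)).
    by under eq_integral do rewrite addrC.
have -> : \int[leb]_x ((\1_E x)%:E * (c%:E * \int[leb]_v ((\1_E v)%:E * (\1_A (v + x)%R)%:E))) =
    c%:E * \int[leb]_x ((\1_E x)%:E * \int[leb]_v ((\1_E v)%:E * (\1_A (v + x)%R)%:E)) :> \bar R.
  rewrite -ge0_integralZl//.
  - by apply: eq_integral => x _; rewrite muleCA.
  - by apply: emeasurable_funM; [exact/measurable_EFinP|].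
  - by move=> x _; rewrite mule_ge0// lee_fin.
  - by rewrite lee_fin ltW.
rewrite (integral_conv2 mI I0 mI I0 mIA IA0).
rewrite 2!EFinM -!muleA.
apply: lee_wpmul2l; first by rewrite lee_fin ltW.
apply: lee_wpmul2l; first by rewrite lee_fin ltW.
have msp : measurable_fun setT (fun x : V => (spline_rV w 1 (x - x0))%:E).
  apply/measurable_EFinP.
  exact: (measurableT_comp (measurable_spline_rV w0 1) (measurable_rV_shift _)).
rewrite -ge0_integralZl//; last 3 first.
- exact: measurable_funTS.
- by move=> x _; rewrite lee_fin spline_rV_ge0.
- by rewrite lee_fin ltW.
rewrite integral_mkcond; apply: ge0_le_integral => //.
- by move=> x _; rewrite patchE; case: ifP => // _; rewrite mule_ge0// lee_fin ?spline_rV_ge0// ltW.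
- by apply/(measurable_restrictT _ _).1 => //; exact/measurable_funTS/measurable_funeM.
- apply: emeasurable_funM; first exact: mIA.
  have mK : measurable_fun setT (fun p : V * V => (\1_E (p.1 - p.2)%R * \1_E p.2)%:E : \bar R).
    apply/measurable_EFinP; apply: measurable_funM; last exact: (measurableT_comp mI measurable_snd).
    apply: (measurableT_comp mI).
    rewrite (_ : (fun _ => _) = fun p : V * V => (p.1 + (-1) *: p.2)%R).
      apply: measurable_rV_add; first exact: measurable_fst.
      by apply: measurable_rV_lin; exact: measurable_snd.
    by apply/funext => p; rewrite scaleN1r.
  by apply: (measurable_integral_rV mK) => p; rewrite lee_fin mulr_ge0.
- move=> z _; rewrite patchE indicE; case: ifP => _; last by rewrite mul0e.
  by rewrite mul1e -EFinM; exact: H.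
Qed.

End convolution_minorant.

(** * Lebesgue decomposition and Radon-Nikodym densities *)

Section lebesgue_decomposition.
Context dT (T : measurableType dT) (R : realType).
Variables (mu : {finite_measure set T -> \bar R}) (leb : {measure set T -> \bar R}).
Local Open Scope ereal_scope.

(** The supremum of [mu] over null sets is attained by the union of a maximizing sequence; adding to
    it the rest of another null set cannot increase its mass. *)
Lemma maximal_null_set : exists N, [/\ measurable N, leb N = 0 &
  forall B, measurable B -> leb B = 0 -> mu (B `\` N) = 0].
Proof.
pose S := [set mu N | N in [set N | measurable N /\ leb N = 0]].
have Sfin : ereal_sup S \is a fin_num.
  rewrite ge0_fin_numE.
    apply: (@le_lt_trans _ _ (mu setT)).
      apply: ge_ereal_sup => _ [N [mN _] <-].
      by apply: le_measure; rewrite ?inE.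
    by rewrite -ge0_fin_numE// fin_num_measure.
  by apply: ereal_sup_ubound; exists set0; rewrite ?measure0//; split; rewrite ?measure0.
have /choice[F HF] : forall k : nat, exists N, [/\ measurable N, leb N = 0 &
    ereal_sup S - (k.+1%:R^-1)%:E < mu N].
  move=> k; have e0 : (0 < k.+1%:R^-1 :> R)%R by rewrite invr_gt0.
  by have [_ [N [mN N0] <-] h] := ub_ereal_sup_adherent e0 Sfin; exists N.
have mF k : measurable (F k) by have [] := HF k.
pose N := \bigcup_k F k; have mN : measurable N by exact: bigcupT_measurable.
have N0 : leb N = 0.
  apply/eqP; rewrite eq_le measure_ge0 andbT.
  apply: (le_trans (measure_sigma_subadditive leb mF mN (fun x h => h))).
  by rewrite eseries0// => k _ _; have [] := HF k.
have NS : mu N = ereal_sup S.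
  apply/eqP; rewrite eq_le; apply/andP; split.
    by apply: ereal_sup_ubound; exists N.
  have NT : mu N \is a fin_num by exact: fin_num_measure.
  apply/lee_addgt0Pr => e e0.
  have [k ke] : exists k : nat, (k.+1%:R^-1 < e)%R.
    have := near_infty_natSinv_lt (PosNum e0).
    by move=> [K _ /(_ K (leqnn _))]; exists K.
  have [_ _ h] := HF k.
  move: h; rewrite lteBlDr// => /ltW h.
  apply: (le_trans h); apply: leeD; last by rewrite lee_fin ltW.
  by apply: le_measure; rewrite ?inE//; exact: bigcup_sup.
exists N; split => // B mB B0.
have BN0 : leb (B `|` N) = 0.
  apply/eqP; rewrite eq_le measure_ge0 andbT.
  have : leb (B `|` N) <= leb B + leb N by exact: measureU2.
  by rewrite B0 N0 adde0.
have : mu ((B `\` N) `|` N) <= mu N.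
  rewrite NS; apply: ereal_sup_ubound; exists ((B `\` N) `|` N) => //.
  by rewrite setUDl setDv setD0; split => //; exact: measurableU.
rewrite measureU//; last 2 first.
- exact: measurableD.
- by rewrite setDKI.
have NT : mu N \is a fin_num by exact: fin_num_measure.
rewrite -[leRHS]add0e leeD2rE// => h.
by apply/eqP; rewrite eq_le h measure_ge0.
Qed.

(* Removing a null set of maximal [mu]-mass leaves the absolutely continuous
   part of [mu]. *)
Lemma ac_part_ex (A : set T) (nu : {measure set T -> \bar R}) : measurable A ->
  (forall B, measurable B -> nu B <= mu B) ->
  (forall B, measurable B -> leb B = 0 -> nu B = 0) -> 0 < nu A ->
  exists ac : {measure set T -> \bar R}, is_ac_part leb mu ac /\
    (exists2 A, measurable A & ac A != 0).
Proof.
move=> mA numu null nuA; have [N [mN N0 Nmax]] := maximal_null_set.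
have mNc : measurable (~` N) by exact: measurableC.
exists (mrestr mu mNc); split; last first.
  exists A => //; rewrite gt_eqF//; apply: (@lt_le_trans _ _ (nu (A `\` N))).
    apply: (lt_le_trans nuA); rewrite -[in leLHS](setDUK (@subIsetl _ A N)).
    rewrite setDIr setDv set0U.
    have : nu ((A `&` N) `|` (A `\` N)) <= nu (A `&` N) + nu (A `\` N).
      by apply: measureU2; [exact: measurableI|exact: measurableD].
    move=> /le_trans; apply; rewrite (null (A `&` N)) ?add0e//; first exact: measurableI.
    apply/eqP; rewrite eq_le measure_ge0 andbT -N0.
    by apply: le_measure; rewrite ?inE//; exact: measurableI.
  by apply: (le_trans (numu _ (measurableD mA mN))).
split.
  apply/null_content_dominatesP => B mB B0.
  by apply: (etrans _ (Nmax B mB B0)); rewrite setDE.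
exists (mrestr mu mN); split.
  exists (~` N); split => //.
  - by apply: (etrans _ (measure0 mu)); rewrite -(setICl N).
  - by rewrite setCK.
move=> B mB; apply: (etrans (measureDI mu mB mN)).
by rewrite setDE.
Qed.

End lebesgue_decomposition.

Section radon_nikodym_minorant.
Context (R : realType) (d : nat).
Local Notation V := 'rV[R]_d.
Local Notation leb := (lebesgue_rV R d).
Local Open Scope ereal_scope.

(** The sets where the Radon-Nikodym density is at least 1 / (k + 1), cut by cubes, exhaust the set
    where it is positive. If all were null, [ac] would vanish. *)
Lemma ac_minorant (ac : {measure set V -> \bar R}) (A0 : set V) :
  ac `<< leb -> ac setT < +oo -> measurable A0 -> ac A0 != 0 ->
  exists (c M : R) (E : set V), [/\ (0 < c)%R, (0 < M)%R & [/\ measurable E,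
    E `<=` cube M, 0 < leb E & forall A, measurable A -> c%:E * leb (A `&` E) <= ac A]].
Proof.
move=> acleb acT mA0 acA0.
pose nu := [the {finite_measure set V -> \bar R} of pack_finite acT].
have nuleb : nu `<< leb by exact: acleb.
pose f := Radon_Nikodym_SigmaFinite.f nu leb.
have f0 x : 0 <= f x by exact: Radon_Nikodym_SigmaFinite.f_ge0.
have fI A : measurable A -> ac A = \int[leb]_(x in A) f x.
  by move=> mA; rewrite -(Radon_Nikodym_SigmaFinite.f_integral nuleb mA).
have mf : measurable_fun setT f.
  exact: measurable_int (Radon_Nikodym_SigmaFinite.f_integrable nuleb).
pose B (k : nat) := [set x | (k.+1%:R^-1)%:E <= f x] `&` cube k.+1%:R.
have mB k : measurable (B k).
  apply: measurableI; last exact: measurable_cube.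
  by rewrite -[X in measurable X]setTI; exact: emeasurable_fun_c_infty.
have [k Bk] : exists k, leb (B k) != 0.
  apply: contrapT => /forallNP h.
  have B0 k : leb (B k) = 0 by have /negP/negbNE/eqP := h k.
  pose U := \bigcup_k B k; have mU : measurable U by exact: bigcupT_measurable.
  have U0 : leb U = 0.
    apply/eqP; rewrite eq_le measure_ge0 andbT.
    apply: (le_trans (measure_sigma_subadditive leb mB mU (fun x h => h))).
    by rewrite eseries0// => k _ _; exact: B0.
  have acU : ac U = 0 by move/null_content_dominatesP : acleb; apply.
  (* Outside U the density is 0: at a point where it is positive, a large k satisfies both the lower
     bound and the cube condition. *)
  have acD : ac (A0 `\` U) = 0.
    rewrite fI; last exact: measurableD.
    apply: integral0_eq => x [_ nUx]; apply/eqP; rewrite eq_le f0 andbT leNgt.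
    apply/negP => fx; apply: nUx.
    pose S := (\sum_i `|x ord0 i|)%R.
    have S0 : (0 <= S)%R by apply: sumr_ge0.
    have [r r0 rf] : exists2 r : R, (0 < r)%R & r%:E <= f x.
      case: (f x) fx => [r| |]//.
        by rewrite lte_fin => r0; exists r.
      by move=> _; exists 1%R => //; rewrite leey.
    have [k kS] : exists k : nat, (Num.max S r^-1 < k%:R)%R.
      by exists (Num.truncn (Num.max S r^-1)%R).+1; exact: truncnS_gt.
    move: kS; rewrite gt_max => /andP[kS kr].
    have k1 : (k%:R <= k.+1%:R :> R)%R by rewrite ler_nat.
    exists k => //; split => /=.
      apply: le_trans rf; rewrite lee_fin invf_ple ?posrE//.
      by apply: le_trans k1; exact: ltW.
    move=> i /=; rewrite in_itv/= -ler_norml.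
    apply: (le_trans _ k1); apply: (le_trans _ (ltW kS)).
    by rewrite /S (bigD1 i)//= lerDl sumr_ge0.
  move: acA0; apply/negP/negPn; rewrite eq_le measure_ge0 andbT.
  rewrite -[A0](setDUK (@subIsetl _ A0 U)) setDIr setDv set0U.
  have : ac ((A0 `&` U) `|` (A0 `\` U)) <= ac (A0 `&` U) + ac (A0 `\` U).
    by apply: measureU2; [exact: measurableI|exact: measurableD].
  move=> /le_trans; apply; rewrite acD adde0 -acU; apply: le_measure; rewrite ?inE//; exact: measurableI.
exists (k.+1%:R^-1)%R, k.+1%:R, (B k); split => //; split => //.
- by move=> x [].
- by rewrite lt0e Bk measure_ge0.
move=> A mA; rewrite fI//.
have mAB : measurable (A `&` B k) by exact: measurableI.
apply: (@le_trans _ _ (\int[leb]_(x in A `&` B k) f x)); last first.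
  apply: ge0_subset_integral => //; exact: measurable_funTS.
rewrite -(integral_cst leb mAB); apply: ge0_le_integral => //.
- by move=> x _; rewrite lee_fin.
- exact: measurable_funTS.
- by move=> x [_ []].
Qed.

Lemma lebesgue_rV_scale (c : R) (A : set V) : (0 < c)%R -> measurable A ->
  leb A = (c ^+ d)%:E * leb [set x | A (c *: x)%R].
Proof.
move=> c0 mA.
have mA' : measurable [set x : V | A (c *: x)%R].
  by rewrite -[X in measurable X]setTI; exact: (measurable_rV_scale c measurableT mA).
have := integral_indic leb measurableT mA; rewrite setIT => <-.
have := integral_indic leb measurableT mA'; rewrite setIT => <-.
rewrite (@ge0_integral_rV_affine _ _ c 0%R)//.
  by congr (_ * _); apply: eq_integral => x _; rewrite addr0.
by apply/measurable_EFinP; exact: measurable_indic.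
Qed.

Lemma minorant_scale (c M s : R) (E : set V) (m : set V -> \bar R) :
  (0 < c)%R -> (0 < M)%R -> (0 < s)%R -> measurable E -> E `<=` cube M -> 0 < leb E ->
  (forall A, measurable A -> c%:E * leb (A `&` E) <= m A) ->
  exists (c' M' : R) (E' : set V), [/\ (0 < c')%R, (0 < M')%R & [/\ measurable E',
    E' `<=` cube M', 0 < leb E' &
    forall A, measurable A -> c'%:E * leb (A `&` E') <= m [set x | A (s *: x)%R]]].
Proof.
move=> c0 M0 s0 mE EM Egt cm.
pose E' := [set x : V | E (s^-1 *: x)%R].
have sn0 : s != 0%R by rewrite gt_eqF.
have mE' : measurable E'.
  by rewrite -[X in measurable X]setTI; exact: (measurable_rV_scale (s^-1)%R measurableT mE).
have sd0 : (0 < s ^+ d)%R by exact: exprn_gt0.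
have scE A : measurable A ->
    leb (A `&` E') = (s ^+ d)%:E * leb ([set x | A (s *: x)%R] `&` E).
  move=> mA; rewrite (lebesgue_rV_scale s0 (measurableI _ _ mA mE')); congr (_ * leb _).
  by apply/seteqP; split => x /= [h1 h2]; split => //; move: h2; rewrite /E'/= scalerA mulVf// scale1r.
exists (c / s ^+ d)%R, (s * M)%R, E'; split; [exact: divr_gt0|exact: mulr_gt0|split => //].
- move=> x /EM h i; have := h i; rewrite /= !in_itv/= mxE.
  rewrite mulrC ler_pdivlMr// ler_pdivrMr// mulNr => /andP[h1 h2].
  by rewrite [(s * M)%R]mulrC h1 h2.
- have := scE setT measurableT; rewrite setTI => ->; rewrite mule_gt0// ?lte_fin//.
  by rewrite (_ : _ `&` E = E)//; apply/seteqP; split => // x [].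
move=> A mA; rewrite scE// muleA -EFinM divfK ?gt_eqF//; apply: cm.
by rewrite -[X in measurable X]setTI; exact: (measurable_rV_scale s measurableT mA).
Qed.

End radon_nikodym_minorant.

(** * Lipschitz densities up to an exponentially small remainder *)

Lemma distr_le_sym (R : realType) (a b c : R) :
  a <= b + c -> b <= a + c -> `|a - b| <= c.
Proof. by move=> ab ba; rewrite ler_norml; apply/andP; split; lra. Qed.

Lemma spline_rV_le1 (R : realType) (d : nat) (w : R) (N : nat) (x : 'rV[R]_d) :
  (0 < N)%N -> spline_rV w N x <= 1.
Proof.
move=> N0; apply: prodr_ile1 => i _; rewrite spline_ge0/=.
apply: (le_trans (spline_le w _ N0)); rewrite invf_le1 ?sqrtr_gt0 ?ltr0n//.
by rewrite -[leLHS]sqrtr1 ler_wsqrtr ?ler1n.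
Qed.

Section scaled_density.
Context (R : realType) (d : nat) (w : R).
Hypothesis w0 : 0 < w.
Local Notation V := 'rV[R]_d.
Local Notation leb := (lebesgue_rV R d).
Variables (N : nat) (s m : R) (Th : {finite_measure set V -> \bar R}).
Hypotheses (N0 : (0 < N)%N) (s0 : 0 < s) (ThT : (Th setT <= m%:E)%E).

Let H (u y : V) : R := s ^+ d * spline_rV w N (s *: u - y).

Let H0 u y : 0 <= H u y.
Proof. by rewrite mulr_ge0 ?spline_rV_ge0// exprn_ge0// ltW. Qed.

Let mH2 : measurable_fun setT (fun p : V * V => (H p.1 p.2)%:E).
Proof.
apply/measurable_EFinP; apply: measurable_funM => //.
apply: (measurableT_comp (measurable_spline_rV w0 N)).
rewrite (_ : (fun _ => _) = fun p : V * V => s *: p.1 + (-1) *: p.2).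
  by apply: measurable_rV_add; apply: measurable_rV_lin;
    [exact: measurable_fst|exact: measurable_snd].
by apply/funext => p; rewrite scaleN1r.
Qed.

Let mH u : measurable_fun setT (fun y : V => (H u y)%:E).
Proof. exact: (measurableT_comp mH2 (measurable_pair1 u)). Qed.

Let Hint u : (\int[Th]_y (H u y)%:E)%E \is a fin_num.
Proof.
rewrite ge0_fin_numE; last by apply: integral_ge0 => y _; rewrite lee_fin H0.
apply: (@le_lt_trans _ _ (\int[Th]_y (s ^+ d)%:E)%E).
  apply: ge0_le_integral => //.
  - by move=> y _; rewrite lee_fin H0.
  - by move=> y _; rewrite lee_fin ler_piMr ?exprn_ge0 ?(ltW s0)// spline_rV_le1.
rewrite (integral_cst Th measurableT) lte_mul_pinfty ?lee_fin ?exprn_ge0 ?(ltW s0)//.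
by rewrite -ge0_fin_numE// fin_num_measure.
Qed.

(** The density at u of the convolution of [Th] with the spline, after division by s; the integral
    is finite by [Hint]. *)
Definition scaled_density (u : V) : R := fine (\int[Th]_y (H u y)%:E)%E.

Lemma scaled_density_ge0 u : 0 <= scaled_density u.
Proof. by apply: fine_ge0; apply: integral_ge0 => y _; rewrite lee_fin H0. Qed.

Lemma measurable_scaled_density : measurable_fun setT scaled_density.
Proof.
apply: measurableT_comp => //.
exact: (measurable_fun_fubini_tonelli_F (m2 := Th) _ mH2 (fun p => H0 _ _)).
Qed.

Lemma scaled_density_lipschitz (B : R) u v : 0 < B -> 0 <= m ->
  s ^+ 2 <= B ^+ 2 * N%:R ->
  `|scaled_density u - scaled_density v| <=
  m * (2 * B ^+ d.+1 / w) * \sum_i `|u ord0 i - v ord0 i|.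
Proof.
move=> B0 m0 sB.
suff oneside x y : scaled_density x <= scaled_density y +
    m * (2 * B ^+ d.+1 / w) * \sum_i `|x ord0 i - y ord0 i|.
  have h1 := oneside u v; have := oneside v u.
  rewrite (eq_bigr (fun i => `|u ord0 i - v ord0 i|)); last by move=> i _; rewrite distrC.
  exact: distr_le_sym.
set C := 2 * B ^+ d.+1 / w; set S := \sum_i _.
have S0 : 0 <= S by exact: sumr_ge0.
have C0 : 0 <= C by rewrite divr_ge0 ?mulr_ge0 ?exprn_ge0 ?ltW.
suff : ((scaled_density x)%:E <= (scaled_density y)%:E + (m * C * S)%:E)%E by [].
rewrite [X in (X <= _)%E](fineK (Hint x)) [X in (_ <= X + _)%E](fineK (Hint y)).
apply: (@le_trans _ _ (\int[Th]_z ((H y z)%:E + (C * S)%:E))%E).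
  apply: ge0_le_integral => //.
  - by move=> z _; rewrite lee_fin H0.
  - exact: emeasurable_funD.
  - move=> z _; rewrite -EFinD lee_fin.
    have E a : s *: a - z = s *: (a - s^-1 *: z).
      by rewrite scalerBr scalerA divff ?gt_eqF// scale1r.
    rewrite /H !E.
    have := scaled_spline_rV_lipschitz w0 (x - s^-1 *: z) (y - s^-1 *: z) N0 B0 (ltW s0) sB.
    rewrite (eq_bigr (fun i => `|x ord0 i - y ord0 i|)); last first.
      by move=> i _; rewrite !mxE opprB addrA subrK.
    by rewrite -/C -/S => /(le_trans (ler_norm _)); rewrite lerBlDl.
rewrite ge0_integralD//; last 2 first.
- by move=> z _; rewrite lee_fin H0.
- by move=> z _; rewrite lee_fin mulr_ge0.
apply: leeD2l; rewrite (integral_cst Th measurableT).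
have CS0 : (0 <= (C * S)%:E)%E by rewrite lee_fin mulr_ge0.
apply: (le_trans (lee_wpmul2l CS0 ThT)).
by rewrite -EFinM lee_fin mulrC mulrA.
Qed.

Lemma integral_scaled_density (A : set V) : measurable A ->
  (\int[leb]_(x in A) (scaled_density x)%:E =
   \int[Th]_y smooth w N (fun x => (\1_A (s^-1 *: x))%:E) y)%E.
Proof.
move=> mA.
have mI : measurable_fun setT (fun x : V => (\1_A x)%:E : \bar R).
  by apply/measurable_EFinP; exact: measurable_indic.
have mIs : measurable_fun setT (fun x : V => (\1_A (s^-1 *: x))%:E : \bar R).
  exact: (measurableT_comp mI (measurable_rV_scale s^-1)).
have mG : measurable_fun setT (spline_rV w N : V -> R) by exact: measurable_spline_rV.
have sn0 : s != 0 by rewrite gt_eqF.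
transitivity (\int[leb]_x \int[Th]_y ((\1_A x)%:E * (H x y)%:E))%E.
  rewrite integral_mkcond; apply: eq_integral => x _.
  rewrite ge0_integralZl//; last by move=> y _; rewrite lee_fin H0.
  rewrite patchE indicE; case: ifP => _; last by rewrite mul0e.
  by rewrite mul1e /scaled_density fineK.
have mK : measurable_fun setT (fun p : V * V => (\1_A p.1)%:E * (H p.1 p.2)%:E)%E.
  by apply: emeasurable_funM => //; exact: (measurableT_comp mI measurable_fst).
have K0 (p : V * V) : (0 <= (\1_A p.1)%:E * (H p.1 p.2)%:E :> \bar R)%E.
  by rewrite mule_ge0// lee_fin.
rewrite (fubini_tonelli (m1 := leb) (m2 := Th) _ mK K0).
apply: eq_integral => y _.
rewrite [RHS](integral_translate_mul y mG (spline_rV_ge0 w N) mIs)//.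
have mG' : measurable_fun setT (fun z : V => (spline_rV w N (z - y))%:E).
  by apply/measurable_EFinP; exact: (measurableT_comp mG (measurable_rV_shift (- y))).
rewrite [RHS](@ge0_integral_rV_affine _ _ s 0)//; last 2 first.
- exact: emeasurable_funM.
- by move=> z; rewrite mule_ge0// lee_fin spline_rV_ge0.
rewrite -ge0_integralZl//; last 3 first.
- have mA' := measurable_rV_affine s (0 : V).
  apply: emeasurable_funM; first exact: (measurableT_comp mG' mA').
  exact: (measurableT_comp mIs mA').
- by move=> z _; rewrite mule_ge0// lee_fin spline_rV_ge0.
- by rewrite lee_fin exprn_ge0// ltW.
apply: eq_integral => z _.
by rewrite addr0 scalerA mulVf// scale1r /H EFinM muleC muleA.
Qed.

End scaled_density.

Lemma half_complement_bounds (R : realType) (p : R) :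
  0 < p -> 0 <= 1 - p -> 0 <= 1 - p / 2 < 1.
Proof. by move=> p0 p1; apply/andP; split; lra. Qed.

Section exponential_splitting.
Context dT (T : measurableType dT) (R : realType) (P : probability T R) (d : nat).
Local Notation V := 'rV[R]_d.
Local Notation leb := (lebesgue_rV R d).
Variable xi : nat -> {RV P >-> V}.
Hypotheses (indep : mutually_independent xi) (idist : identically_distributed xi).
Local Open Scope ereal_scope.

Lemma sum_law_minorant n0 (ac : {measure set V -> \bar R}) (A0 : set V) :
  (0 < n0)%N -> is_ac_part leb (distribution P (normalized_sum xi n0)) ac ->
  measurable A0 -> ac A0 != 0 ->
  exists (c M : R) (E : set V), [/\ (0 < c)%R, (0 < M)%R & [/\ measurable E,
    E `<=` cube M, 0 < leb E &
    forall A, measurable A -> c%:E * leb (A `&` E) <= sum_law xi n0 A]].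
Proof.
move=> n00 [acleb [s [_ PE]]] mA0 acA0.
have acle A : measurable A -> ac A <= distribution P (normalized_sum xi n0) A.
  by move=> mA; rewrite PE// leeDl.
have acT : ac setT < +oo.
  by apply: (le_lt_trans (acle _ measurableT)); rewrite probability_setT ltry.
have [c [M [E [c0 M0 [mE EM Egt cE]]]]] := ac_minorant acleb acT mA0 acA0.
have s0 : (0 < (Num.sqrt n0%:R) :> R)%R by rewrite sqrtr_gt0 ltr0n.
have cE' A : measurable A -> c%:E * leb (A `&` E) <=
    distribution P (normalized_sum xi n0) A.
  by move=> mA; apply: le_trans (cE _ mA) (acle _ mA).
have [c' [M' [E' [c0' M0' [mE' EM' Egt' cE'']]]]] :=
  minorant_scale c0 M0 s0 mE EM Egt cE'.
exists c', M', E'; split => //; split => // A mA.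
apply: (le_trans (cE'' _ mA)); rewrite distribution_normalized_sum.
rewrite (_ : [set x | _] = A)//; apply/funext => x /=.
by rewrite scalerA divff ?scale1r// gt_eqF.
Qed.

Lemma spline_component (c w m0 : R) (x0 : V) (k : {finite_measure set V -> \bar R}) :
  (0 < c)%R -> (0 < w)%R -> spline_mass d w = m0%:E -> k setT = 1 ->
  (forall A, measurable A ->
    c%:E * \int[leb]_(x in A) (spline_rV w 1 (x - x0))%:E <= k A) ->
  exists b : {finite_measure set V -> \bar R}, b setT = (1 - c * m0)%:E /\
    forall f : V -> \bar R, measurable_fun setT f -> (forall x, 0 <= f x) ->
    \int[k]_x f x = c%:E * smooth w 1 f x0 + \int[b]_x f x.
Proof.
move=> c0 w0 mass kT kA.
have [z [zT zE]] := smooth_measure_ex w0 x0 c0 mass erefl 1.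
have mG : measurable_fun setT (spline_rV w 1 : V -> R) by exact: measurable_spline_rV.
have zk A : measurable A -> z A <= k A.
  move=> mA; apply: le_trans (kA _ mA).
  have mI : measurable_fun setT (fun x : V => (\1_A x)%:E : \bar R).
    by apply/measurable_EFinP; exact: measurable_indic.
  have := zE _ mI (fun x => _); rewrite integral_indic// setIT => ->; last first.
    by move=> x; rewrite lee_fin.
  rewrite lee_wpmul2l ?lee_fin ?(ltW c0)//.
  rewrite [X in X <= _](integral_translate_mul x0 mG (spline_rV_ge0 w 1) mI); last first.
    by move=> x; rewrite lee_fin.
  rewrite [X in _ <= X]integral_mkcond le_eqVlt; apply/orP; left; apply/eqP.
  apply: eq_integral => x _; rewrite patchE indicE.
  by case: ifP => _; rewrite ?mule1 ?mule0.
have [b bE] := measure_difference_ex zk.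
exists b; split.
  have /esym := bE _ measurableT; rewrite kT zT => h.
  have bf : b setT \is a fin_num by rewrite fin_num_measure.
  move: h; rewrite -(fineK bf) => -[h].
  by congr EFin; rewrite -h addrAC subrr add0r.
move=> f mf f0; rewrite -zE// -ge0_integral_measure_add//.
by apply: eq_measure_integral => A mA _; rewrite /= /measure_add /= /msum !big_ord_recr big_ord0 /= add0e bE.
Qed.

(** A block has 2 n0 steps, since the spline minorant comes from convolving the law of n0 steps with
    itself. The r leftover steps form the initial measure of [smooth_split], so the constants depend
    neither on the number of blocks nor on r. *)
Lemma sum_law_split n0 (ac : {measure set V -> \bar R}) (A0 : set V) :
  (0 < n0)%N -> is_ac_part leb (distribution P (normalized_sum xi n0)) ac ->
  measurable A0 -> ac A0 != 0 ->
  exists w m0 q : R, [/\ (0 < w)%R, (0 < m0)%R, (0 <= q < 1)%R &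
    forall i N r, exists T' R' : {finite_measure set V -> \bar R},
    [/\ T' setT <= (m0^-1)%:E, R' setT <= (2 ^+ N.+1 * q ^+ i)%:E &
      forall f : V -> \bar R, measurable_fun setT f -> (forall x, 0 <= f x) ->
      \int[sum_law xi ((n0 + n0) * i + r)]_x f x =
      \int[T']_y smooth w N.+1 f y + \int[R']_x f x]].
Proof.
move=> n00 acP mA0 acA0.
have [c [M [E [c0 M0 [mE EM Egt cE]]]]] := sum_law_minorant n00 acP mA0 acA0.
have [x0 [c' [w [c0' w0 kA]]]] := mconv_minorant c0 M0 mE EM Egt cE.
have [m0 m00 mass] := spline_massE d w0.
pose k := [the {finite_measure set V -> \bar R} of mconv (sum_law xi n0) (sum_law xi n0)].
have kT : k setT = 1.
  by rewrite /k/= mconv_setT [X in X * _]probability_setT [X in _ * X]probability_setT mule1.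
have [b [bT kE]] := spline_component c0' w0 mass kT kA.
exists w, m0, (1 - c' * m0 / 2)%R; split => //.
  have p0 : (0 < c' * m0)%R by rewrite mulr_gt0.
  have : 0 <= b setT by [].
  by rewrite bT lee_fin; exact: half_complement_bounds.
move=> i N r.
pose L (i : nat) : {finite_measure set V -> \bar R} := sum_law xi ((n0 + n0) * i + r)%N.
have LT i' : L i' setT <= 1 by rewrite [X in X <= _]probability_setT.
have LE i' (f : V -> \bar R) : measurable_fun setT f -> (forall x, 0 <= f x) ->
    \int[L i'.+1]_x f x = \int[L i']_s \int[k]_v f (s + v)%R.
  move=> mf f0; rewrite /L/=.
  rewrite (_ : (_ * _ + _ = ((n0 + n0) * i' + r) + (n0 + n0))%N); last by lia.
  rewrite ge0_integral_sum_lawD//; apply: eq_integral => s _.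
  have mfs : measurable_fun setT (fun v : V => f (s + v)%R).
    by under eq_fun do rewrite addrC; exact: (measurableT_comp mf (measurable_rV_shift s)).
  rewrite [LHS](ge0_integral_sum_lawD indep idist)// [RHS]ge0_integral_mconv//.
exact: (smooth_split w0 c0' m00 mass erefl bT kE LT LE i N).
Qed.

End exponential_splitting.

Lemma expr_le_quarter_ex (R : realType) (q : R) : 0 <= q < 1 ->
  exists2 K, (0 < K)%N & q ^+ K <= 4^-1.
Proof.
move=> /andP[q0 q1].
have /cvgrPdist_le/(_ 4^-1) : (fun n => q ^+ n) @ \oo --> (0 : R).
  by apply: cvg_expr; rewrite ger0_norm.
rewrite invr_gt0 ltr0n => /(_ isT)[N _ /(_ N.+1)]/=; rewrite leqnSn => /(_ isT).
by rewrite sub0r normrN ger0_norm ?exprn_ge0// => h; exists N.+1.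
Qed.

(* [q ^+ K <= 4^-1] beats the factor [2 ^+ a.+1] of [smooth_split]. *)
Lemma geometric_remainder_le (R : realType) (q : R) (K L a n : nat) :
  0 <= q -> q ^+ K <= 4^-1 -> (0 < L)%N -> (n <= L * a.+1)%N ->
  2 ^+ a.+1 * q ^+ (K * a) <= 4 * expR (- (ln 2 / L%:R) * n%:R).
Proof.
move=> q0 qK L0 nL.
have L0' : 0 < L%:R :> R by rewrite ltr0n.
have h1 : q ^+ (K * a) <= 4^-1 ^+ a.
  by rewrite exprM lerXn2r// ?nnegrE ?exprn_ge0// invr_ge0.
apply: (@le_trans _ _ (2 ^+ a.+1 * 4^-1 ^+ a)); first by rewrite ler_wpM2l ?exprn_ge0.
have -> : 2 ^+ a.+1 * 4^-1 ^+ a = 4 * 2^-1 ^+ a.+1 :> R.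
  rewrite !exprS mulrCA -!mulrA -exprMn (_ : 2 * 4^-1 = 2^-1)//; last by field.
  by field.
rewrite ler_pM2l// -[2^-1 in leLHS](@lnK R) ?posrE ?invr_gt0// -expRM_natl ler_expR.
rewrite lnV ?posrE// mulrN mulNr lerN2 mulrAC ler_pdivrMr//.
rewrite mulrAC [leRHS]mulrC ler_wpM2l//; first by rewrite ln_ge0// ler1n.
by rewrite -natrM ler_nat mulnC.
Qed.

Section lipschitz_decomposition.
Context dT (T : measurableType dT) (R : realType) (P : probability T R) (d : nat).
Local Notation V := 'rV[R]_d.
Local Notation leb := (lebesgue_rV R d).
Variable xi : nat -> {RV P >-> V}.
Hypotheses (indep : mutually_independent xi) (idist : identically_distributed xi).

Lemma lipschitz_decomposition n0 (ac : {measure set V -> \bar R}) (A0 : set V) :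
  (0 < n0)%N -> is_ac_part leb (distribution P (normalized_sum xi n0)) ac ->
  measurable A0 -> ac A0 != 0%E ->
  exists K1 D rho : R, [/\ 0 <= K1, 0 < D, 0 < rho &
  forall n, (0 < n)%N ->
  exists (q : V -> R) (Q Rm : {measure set V -> \bar R}),
  [/\ measurable_fun setT q, forall x, 0 <= q x,
    forall x y, `|q x - q y| <= K1 * \sum_i `|x ord0 i - y ord0 i|,
    forall A, measurable A -> Q A = (\int[leb]_(x in A) (q x)%:E)%E &
    (Rm setT <= (D * expR (- rho * n%:R))%:E)%E /\
    forall A, measurable A ->
      distribution P (normalized_sum xi n) A = (Q A + Rm A)%E]].
Proof.
move=> n00 acP mA0 acA0.
have [w [m0 [q [w0 m00 q01 H]]]] := sum_law_split indep idist n00 acP mA0 acA0.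
have [K K0 qK] := expr_le_quarter_ex q01.
have q0 : 0 <= q by case/andP: q01.
pose L := ((n0 + n0) * K)%N.
have L0 : (0 < L)%N by rewrite muln_gt0 addn_gt0 n00.
have L0' : 0 < L%:R :> R by rewrite ltr0n.
(* With this choice s^2 = n <= B^2 (a + 1), the scale condition of [scaled_density_lipschitz]. *)
pose B : R := Num.sqrt L%:R.
have B0 : 0 < B by rewrite sqrtr_gt0.
have m0V : 0 <= m0^-1 by rewrite invr_ge0 ltW.
exists (m0^-1 * (2 * B ^+ d.+1 / w)), 4, (ln 2 / L%:R); split => //.
- by rewrite mulr_ge0// divr_ge0 ?(ltW w0)// mulr_ge0// exprn_ge0// ltW.
- by rewrite divr_gt0// ln_gt0// ltr1n.
move=> n n_gt0; pose a := (n %/ L)%N; pose r := (n %% L)%N.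
have nE : n = ((n0 + n0) * (K * a) + r)%N.
  by rewrite mulnA -/L mulnC -divn_eq.
have nL : (n <= L * a.+1)%N.
  by rewrite mulnS [(L * a)%N]mulnC {1}(divn_eq n L) addnC leq_add2r ltnW// ltn_mod.
(* Among K a blocks, a + 1 spline factors are demanded: a number proportional to n, yet few enough
   that failing to reach it has exponentially small mass. *)
have [Th [R' [ThT RT HE]]] := H (K * a)%N a r.
rewrite -nE in HE.
pose s : R := Num.sqrt n%:R.
have s0 : 0 < s by rewrite sqrtr_gt0 ltr0n.
have sB : s ^+ 2 <= B ^+ 2 * a.+1%:R.
  by rewrite !sqr_sqrtr// -natrM ler_nat.
have a0 : (0 < a.+1)%N by [].
have q_ge0 x := scaled_density_ge0 w a.+1 Th s0 x.
have mq := measurable_scaled_density w0 a.+1 Th s0.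
set q_ := scaled_density w a.+1 s Th in q_ge0 mq.
pose mscale_inv := pack_mfun (@measurable_rV_scale R d s^-1).
exists q_, (density_measure leb (pack_mfun mq)), (image_measure R' mscale_inv).
have QE A : measurable A ->
    (density_measure leb (pack_mfun mq) A = \int[leb]_(x in A) (q_ x)%:E)%E.
  by move=> mA; apply: eq_integral => x _; rewrite /= ger0_norm.
split => //.
- by move=> x y; exact: scaled_density_lipschitz.
split.
  apply: (le_trans RT).
  by rewrite lee_fin; exact: geometric_remainder_le.
move=> A mA; rewrite distribution_normalized_sum -/s.
have mA' : measurable [set x : V | A (s^-1 *: x)].
  by rewrite -[X in measurable X]setTI; exact: (measurable_rV_scale s^-1 measurableT mA).
have mIs : measurable_fun setT (fun x : V => (\1_A (s^-1 *: x))%:E : \bar R).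
  apply/measurable_EFinP.
  exact: (measurableT_comp (measurable_indic mA) (measurable_rV_scale s^-1)).
have Is0 (x : V) : (0 <= (\1_A (s^-1 *: x))%:E :> \bar R)%E by rewrite lee_fin.
have intI (m : {measure set V -> \bar R}) :
    (\int[m]_x (\1_A (s^-1 *: x))%:E = m [set x | A (s^-1 *: x)])%E.
  by have := integral_indic m measurableT mA'; rewrite setIT.
rewrite -intI (HE _ mIs Is0) intI.
by rewrite [X in _ = (X + _)%E](QE _ mA) integral_scaled_density.
Qed.


End lipschitz_decomposition.

(** * The uniform local limit *)

Section heat_average.
Context (R : realType) (d : nat).
Local Notation V := 'rV[R]_d.
Local Notation D := (d%:R / 2 : R).
Local Notation leb := (lebesgue_rV R d).
Local Open Scope ereal_scope.

Lemma heat_opp (t : R) (v : V) : heat t (- v)%R = heat t v.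
Proof. by rewrite -scaleN1r /heat sqnZ sqrrN expr1n mul1r. Qed.

Lemma heat_average_near (K1 t : R) (q : V -> R) (x : V) : (0 <= K1)%R -> (0 < t)%R ->
  measurable_fun setT q -> (forall x, 0 <= q x)%R ->
  (forall x y, `|q x - q y| <= K1 * \sum_i `|x ord0 i - y ord0 i|)%R ->
  let C := (K1 * (d%:R * (2 * Num.sqrt t) * expR (D * ln 2)))%R in
  (q x)%:E <= \int[leb]_y (heat t (x - y) * q y)%:E + C%:E /\
  \int[leb]_y (heat t (x - y) * q y)%:E <= (q x + C)%:E.
Proof.
move=> K10 t0 mq q0 qL C.
pose A (v : V) : R := (\sum_i `|v ord0 i|)%R.
have A0 v : (0 <= A v)%R by exact: sumr_ge0.
have mA : measurable_fun setT A.
  apply: measurable_sum => i; apply: measurableT_comp => //; exact: measurable_rV_coord.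
have mh : measurable_fun setT (heat t : V -> R) by exact: measurable_heat.
have h0 (v : V) : (0 <= heat t v)%R by exact: heat_ge0.
have mqx : measurable_fun setT (fun v : V => q (v + x)%R).
  exact: (measurableT_comp mq (measurable_rV_shift x)).
have -> : \int[leb]_y (heat t (x - y) * q y)%:E = \int[leb]_v (heat t v * q (v + x)%R)%:E.
  rewrite (ge0_integral_rV_shift x).
  - by apply: eq_integral => v _; rewrite opprD addrCA subrr addr0 heat_opp.
  - apply/measurable_EFinP; apply: measurable_funM => //.
    rewrite (_ : (fun _ => _) = fun y : V => heat t (y - x)%R).
      exact: (measurableT_comp mh (measurable_rV_shift (- x)%R)).
    by apply/funext => y; rewrite -heat_opp opprB.
  - by move=> y; rewrite lee_fin mulr_ge0.
have mhq : measurable_fun setT (fun v : V => (heat t v * q (v + x)%R)%:E).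
  by apply/measurable_EFinP; exact: measurable_funM.
have mAh : measurable_fun setT (fun v : V => (A v * heat t v)%:E).
  by apply/measurable_EFinP; exact: measurable_funM.
have mhE : measurable_fun setT (fun v : V => (heat t v)%:E) by exact/measurable_EFinP.
have IA : K1%:E * \int[leb]_v (A v * heat t v)%:E <= C%:E.
  by rewrite /C EFinM lee_wpmul2l ?lee_fin//; exact: integral_heat_abs.
have qd v : (`|q (v + x)%R - q x| <= K1 * A v)%R.
  have := qL (v + x)%R x; rewrite (_ : \sum_i _ = A v)%R//; apply: eq_bigr => i _.
  by rewrite !mxE addrK.
have Iq : \int[leb]_v (heat t v * q x)%:E = (q x)%:E.
  under eq_integral do rewrite EFinM.
  rewrite ge0_integralZr ?lee_fin//; last by move=> v _; rewrite lee_fin.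
  by rewrite integral_heat// mul1e.
have IK : \int[leb]_v (K1%:E * (A v * heat t v)%:E) <= C%:E.
  by rewrite ge0_integralZl ?lee_fin// => v _; rewrite lee_fin mulr_ge0.
split.
- rewrite -{1}Iq; apply: (le_trans _ (leeD (lexx _) IK)).
  rewrite -ge0_integralD//; last 3 first.
  + by move=> v _; rewrite lee_fin mulr_ge0.
  + by move=> v _; rewrite mule_ge0 ?lee_fin// mulr_ge0.
  + exact: emeasurable_funM.
  apply: ge0_le_integral => //.
  + by move=> v _; rewrite lee_fin mulr_ge0.
  + by apply/measurable_EFinP; exact: measurable_funM.
  + by apply: emeasurable_funD => //; exact: emeasurable_funM.
  + move=> v _; rewrite -EFinM -EFinD lee_fin mulrA [(_ * heat t v)%R]mulrC -mulrDr.
    apply: ler_wpM2l => //; move: (qd v).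
    by rewrite distrC => /(le_trans (ler_norm _)); rewrite lerBlDl.
- rewrite EFinD -{1}Iq; apply: (le_trans _ (leeD (lexx _) IK)).
  rewrite -ge0_integralD//; last 4 first.
  + by move=> v _; rewrite lee_fin mulr_ge0.
  + by apply/measurable_EFinP; exact: measurable_funM.
  + by move=> v _; rewrite mule_ge0 ?lee_fin// mulr_ge0.
  + exact: emeasurable_funM.
  apply: ge0_le_integral => //.
  + by move=> v _; rewrite lee_fin mulr_ge0.
  + apply: emeasurable_funD => //; last exact: emeasurable_funM.
    by apply/measurable_EFinP; exact: measurable_funM.
  + move=> v _; rewrite -EFinM -EFinD lee_fin mulrA [(_ * heat t v)%R]mulrC -mulrDr.
    apply: ler_wpM2l => //; move: (qd v).
    by move/(le_trans (ler_norm _)); rewrite lerBlDl.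
Qed.

End heat_average.

Lemma expR_decay (R : realType) (C rho eps : R) : 0 < rho -> 0 < eps ->
  exists N : nat, forall n, (N < n)%N -> C * expR (- rho * n%:R) <= eps.
Proof.
move=> rho0 eps0; exists (Num.bound `|C / (eps * rho)|) => n Nn.
rewrite mulNr expRN ler_pdivrMr ?expR_gt0//.
apply: (@le_trans _ _ (eps * (rho * n%:R))).
  rewrite mulrA mulrC -ler_pdivrMr ?mulr_gt0//.
  apply: (le_trans (ler_norm _)); apply: (le_trans (ltW (archi_boundP _))) => //.
  by rewrite ler_nat ltnW.
rewrite ler_wpM2l ?(ltW eps0)//; apply: le_trans (expR_ge1Dx _).
by rewrite lerDr.
Qed.

(** The error budget of [local_limit]: a for smoothing the density, one quarter of eps for
    Lindeberg's comparison and one for the remainder, b for changing the variance from 1 + t to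
    1. *)
Lemma distr_le_quarters (R : realType) (a b eps h q g : R) :
  q <= h + eps / 4 + a -> h <= q + a + eps / 4 + eps / 4 -> `|h - g| <= b ->
  a + b <= eps / 4 -> `|q - g| <= eps.
Proof.
move=> h1 h2; rewrite !ler_norml => /andP[h3 h4] h5.
by apply/andP; split; lra.
Qed.

Section local_limit.
Context dT (T : measurableType dT) (R : realType) (P : probability T R) (d : nat).
Local Notation V := 'rV[R]_d.
Local Notation D := (d%:R / 2 : R).
Local Notation leb := (lebesgue_rV R d).
Variable xi : nat -> {RV P >-> V}.
Hypothesis indep : mutually_independent xi.
Hypothesis idist : identically_distributed xi.
Hypothesis xiL2 : forall k, square_integrable P (xi k).
Hypothesis xic : forall k, centered P (xi k).
Hypothesis xicov : forall k, identity_covariance P (xi k).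

Lemma heat_normalized_sum (n : nat) (t : R) (x : V) (q : V -> R)
    (Q Rm : {measure set V -> \bar R}) :
  measurable_fun setT q -> (forall x, 0 <= q x) -> 0 < t ->
  (forall A, measurable A -> Q A = (\int[leb]_(x in A) (q x)%:E)%E) ->
  (forall A, measurable A -> distribution P (normalized_sum xi n) A = (Q A + Rm A)%E) ->
  let I := (\int[sum_law xi n]_y (heat t (x - (Num.sqrt n%:R)^-1 *: y))%:E)%E in
  let J := (\int[leb]_y (heat t (x - y) * q y)%:E)%E in
  (J <= I)%E /\ (I <= J + (heat_peak d t)%:E * Rm setT)%E.
Proof.
move=> mq q0 t0 QE PE I J.
have mF : measurable_fun setT (fun y : V => (heat t (x - y))%:E).
  apply/measurable_EFinP; apply: (measurableT_comp (measurable_heat t)).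
  rewrite (_ : (fun _ => _) = fun v : V => -1 *: v + x); first exact: measurable_rV_affine.
  by apply/funext => v; rewrite scaleN1r addrC.
have F0 (y : V) : (0 <= (heat t (x - y))%:E)%E by rewrite lee_fin heat_ge0.
have IE : I = (\int[distribution P (normalized_sum xi n)]_y (heat t (x - y))%:E)%E.
  rewrite ge0_integral_distribution// /I ge0_integral_distribution//.
  exact: measurable_heat_sub.
have JE : J = (\int[Q]_y (heat t (x - y))%:E)%E.
  rewrite (eq_measure_integral (density_measure leb (pack_mfun mq))); last first.
    by move=> A mA _; rewrite QE//; apply: eq_integral => y _; rewrite /= ger0_norm.
  by rewrite ge0_integral_density//; apply: eq_integral => y _; rewrite /= ger0_norm// EFinM.
have -> : I = (J + \int[Rm]_y (heat t (x - y))%:E)%E.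
  rewrite IE JE -ge0_integral_measure_add//.
  apply: eq_measure_integral => A mA _.
  by rewrite /= /measure_add /= /msum !big_ord_recr big_ord0 /= add0e PE.
split; first by rewrite leeDl// integral_ge0.
apply: leeD2l; rewrite -[leRHS](integral_cst Rm measurableT).
by apply: ge0_le_integral => // y _; rewrite lee_fin ?heat_ge0 ?heat_le_peak.
Qed.

Lemma local_limit (K1 C0 rho : R) (q : nat -> V -> R)
    (Q Rm : nat -> {measure set V -> \bar R}) :
  0 <= K1 -> 0 < C0 -> 0 < rho ->
  (forall n, (0 < n)%N -> [/\ measurable_fun setT (q n), forall x, 0 <= q n x,
    forall x y, `|q n x - q n y| <= K1 * \sum_i `|x ord0 i - y ord0 i|,
    forall A, measurable A -> Q n A = (\int[leb]_(x in A) (q n x)%:E)%E &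
    (Rm n setT <= (C0 * expR (- rho * n%:R))%:E)%E /\
    forall A, measurable A ->
      distribution P (normalized_sum xi n) A = (Q n A + Rm n A)%E]) ->
  forall eps, 0 < eps -> exists N : nat, forall n, (N < n)%N -> forall x,
    `|q n x - std_gauss_pdf x| <= eps.
Proof.
move=> K10 C00 rho0 H eps eps0.
pose c1 := K1 * (d%:R * 2 * expR (D * ln 2)).
pose c2 := (D + 1) * heat_peak d 1.
have c10 : 0 <= c1 by rewrite mulr_ge0// mulr_ge0 ?expR_ge0// mulr_ge0.
have c20 : 0 <= c2 by rewrite mulr_ge0 ?expR_ge0// addr_ge0// divr_ge0.
have c0 : 0 < c1 + c2 + 1 by rewrite ltr_wpDl// addr_ge0.
(* With t = tau^2 the smoothing error is c1 tau; since tau <= 1, the variance error c2 t is at most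
   c2 tau. The 1 in the denominator keeps it positive. *)
pose tau := Num.min 1 (eps / 4 / (c1 + c2 + 1)).
have tau0 : 0 < tau by rewrite lt_min ltr01/= divr_gt0// divr_gt0.
have tau1 : tau <= 1 by rewrite ge_min lexx.
have tauE : (c1 + c2 + 1) * tau <= eps / 4.
  by rewrite mulrC -ler_pdivlMr// ge_min lexx orbT.
pose t := tau ^+ 2.
have t0 : 0 < t by rewrite exprn_gt0.
have c1t : K1 * (d%:R * (2 * Num.sqrt t) * expR (D * ln 2)) = c1 * tau.
  by rewrite sqrtr_sqr ger0_norm ?(ltW tau0)// /c1; ring.
have eps4 : 0 < eps / 4 by rewrite divr_gt0.
have [N1 HN1] := heat_sum_law indep idist xiL2 xic xicov t0 eps4.
have [N2 HN2] := expR_decay (heat_peak d t * C0) rho0 eps4.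
exists (maxn N1 N2) => n nN x; have /andP[nN1 nN2] : (N1 < n)%N && (N2 < n)%N by rewrite -gtn_max.
have n0 : (0 < n)%N by exact: leq_ltn_trans nN.
have [mq q0 qL QE [RT PE]] := H _ n0.
have [h1 h2] := heat_average_near x K10 t0 mq q0 qL.
have [J1 J2] := heat_normalized_sum x mq q0 t0 QE PE.
(* All n summands are replaced, so the time moves from t to t + 1 at a total cost of eps / 4. *)
have [] := HN1 n nN1 n t x (lexx t).
rewrite divff ?pnatr_eq0 -?lt0n// (_ : n%:R * (eps / 4 / n%:R) = eps / 4); last first.
  by rewrite mulrC divfK// pnatr_eq0 -lt0n.
move=> L1 L2.
move: h1 h2; rewrite c1t; set J := (\int[leb]_y _)%E in J1 J2 *.
set I := (\int[_]_y _)%E in J1 J2 L1 L2 => h1 h2.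
have peakR : ((heat_peak d t)%:E * Rm n setT <= (eps / 4)%:E)%E.
  apply: (le_trans (lee_wpmul2l _ RT)); first by rewrite lee_fin ltW// heat_peak_gt0.
  by rewrite -EFinM lee_fin mulrA; exact: HN2 nN2.
apply: (@distr_le_quarters _ (c1 * tau) (c2 * t) eps (heat (t + 1) x)).
- rewrite -lee_fin; apply: (le_trans h1).
  by rewrite EFinD; apply: leeD => //; exact: le_trans L1.
- rewrite -lee_fin; apply: (le_trans L2); rewrite EFinD; apply: leeD => //.
  by apply: (le_trans J2); rewrite EFinD; exact: leeD.
- by have := heat_near1 x (ltW t0); rewrite heat1E.
- apply: le_trans tauE; rewrite -subr_ge0.
  rewrite (_ : _ - _ = tau + c2 * (tau - t)); last by rewrite /t; ring.
  by rewrite addr_ge0 ?(ltW tau0)// mulr_ge0// subr_ge0 /t expr2 ler_piMr ?(ltW tau0).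
Qed.


End local_limit.

(** The point x0 makes the range nonempty; otherwise the supremum would be -oo. *)
Lemma cvg_sup_dist_to0P (R : realType) (X : Type) (x0 : X) (f : nat -> X -> R) (g : X -> R) :
  ereal_sup (range (fun y => `|f n y - g y|%:E)) @[n --> \oo] --> 0%E <->
  forall eps, 0 < eps -> exists N : nat, forall n, (N < n)%N -> forall x,
    `|f n x - g x| <= eps.
Proof.
pose u n : \bar R := ereal_sup (range (fun y => `|f n y - g y|%:E)).
have ub n x : (`|f n x - g x|%:E <= u n)%E by apply: ereal_sup_ubound; exists x.
have u0 n : (0 <= u n)%E by apply: le_trans (ub n x0); rewrite lee_fin.
split.
- move=> /fine_cvgP[ufin /cvgrPdist_le h] eps eps0.
  have [N _ HN] := filterI ufin (h _ eps0).
  exists N => n /ltnW /HN[/= un]; rewrite sub0r normrN => ue x.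
  rewrite -lee_fin; apply: (le_trans (ub n x)); have -> : u n = (fine (u n))%:E by rewrite fineK.
  rewrite lee_fin.
  exact: le_trans (ler_norm _) ue.
- move=> h.
  have hu eps : 0 < eps -> exists N : nat, forall n, (N < n)%N -> (u n <= eps%:E)%E.
    move=> /h[N HN]; exists N => n Nn; apply: ge_ereal_sup => _ [x _ <-].
    by rewrite lee_fin; exact: HN.
  have ufin n (eps : R) : (u n <= eps%:E)%E -> u n \is a fin_num.
    by move=> un; rewrite ge0_fin_numE// (le_lt_trans un)// ltry.
  apply/fine_cvgP; split.
    by have [N HN] := hu 1 ltr01; exists N.+1 => // n /HN; exact: ufin.
  apply/cvgrPdist_le => eps /hu[N HN]; exists N.+1 => // n /HN un /=.
  rewrite sub0r normrN ger0_norm; last by apply: fine_ge0; exact: u0.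
  have uE : u n = (fine (u n))%:E by rewrite fineK// (ufin _ _ un).
  by move: un; rewrite uE lee_fin.
Qed.

(** * From the local limit to an absolutely continuous part, and the equivalence *)

Section gaussian_cube.
Context (R : realType) (d : nat).
Local Notation V := 'rV[R]_d.

Lemma std_gauss_pdf_cube : exists2 gam : R, 0 < gam &
  forall x : V, cube 1 x -> gam <= std_gauss_pdf x.
Proof.
exists (heat_peak d 1 * expR (- (d%:R / 2))); first exact: (mulr_gt0 (heat_peak_gt0 d 1) (expR_gt0 _)).
move=> x cx; rewrite -heat1E /heat; apply: ler_wpM2l; first exact: (ltW (heat_peak_gt0 d 1)).
rewrite ler_expR lerN2 mulr1 ler_wpM2r ?invr_ge0//.
apply: (@le_trans _ _ (\sum_(i < d) 1)); last by rewrite sumr_const card_ord.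
apply: ler_sum => i _; have := cx i; rewrite /= in_itv/= -ler_norml => h.
by rewrite -real_normK ?num_real// expr_le1.
Qed.

Lemma lebesgue_cube_gt0 (M : R) : 0 < M -> (0 < lebesgue_rV R d (cube M))%E.
Proof.
move=> M0; rewrite (@lebesgue_rV_box R d (fun=> `[- M, M]%classic%R))//.
rewrite (eq_bigr (fun=> (M + M)%:E)).
  by rewrite prodEFin lte_fin prodr_gt0// => i _; rewrite addr_gt0.
by move=> i _; rewrite lebesgue_measure_itv/= lte_fin gtrN// opprK.
Qed.

End gaussian_cube.

Lemma half_below (R : realType) (a g q : R) :
  a <= g -> `|q - g| <= a / 2 -> a / 2 <= q.
Proof. by rewrite ler_norml => ag /andP[h _]; lra. Qed.

Section local_limit_converse.
Context dT (T : measurableType dT) (R : realType) (P : probability T R) (d : nat).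
Local Notation V := 'rV[R]_d.
Local Notation leb := (lebesgue_rV R d).
Variable xi : nat -> {RV P >-> V}.

Lemma ac_part_of_local_limit (Q Rm : nat -> {measure set V -> \bar R}) (q : nat -> V -> R) :
  (forall n A, (0 < n)%N -> measurable A ->
    distribution P (normalized_sum xi n) A = (Q n A + Rm n A)%E) ->
  (forall n, (0 < n)%N -> measurable_fun [set: V] (q n) /\
    forall A, measurable A -> Q n A = (\int[leb]_(y in A) (q n y)%:E)%E) ->
  (forall eps, 0 < eps -> exists N : nat, forall n, (N < n)%N -> forall x,
    `|q n x - std_gauss_pdf x| <= eps) ->
  exists n0 : nat, (0 < n0)%N /\ exists ac : {measure set V -> \bar R},
    is_ac_part leb (distribution P (normalized_sum xi n0)) ac /\
    (exists2 A, measurable A & ac A != 0%E).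
Proof.
move=> PE QE lim.
have [gam gam0 gamE] := std_gauss_pdf_cube R d.
have [N HN] := lim (gam / 2) (divr_gt0 gam0 (ltr0n _ 2)).
exists N.+1; split => //.
have [mq QN] := QE N.+1 isT.
have mC := @measurable_cube R d 1.
apply: (ac_part_ex (nu := Q N.+1) mC).
- by move=> B mB; rewrite [leRHS]PE// leeDl.
- move=> B mB B0; rewrite QN// null_set_integral//.
  by apply/measurable_EFinP; exact: measurable_funTS.
- rewrite QN//; apply: (@lt_le_trans _ _ (\int[leb]_(y in cube 1) (gam / 2)%:E)%E).
    rewrite integral_cst// mule_gt0 ?lte_fin ?divr_gt0//.
    exact: lebesgue_cube_gt0.
  have qC (y : V) : cube 1 y -> gam / 2 <= q N.+1 y.
    by move=> /gamE gy; exact: half_below gy (HN N.+1 (ltnSn N) y).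
  apply: ge0_le_integral => //.
  + by move=> y _; rewrite lee_fin divr_ge0// ltW.
  + by apply/measurable_EFinP; exact: measurable_funTS.
Qed.

End local_limit_converse.

Theorem theorem1p2 (R : realType) (d : nat) (d_gt0 : (0 < d)%N)
    (dT : measure_display) (T : measurableType dT) (P : probability T R)
    (xi : nat -> {RV P >-> 'rV[R]_d})
    (xi_indep : mutually_independent xi)
    (xi_idist : identically_distributed xi)
    (xi_L2 : forall k, square_integrable P (xi k))
    (xi_centered : forall k, centered P (xi k))
    (xi_cov : forall k, identity_covariance P (xi k)) :
  let Pn n := distribution P (normalized_sum xi n) in
  (exists n0 : nat, (0 < n0)%N /\
    exists ac : {measure set 'rV[R]_d -> \bar R},
      is_ac_part (lebesgue_rV R d) (Pn n0) ac /\
      (exists2 A, measurable A & ac A != 0%E))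
  <->
  (exists Q Rem : nat -> {measure set 'rV[R]_d -> \bar R},
    (forall n A, (0 < n)%N -> measurable A -> Pn n A = (Q n A + Rem n A)%E) /\
    (exists q : nat -> 'rV[R]_d -> R,
      (forall n, (0 < n)%N ->
        measurable_fun [set: 'rV[R]_d] (q n) /\
        (forall A, measurable A ->
          Q n A = (\int[lebesgue_rV R d]_(y in A) (q n y)%:E)%E)) /\
      ereal_sup (range (fun y => `|q n y - std_gauss_pdf y|%:E))
        @[n --> \oo] --> 0%E) /\
    (exists D rho : R, 0 < D /\ 0 < rho /\
      forall n, (0 < n)%N ->
        (Rem n [set: 'rV[R]_d] <= (D * expR (- rho * n%:R))%:E)%E)).
Proof.
move=> Pn; split; last first.
  move=> [Q [Rm [PE [[q [QE lim]] _]]]].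
  apply: (ac_part_of_local_limit PE QE).
  exact/(cvg_sup_dist_to0P (0 : 'rV[R]_d) q).
move=> [n0 [n00 [ac [acP [A0 mA0 acA0]]]]].
have [K1 [D [rho [K10 D0 rho0 H]]]] :=
  lipschitz_decomposition xi_indep xi_idist n00 acP mA0 acA0.
pose leb : {measure set 'rV[R]_d -> \bar R} := lebesgue_rV R d.
have /choice[F HF] : forall n, exists x : ('rV[R]_d -> R) *
    ({measure set 'rV[R]_d -> \bar R} * {measure set 'rV[R]_d -> \bar R}),
    (0 < n)%N -> [/\ measurable_fun setT x.1, forall y, 0 <= x.1 y,
      forall y z, `|x.1 y - x.1 z| <= K1 * \sum_i `|y ord0 i - z ord0 i|,
      forall A, measurable A -> x.2.1 A = (\int[leb]_(y in A) (x.1 y)%:E)%E &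
      (x.2.2 setT <= (D * expR (- rho * n%:R))%:E)%E /\
      forall A, measurable A -> Pn n A = (x.2.1 A + x.2.2 A)%E].
  (* The choice at n = 0 is arbitrary, as the requirements concern positive n. *)
  case=> [|n]; first by exists (cst 0, (leb, leb)).
  by have [q [Q [Rm HQ]]] := H n.+1 isT; exists (q, (Q, Rm)).
pose q n := (F n).1; pose Q n := (F n).2.1; pose Rm n := (F n).2.2.
exists Q, Rm; split; [|split].
- by move=> n A /HF[_ _ _ _ [_]]; exact.
- exists q; split; first by move=> n /HF[? _ _ ? _].
  apply/(cvg_sup_dist_to0P (0 : 'rV[R]_d) q).
  exact: (local_limit xi_indep xi_idist xi_L2 xi_centered xi_cov K10 D0 rho0 HF).
- exists D, rho; split => //; split => // n n_gt0.
  by have [_ _ _ _ []] := HF _ n_gt0.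
Qed.
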